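(* Let $(\mathcal A,\mathcal H,D)$ be a spectral triple and let $d:=d(\mathcal A,\mathcal H,D)\in[0,\infty]$ be its Hausdorff dimension. Then: (i) $d(\mathcal A,\mathcal H,D)=\overline{d}(|D|^{-1})$. (ii) $d$ is the unique exponent, if any, whose Hausdorff functional is non-trivial; that is, if $\alpha>0$ and the $\alpha$-dimensional Hausdorff functional is non-trivial, then $\alpha=d$. (iii) If $d\in(0,\infty)$, then $d$ is an exponent of singular traceability for $|D|^{-1}$.
   Context: A spectral triple $(\mathcal A,\mathcal H,D)$ consists of a $*$-algebra $\mathcal A$ of bounded operators acting on an infinite-dimensional Hilbert space $\mathcal H$ and a self-adjoint operator $D$ with compact resolvent such that $[D,a]$ is bounded for every $a\in\mathcal A$; it is assumed that $0$ is not an eigenvalue of $D$. For a compact operator $a$, $\mu_n(a)$, $n\ge0$, are the eigenvalues of $|a|$ in non-increasing order with multiplicity, $\mu_a(x)=\mu_n(a)$ for $x\in[n,n+1)$, and $S_a^{\uparrow}(t)=\int_0^t\mu_a(x)\,dx$. Set $\mathcal L^{1,\infty}=\{a \text{ compact}: S_a^{\uparrow}(t)/\log t \text{ is bounded as } t\to\infty\}$ and $\mathcal L^{1,\infty}_0=\{a\text{ compact}: S_a^{\uparrow}(t)/\log t\to0 \text{ as } t\to\infty\}$. The Dixmier trace $\mathrm{Tr}_\omega$ is the singular trace with domain $\mathcal L^{1,\infty}$ given on its positive elements by $\mathrm{Tr}_\omega(a)=\mathrm{Lim}_\omega\big(S_a^{\uparrow}(n)/\log n\big)$ for a suitable (dilation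 invariant) generalized limit $\mathrm{Lim}_\omega$ on bounded sequences, and $+\infty$ on other positive operators. The Hausdorff dimension is $d(\mathcal A,\mathcal H,D)=\inf\{d>0:|D|^{-d}\in\mathcal L^{1,\infty}_0\}=\sup\{d>0:|D|^{-d}\notin\mathcal L^{1,\infty}\}$ (these agree, with $\inf\emptyset=\infty$, $\sup\emptyset=0$). The $\alpha$-dimensional Hausdorff functional is $a\mapsto\mathrm{Tr}_\omega(a|D|^{-\alpha})$, $a\in\mathcal A$; it is non-trivial if $|D|^{-\alpha}\in\mathcal L^{1,\infty}$ and the functional is not identically zero. For a compact operator $a$ with $\mu_a>0$: $\overline{d}(a)=\Big(\liminf_{t\to\infty}\frac{-\log\mu_a(e^t)}{t}\Big)^{-1}\in[0,\infty]$ (with $1/0=\infty$, $1/\infty=0$). A singular trace on $\mathcal B(\mathcal H)$ is a positive tracial weight on $\mathcal B(\mathcal H)_+$ with values in $[0,\infty]$, vanishing on finite rank projections. $\alpha>0$ is an exponent of singular traceability for $a$ if some singular trace is finite and nonzero on $|a|^\alpha$. *)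

(* Defs.v *)
From HB Require Import structures.
From mathcomp Require Import all_boot all_order all_algebra.
From mathcomp Require Import sesquilinear complex.
From mathcomp Require Import all_classical all_reals all_analysis.

Set Implicit Arguments.
Unset Strict Implicit.
Unset Printing Implicit Defensive.

Import Order.TTheory GRing.Theory Num.Theory.
Import numFieldNormedType.Exports.

Local Open Scope classical_set_scope.
Local Open Scope ring_scope.
Local Open Scope complex_scope.

(* A complex Hilbert space: [dotp] is linear in its first argument and
   conjugate-linear in the second one; the norm takes its (real) values in
   R[i]. *)
HB.mixin Record isHilbert (R : realType) H
    of CompleteNormedModule R[i] H := {
  dotp : {dot H for (@Num.conj R[i])} ;
  dotp_normE : forall x : H, `|x| ^+ 2 = dotp x x
}.

#[short(type="hilbertType")]
HB.structure Definition Hilbert (R : realType) :=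
  {H of CompleteNormedModule R[i] H & isHilbert R H}.

Section operators.
Context {R : realType} {H : hilbertType R}.
Implicit Types (a b T P : H -> H) (V : set H).

Definition in_span n (e : 'I_n -> H) (x : H) : Prop :=
  exists c : 'I_n -> R[i], x = \sum_i c i *: e i.

Definition lin_indep n (e : 'I_n -> H) : Prop :=
  forall c : 'I_n -> R[i], \sum_i c i *: e i = 0 -> forall i, c i = 0.

Definition has_dim V n : Prop :=
  exists2 e : 'I_n -> H, lin_indep e & V = [set x | in_span e x].

Definition infinite_dimensional : Prop :=
  forall n (e : 'I_n -> H), exists x, ~ in_span e x.

Definition bounded_op T : Prop :=
  linear T /\ exists M : R, forall x, `|T x| <= M%:C * `|x|.

Definition compact_op T : Prop :=
  linear T /\ precompact (T @` [set x : H | `|x| <= 1]).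

Definition is_adjoint T b : Prop := forall x y, dotp (T x) y = dotp x (b y).

Definition adjoint T : H -> H := get [set b | is_adjoint T b].

Definition positive_op T : Prop := bounded_op T /\ forall x, 0 <= dotp (T x) x.

(* |a|, the positive square root of a* a. *)
Definition abs_op a : H -> H :=
  get [set P | positive_op P /\ P \o P = adjoint a \o a].

Definition finite_rank_projection P : Prop :=
  [/\ bounded_op P, P \o P = P, is_adjoint P P &
      exists n (e : 'I_n -> H), forall x, in_span e (P x)].

End operators.
Arguments infinite_dimensional {R} H.

(* A possibly unbounded operator; the values of [papp] outside [pdom] are
   irrelevant. *)
Record partial_op (H : Type) := PartialOp { pdom : set H ; papp : H -> H }.

Definition total_op (H : Type) (T : H -> H) : partial_op H := PartialOp setT T.

Section unbounded_operators.
Context {R : realType} {H : hilbertType R}.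
Implicit Types D : partial_op H.

Definition linear_partial_op D : Prop :=
  pdom D 0 /\
  forall (c : R[i]) x y, pdom D x -> pdom D y ->
    pdom D (c *: x + y) /\ papp D (c *: x + y) = c *: papp D x + papp D y.

(* The last clause says that D* and D have the same graph. *)
Definition self_adjoint D : Prop :=
  [/\ linear_partial_op D, dense (pdom D) &
      forall y z, (forall x, pdom D x -> dotp (papp D x) y = dotp x z) <->
                  (pdom D y /\ z = papp D y)].

Definition is_resolvent D (z : R[i]) (S : H -> H) : Prop :=
  [/\ bounded_op S,
      forall x, pdom D (S x) /\ papp D (S x) - z *: S x = x &
      forall x, pdom D x -> S (papp D x - z *: x) = x].

Definition compact_resolvent D : Prop :=
  exists z S, is_resolvent D z S /\ compact_op S.

Definition commutator_bounded D (a : H -> H) : Prop :=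
  (forall x, pdom D x -> pdom D (a x)) /\
  exists M : R, forall x, pdom D x ->
    `|papp D (a x) - a (papp D x)| <= M%:C * `|x|.

(* f(D) for a self-adjoint operator D whose eigenvectors span a dense
   subspace: the bounded operator acting as f(l) on the eigenspace of each
   eigenvalue l. It is used below only for D with compact resolvent and for
   D compact and positive. *)
Definition fun_calc (f : R -> R) D : H -> H :=
  get [set B | bounded_op B /\
    forall (l : R) x, pdom D x -> papp D x = l%:C *: x ->
      B x = (f l)%:C *: x].

(* |D|^s *)
Definition abs_power D (s : R) : H -> H := fun_calc (fun l => `|l| `^ s) D.

End unbounded_operators.

Record star_algebra (R : realType) (H : hilbertType R) (A : set (H -> H)) :
  Prop := StarAlgebra {
  star_algebra_bounded : forall a, A a -> bounded_op a ;
  star_algebra0 : A (fun=> 0) ;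
  star_algebraP : forall (c : R[i]) a b, A a -> A b ->
    A (fun x => c *: a x + b x) ;
  star_algebraM : forall a b, A a -> A b -> A (a \o b) ;
  star_algebra_adj : forall a, A a -> A (adjoint a)
}.

Record spectral_triple (R : realType) (H : hilbertType R)
    (A : set (H -> H)) (D : partial_op H) : Prop := SpectralTriple {
  triple_infinite : infinite_dimensional H ;
  triple_algebra : star_algebra A ;
  triple_self_adjoint : self_adjoint D ;
  triple_compact_resolvent : compact_resolvent D ;
  triple_commutator : forall a, A a -> commutator_bounded D a ;
  triple_injective : forall x, pdom D x -> papp D x = 0 -> x = 0
}.

Section singular_values.
Context {R : realType} {H : hilbertType R}.
Implicit Types (a P : H -> H).

(* m lists the eigenvalues of the compact positive operator P in
   non-increasing order with multiplicity; 0 only pads the list when P has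
   finitely many positive eigenvalues. *)
Definition eigenvalue_seq P (m : nat -> R) : Prop :=
  [/\ (forall i j, (i <= j)%N -> m j <= m i),
      (forall n, 0 <= m n) &
      forall l : R, 0 < l -> exists k,
        (([set n | m n = l] #= `I_k)%card) /\ has_dim [set x | P x = l%:C *: x] k].

Definition mu_seq a : nat -> R :=
  get [set m | eigenvalue_seq (abs_op a) m].

Definition mu_fun a (x : R) : R := mu_seq a (Num.truncn x).

Definition S_up a (t : R) : R :=
  Rintegral lebesgue_measure `[0, t] (mu_fun a).

Definition L1oo a : Prop :=
  compact_op a /\ exists M, \forall t \near +oo, S_up a t / ln t <= M.

Definition L1oo0 a : Prop :=
  compact_op a /\ S_up a t / ln t @[t --> +oo] --> (0 : R).

(* 1/0 = +oo and 1/+oo = 0 hold for the inverse of \bar R. *)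
Definition d_bar a : \bar R :=
  (limf_einf (fun t : R => (- ln (mu_fun a (expR t)) / t)%:E)
     (pinfty_nbhs R))^-1%E.

Definition hausdorff_dim (D : partial_op H) : \bar R :=
  ereal_inf [set d%:E | d in [set d | 0 < d /\ L1oo0 (abs_power D (- d))]].

End singular_values.

Section traces.
Context {R : realType} {H : hilbertType R}.
Implicit Types (a b P : H -> H).

Record generalized_limit (Lim : (nat -> R) -> R) : Prop := GeneralizedLimit {
  glim_linear : forall (c : R) (u v : nat -> R), bounded_fun u -> bounded_fun v ->
    Lim (fun n => c * u n + v n) = c * Lim u + Lim v ;
  glim_ge0 : forall u : nat -> R, bounded_fun u -> (forall n, 0 <= u n) -> 0 <= Lim u ;
  glim_cvg : forall (u : nat -> R) (l : R), u @ \oo --> l -> Lim u = l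
}.

(* Invariance under the dilation by 2, which is what makes the formula for
   the Dixmier trace additive on positive operators. *)
Definition dilation_invariant (Lim : (nat -> R) -> R) : Prop :=
  forall u : nat -> R, bounded_fun u -> Lim (fun n => u (2 * n)%N) = Lim u.

Definition dixmier_weight (Lim : (nat -> R) -> R) a : \bar R :=
  if `[< L1oo a >] then (Lim (fun n => S_up a n%:R / ln n%:R))%:E else +oo%E.

Definition is_dixmier_trace Lim (f : (H -> H) -> R[i]) : Prop :=
  (forall (c : R[i]) a b, L1oo a -> L1oo b ->
     f (fun x => c *: a x + b x) = c * f a + f b) /\
  (forall a, positive_op a -> L1oo a -> f a = (fine (dixmier_weight Lim a))%:C).

(* The linear extension of the Dixmier weight to its domain. *)
Definition dixmier_trace Lim : (H -> H) -> R[i] :=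
  xget (fun=> 0) [set f | is_dixmier_trace Lim f].

Definition hausdorff_functional Lim (D : partial_op H) (al : R) a : R[i] :=
  dixmier_trace Lim (a \o abs_power D (- al)).

Definition nontrivial_hausdorff_functional Lim (A : set (H -> H))
    (D : partial_op H) (al : R) : Prop :=
  L1oo (abs_power D (- al)) /\
  exists2 a, A a & hausdorff_functional Lim D al a != 0.

Record singular_trace (tau : (H -> H) -> \bar R) : Prop := SingularTrace {
  strace_ge0 : forall a, positive_op a -> (0 <= tau a)%E ;
  straceD : forall a b, positive_op a -> positive_op b ->
    tau (fun x => a x + b x) = (tau a + tau b)%E ;
  straceZ : forall (c : R) a, 0 <= c -> positive_op a ->
    tau (fun x => c%:C *: a x) = (c%:E * tau a)%E ;
  strace_tracial : forall a, bounded_op a ->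
    tau (adjoint a \o a) = tau (a \o adjoint a) ;
  strace_finite_rank : forall P, finite_rank_projection P -> tau P = 0%E
}.

Definition singular_traceability_exponent a (al : R) : Prop :=
  0 < al /\
  exists2 tau, singular_trace tau &
    let x := tau (fun_calc (fun l => l `^ al) (total_op (abs_op a))) in
    x \is a fin_num /\ x != 0%E.

End traces.

(* Main.v *)
(* By the spectral theorem, a self-adjoint operator with compact resolvent and
   trivial kernel is diagonal in an orthonormal basis, so that |D|^(-s) has the
   singular values mu_n^s, where the mu_n decrease to 0. If mu^al has
   logarithmically bounded partial sums, then the sum of mu_n^be converges for
   every be > al. Hence the Hausdorff dimension d is the exponent of convergence
   of mu, which gives (i). Moreover, for al > d the operator |D|^(-al) is of trace
   class, so the Dixmier trace of a |D|^(-al) vanishes for every bounded a, which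
   gives (ii). For (iii), let nu = mu^d. If the sum of nu diverges, then
   convergence of the sums of nu^p for p > 1 prevents the partial sums of nu from
   growing by a fixed factor over every long dyadic block; averaging the ratios
   of partial sums over the slow blocks yields a singular trace with value 1 at
   nu. If the sum of nu converges, the same argument applies to the tails, by
   divergence of the sums of nu^p for p < 1. *)
Require Import Defs.
From mathcomp Require Import all_boot all_order all_algebra.
From mathcomp Require Import sesquilinear complex.
From mathcomp Require Import all_classical all_reals all_analysis.
From mathcomp Require Import ring lra zify.
From mathcomp Require Import finmap measurable_realfun.

Set Implicit Arguments.
Unset Strict Implicit.
Unset Printing Implicit Defensive.

Import Order.TTheory GRing.Theory Num.Theory.
Import numFieldNormedType.Exports.

Local Open Scope classical_set_scope.
Local Open Scope ring_scope.
Local Open Scope complex_scope.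

(** * Hilbert space geometry *)

(** The operators and sequences of the statement are obtained by choice ([get], [xget]), so each
    identification needs existence and uniqueness. The diagonal operators [diagop] serve as models:
    in one orthonormal eigenbasis of [D], the operators [abs_power], [abs_op] and [fun_calc] become
    explicit sequences. The obstacle in (ii) is that [a |D|^(-al)] need not be positive, while the
    Dixmier trace is prescribed by a formula on positive operators only. Trace class is therefore
    encoded by a bound on bilinear sums, visibly stable under the combinations of a polarization
    identity, before any singular value is computed. The obstacle in (iii) is that a singular trace
    must be additive on all positive bounded operators, compact or not, whereas singular values are
    not additive. Ky Fan sums exist for all of them and are additive up to a doubling of the index;
    in a mean over dyadic scales that doubling is a shift by one scale, which changes only the two
    end terms. Summability at the exponent [d] itself is undecided, hence two constructions. *)

Section complex_numbers.
Context {R : realType}.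
Implicit Types c d : R[i].

(** The squared modulus with values in [R], so that estimates take place between reals and not in
    the partial order of [R[i]]. *)
Definition sqc c : R := complex.Re c ^+ 2 + complex.Im c ^+ 2.

Lemma ReD c d : complex.Re (c + d) = complex.Re c + complex.Re d.
Proof. by case: c d => [? ?] [? ?]. Qed.

Lemma ReN c : complex.Re (- c) = - complex.Re c.
Proof. by case: c. Qed.

Lemma ReB c d : complex.Re (c - d) = complex.Re c - complex.Re d.
Proof. by rewrite ReD ReN. Qed.

Lemma Re_sum I r (P : pred I) (F : I -> R[i]) :
  complex.Re (\sum_(i <- r | P i) F i) = \sum_(i <- r | P i) complex.Re (F i).
Proof. exact: (big_morph _ ReD). Qed.

Lemma Re_realM (r : R) c : complex.Re (r%:C * c) = r * complex.Re c.
Proof. by case: c => [? ?] /=; rewrite mul0r subr0. Qed.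

Lemma Re_conjC c : complex.Re (Num.conj c) = complex.Re c.
Proof. by case: c. Qed.

Lemma sqc_ge0 c : 0 <= sqc c.
Proof. by rewrite addr_ge0 ?sqr_ge0. Qed.

Lemma sqc_eq0 c : sqc c = 0 -> c = 0.
Proof.
case: c => a b; rewrite /sqc /= => h.
have a0 : a = 0 by nra.
have b0 : b = 0 by nra.
by rewrite a0 b0.
Qed.

Lemma sqc0 : sqc 0 = 0.
Proof. by rewrite /sqc /=; lra. Qed.

Lemma sqc_real (r : R) : sqc r%:C = r ^+ 2.
Proof. by rewrite /sqc /=; lra. Qed.

Lemma sqcM c d : sqc (c * d) = sqc c * sqc d.
Proof. by case: c d => [? ?] [? ?]; rewrite /sqc /=; ring. Qed.

Lemma sqcN c : sqc (- c) = sqc c.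
Proof. by case: c => [? ?]; rewrite /sqc /=; ring. Qed.

Lemma sqcJ c : sqc (Num.conj c) = sqc c.
Proof. by case: c => [? ?]; rewrite /sqc /=; ring. Qed.

Lemma mulcJ c : c * Num.conj c = (sqc c)%:C.
Proof.
by case: c => [? ?]; rewrite /sqc /=; apply/eqP; rewrite eq_complex /=;
  apply/andP; split; apply/eqP; ring.
Qed.

Lemma invC_conj c : (sqc c)^-1%:C * Num.conj c = c^-1.
Proof.
have [->|c0] := eqVneq c 0; first by rewrite rmorph0 mulr0 invr0.
have s0 : sqc c != 0 by apply/eqP => /sqc_eq0 /eqP; rewrite (negPf c0).
by apply: (mulIf c0); rewrite mulVf // -mulrA (mulrC _ c) mulcJ -rmorphM /= mulVf.
Qed.

Lemma Re_le_sqc c : complex.Re c ^+ 2 <= sqc c.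
Proof. by rewrite lerDl sqr_ge0. Qed.

Lemma conj_real (r : R) : Num.conj r%:C = r%:C.
Proof. exact: conjc_real. Qed.

End complex_numbers.

Section inner_product.
Context {R : realType} {H : hilbertType R}.
Implicit Types (x y z : H) (c : R[i]).

Lemma dotpC x y : dotp x y = Num.conj (dotp y x).
Proof. by rewrite hermC expr0 mul1r. Qed.

Lemma dotpDl x y z : dotp (x + y) z = dotp x z + dotp y z.
Proof. exact: linearDl. Qed.
Lemma dotpDr x y z : dotp x (y + z) = dotp x y + dotp x z.
Proof. exact: linearDr. Qed.
Lemma dotpNl x z : dotp (- x) z = - dotp x z.
Proof. exact: linearNl. Qed.
Lemma dotpNr x z : dotp x (- z) = - dotp x z.
Proof. exact: linearNr. Qed.
Lemma dotpBl x y z : dotp (x - y) z = dotp x z - dotp y z.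
Proof. by rewrite dotpDl dotpNl. Qed.
Lemma dotpBr x y z : dotp x (y - z) = dotp x y - dotp x z.
Proof. by rewrite dotpDr dotpNr. Qed.
Lemma dotpZl c x z : dotp (c *: x) z = c * dotp x z.
Proof. exact: linearZl_LR. Qed.
Lemma dotpZr c x z : dotp x (c *: z) = Num.conj c * dotp x z.
Proof. by rewrite dotpC dotpZl rmorphM [in RHS]dotpC. Qed.
Lemma dotp0l z : dotp 0 z = 0.
Proof. exact: linear0l. Qed.
Lemma dotp0r z : dotp z 0 = 0.
Proof. exact: linear0r. Qed.

Lemma dotp_suml I r (P : pred I) (F : I -> H) z :
  dotp (\sum_(i <- r | P i) F i) z = \sum_(i <- r | P i) dotp (F i) z.
Proof. exact: (big_morph (dotp^~ z) (fun x y => dotpDl x y z) (dotp0l z)). Qed.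

Lemma dotp_sumr I r (P : pred I) (F : I -> H) z :
  dotp z (\sum_(i <- r | P i) F i) = \sum_(i <- r | P i) dotp z (F i).
Proof. exact: (big_morph (dotp z) (dotpDr z) (dotp0r z)). Qed.

Definition nsq x : R := complex.Re (dotp x x).
Definition nrm x : R := Num.sqrt (nsq x).

Lemma dotpxx x : dotp x x = (nsq x)%:C.
Proof.
apply/eqP; rewrite eq_complex /nsq /= eqxx /=.
by have := dnorm_ge0 dotp x; rewrite lecE /= => /andP[/eqP-> _].
Qed.

Lemma nsq_ge0 x : 0 <= nsq x.
Proof. by have := dnorm_ge0 dotp x; rewrite dotpxx ler0c. Qed.

Lemma nsq_eq0 x : nsq x = 0 -> x = 0.
Proof. by move=> h; apply/eqP; rewrite -(dnorm_eq0 dotp) dotpxx h. Qed.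

Lemma nsq0 : nsq 0 = 0.
Proof. by rewrite /nsq dotp0l. Qed.

Lemma nsq_gt0 x : x <> 0 -> 0 < nsq x.
Proof.
by move=> x0; rewrite lt0r nsq_ge0 andbT; apply/eqP => /nsq_eq0.
Qed.

Lemma nsqD x y : nsq (x + y) = nsq x + nsq y + 2 * complex.Re (dotp x y).
Proof.
rewrite /nsq dotpDl !dotpDr !ReD (dotpC y x) Re_conjC; ring.
Qed.

Lemma nsqN x : nsq (- x) = nsq x.
Proof. by rewrite /nsq dotpNl dotpNr opprK. Qed.

Lemma nsqB x y : nsq (x - y) = nsq x + nsq y - 2 * complex.Re (dotp x y).
Proof. by rewrite nsqD nsqN dotpNr ReN; ring. Qed.

Lemma nsqZ c x : nsq (c *: x) = sqc c * nsq x.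
Proof.
by rewrite /nsq dotpZl dotpZr mulrA mulcJ Re_realM.
Qed.

Lemma cauchy_schwarz x y : sqc (dotp x y) <= nsq x * nsq y.
Proof.
have [->|/eqP/nsq_gt0 y0] := eqVneq y 0; first by rewrite dotp0r sqc0 nsq0 mulr0.
(* This is [nsq y] times the component of [x] orthogonal to [y]; the factor clears the division. *)
have := nsq_ge0 ((nsq y)%:C *: x - dotp x y *: y).
rewrite nsqB !nsqZ sqc_real dotpZl dotpZr (mulrC _ (dotp x y)) mulcJ -rmorphM /=.
have := nsq_ge0 x; move: (nsq y) y0 (nsq x) (sqc _) => a a0 b c b0 h.
have h2 : 0 <= a * (b * a - c) by nra.
by rewrite pmulr_rge0 // subr_ge0 in h2.
Qed.

Lemma nrm_ge0 x : 0 <= nrm x.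
Proof. exact: sqrtr_ge0. Qed.

Lemma nrm_sqr x : nrm x ^+ 2 = nsq x.
Proof. by rewrite sqr_sqrtr ?nsq_ge0. Qed.

Lemma nrm_eq0 x : nrm x = 0 -> x = 0.
Proof. by move=> h; apply: nsq_eq0; rewrite -nrm_sqr h expr0n. Qed.

Lemma nrm_gt0 x : x <> 0 -> 0 < nrm x.
Proof. by move=> x0; rewrite sqrtr_gt0 nsq_gt0. Qed.

Lemma nrm0 : nrm 0 = 0.
Proof. by rewrite /nrm nsq0 sqrtr0. Qed.

Lemma nrmE x : `|x| = (nrm x)%:C.
Proof.
apply/eqP; rewrite -(eqrXn2 (n:=2)) //; last by rewrite ler0c nrm_ge0.
by rewrite dotp_normE dotpxx -rmorphXn /= nrm_sqr.
Qed.

Lemma nrmN x : nrm (- x) = nrm x.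
Proof. by rewrite /nrm nsqN. Qed.

Lemma nrmB x y : nrm (x - y) = nrm (y - x).
Proof. by rewrite -nrmN opprB. Qed.

Lemma nrmZ c x : nrm (c *: x) = Num.sqrt (sqc c) * nrm x.
Proof. by rewrite /nrm nsqZ sqrtrM ?sqc_ge0. Qed.

Lemma nrmZr (r : R) x : nrm (r%:C *: x) = `|r| * nrm x.
Proof. by rewrite nrmZ sqc_real sqrtr_sqr. Qed.

Lemma Re_dotp_le x y : `|complex.Re (dotp x y)| <= nrm x * nrm y.
Proof.
rewrite -sqrtr_sqr /nrm -sqrtrM ?nsq_ge0 // ler_wsqrtr //.
exact: le_trans (Re_le_sqc _) (cauchy_schwarz _ _).
Qed.

Lemma nrmD x y : nrm (x + y) <= nrm x + nrm y.
Proof.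
rewrite -(ler_pXn2r (n:=2)) ?nnegrE ?addr_ge0 ?nrm_ge0 // nrm_sqr nsqD.
rewrite -!nrm_sqr; have := Re_dotp_le x y; rewrite ler_norml => /andP[_ h]; nra.
Qed.

Lemma nrm_tri x y z : nrm (x - z) <= nrm (x - y) + nrm (y - z).
Proof. by apply: le_trans (nrmD _ _); rewrite addrA subrK. Qed.

Lemma nrm_sum n (F : nat -> H) :
  nrm (\sum_(i < n) F i) <= \sum_(i < n) nrm (F i).
Proof.
elim: n => [|n IH]; first by rewrite !big_ord0 nrm0.
by rewrite !big_ord_recr /=; apply: le_trans (nrmD _ _) _; rewrite lerD2r.
Qed.

Lemma nrm_le x (M : R) : 0 <= M -> nsq x <= M ^+ 2 -> nrm x <= M.
Proof.
by move=> M0 h; rewrite -(ler_pXn2r (n:=2)) ?nnegrE ?nrm_ge0 // nrm_sqr.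
Qed.

Lemma dotp_inj x y : (forall z, dotp x z = dotp y z) -> x = y.
Proof.
move=> h; apply/eqP; rewrite -subr_eq0; apply/eqP/nsq_eq0.
by rewrite /nsq dotpBl h subrr.
Qed.

Lemma nrm_eps x y : (forall e : R, 0 < e -> nrm (x - y) <= e) -> x = y.
Proof.
move=> h; apply/eqP; rewrite -subr_eq0; apply/eqP/nrm_eq0/eqP.
by rewrite eq_le nrm_ge0 andbT; apply/ler_addgt0Pr => e e0; rewrite add0r; exact: h.
Qed.

Lemma parallelogram x y : nsq (x + y) + nsq (x - y) = 2 * nsq x + 2 * nsq y.
Proof. by rewrite nsqD nsqB; ring. Qed.

End inner_product.

Section real_sequences.
Context {R : realType}.

Lemma monotone_cauchy (s : nat -> R) (M : R) :
  (forall n, s n <= s n.+1) -> (forall n, s n <= M) ->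
  forall e, 0 < e -> exists N, forall n m, (N <= n)%N -> (N <= m)%N ->
    `|s m - s n| <= e.
Proof.
move=> smono sM e e0.
have smono2 : forall i j, (i <= j)%N -> s i <= s j.
  by move=> i j; exact: (homo_leq (@lexx _ R) (@le_trans _ R)).
have hs : has_sup (range s).
  by split; [exists (s 0%N), 0%N|exists M => _ [n _ <-]].
have [_ [N _ <-] hN] := sup_adherent e0 hs.
exists N => n m Nn Nm.
have ub k : s k <= sup (range s) by apply: ub_le_sup; [case: hs|exists k].
have := ub n; have := ub m; have := smono2 _ _ Nn; have := smono2 _ _ Nm.
rewrite ler_norml; lra.
Qed.

(** Reduces complex identities that are linear in a vector to their real parts: multiplying the
    vector by ['i] gives the imaginary part. *)
Lemma complex_ReiP (c d : R[i]) : complex.Re c = complex.Re d ->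
  complex.Re ('i%C * c) = complex.Re ('i%C * d) -> c = d.
Proof.
case: c d => [a b] [a' b'] /= -> h; congr (_ +i* _); lra.
Qed.

End real_sequences.

Section orthonormal_families.
Context {R : realType} {H : hilbertType R}.
Implicit Types (x y z : H) (f g : nat -> H).

Definition orthof n f := forall i j, (i < n)%N -> (j < n)%N ->
  dotp (f i) (f j) = (i == j)%:R.

Definition onseq f := forall i j, dotp (f i) (f j) = (i == j)%:R.

Lemma onseq_orthof f n : onseq f -> orthof n f.
Proof. by move=> h i j _ _. Qed.

Lemma orthof_dotp n f (c : nat -> R[i]) j : orthof n f -> (j < n)%N ->
  dotp (\sum_(i < n) c i *: f i) (f j) = c j.
Proof.
move=> fo jn; rewrite dotp_suml.
rewrite (bigD1 (Ordinal jn)) //= dotpZl fo // eqxx mulr1 big1 ?addr0 // => i /eqP ij.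
rewrite dotpZl fo //; case: eqP => [e|_]; last by rewrite mulr0.
by case: ij; apply/val_inj.
Qed.

Lemma orthof_nsq n f (c : nat -> R[i]) : orthof n f ->
  nsq (\sum_(i < n) c i *: f i) = \sum_(i < n) sqc (c i).
Proof.
move=> fo; rewrite /nsq dotp_suml.
rewrite Re_sum.
apply: eq_bigr => i _.
by rewrite dotpZl dotpC orthof_dotp // mulcJ.
Qed.

Definition oproj n f x := \sum_(i < n) dotp x (f i) *: f i.

Lemma oproj_dotp n f x j : orthof n f -> (j < n)%N ->
  dotp (x - oproj n f x) (f j) = 0.
Proof.
move=> fo jn; rewrite dotpBl (orthof_dotp (fun i => dotp x (f i))) //.
by rewrite subrr.
Qed.

Lemma oproj_nsq n f x : orthof n f ->
  nsq (x - oproj n f x) = nsq x - \sum_(i < n) sqc (dotp x (f i)).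
Proof.
move=> fo; rewrite nsqB (orthof_nsq (fun i => dotp x (f i))) //.
rewrite dotp_sumr Re_sum.
under [X in 2 * X]eq_bigr => i _ do rewrite dotpZr mulrC mulcJ /=.
by ring.
Qed.

Definition bessel_family n g := forall x,
  \sum_(i < n) sqc (dotp x (g i)) <= nsq x.

Lemma bessel n f : orthof n f -> bessel_family n f.
Proof.
by move=> fo x; rewrite -subr_ge0 -oproj_nsq // nsq_ge0.
Qed.

Definition snoc n f y : nat -> H := fun i => if (i < n)%N then f i else y.

Lemma orthof_snoc n f y : orthof n f -> nsq y = 1 ->
  (forall i, (i < n)%N -> dotp y (f i) = 0) -> orthof n.+1 (snoc n f y).
Proof.
move=> fo y1 yf i j; rewrite /snoc !ltnS => ilen jlen.
case: (ltnP i n) => [ii|ni]; case: (ltnP j n) => [jj|nj].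
- exact: fo.
- by rewrite dotpC yf // rmorph0; case: eqP => // ij; lia.
- by rewrite yf //; case: eqP => // ij; lia.
- have -> : i = j by lia.
  by rewrite eqxx dotpxx y1.
Qed.

Lemma sum_snoc n f y (V : nmodType) (F : nat -> H -> V) :
  \sum_(i < n.+1) F i (snoc n f y i) = \sum_(i < n) F i (f i) + F n y.
Proof.
rewrite big_ord_recr /= /snoc ltnn; congr (_ + _).
by apply: eq_bigr => i _; rewrite ltn_ord.
Qed.

Lemma unit_normalize x : x <> 0 ->
  nsq ((nrm x)^-1%:C *: x) = 1.
Proof.
move=> x0; rewrite nsqZ sqc_real -nrm_sqr -exprMn mulVf ?expr1n //.
by rewrite gt_eqF // nrm_gt0.
Qed.

Lemma oproj_snoc n f y x : oproj n.+1 (snoc n f y) x = oproj n f x + dotp x y *: y.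
Proof. exact: (sum_snoc _ _ _ (fun _ z => dotp x z *: z)). Qed.

Lemma exists_orthogonal n f : infinite_dimensional H -> orthof n f ->
  exists y, nsq y = 1 /\ forall i, (i < n)%N -> dotp y (f i) = 0.
Proof.
move=> infH fo; have [x xf] := infH n f.
set y := x - oproj n f x.
have y0 : y <> 0.
  move=> /eqP; rewrite subr_eq0 => /eqP xE; apply: xf.
  by exists (fun i => dotp x (f i)).
exists ((nrm y)^-1%:C *: y); split; first exact: unit_normalize.
by move=> i i_n; rewrite dotpZl oproj_dotp // mulr0.
Qed.

(** The vectors [v i] may be dependent. When [v m] already lies in the span, infinite dimension
    supplies a filler orthogonal to the previous vectors, so that exactly [m] orthonormal vectors
    come out. *)
Lemma gram_schmidt (m : nat) (v : nat -> H) : infinite_dimensional H ->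
  exists f, orthof m f /\ forall i, (i < m)%N -> v i = oproj m f (v i).
Proof.
move=> infH; elim: m => [|m [f [fo fv]]].
  by exists v; split => // i j; rewrite ltn0.
have [y [y1 yf vm]] : exists y, [/\ nsq y = 1,
    forall i, (i < m)%N -> dotp y (f i) = 0 &
    v m = oproj m f (v m) + dotp (v m) y *: y].
  have [vE|/eqP vE] := eqVneq (v m - oproj m f (v m)) 0.
    have [y [y1 yf]] := exists_orthogonal infH fo.
    exists y; split => //.
    move/eqP: vE; rewrite subr_eq0 => /eqP vE.
    suff -> : dotp (v m) y = 0 by rewrite scale0r addr0.
    rewrite vE /oproj dotp_suml big1 // => i _.
    by rewrite dotpZl (dotpC (f _)) yf // rmorph0 mulr0.
  set w := v m - _ in vE *; set y := (nrm w)^-1%:C *: w.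
  have yf i : (i < m)%N -> dotp y (f i) = 0.
    by move=> i_n; rewrite dotpZl oproj_dotp // mulr0.
  have wE : w = (nrm w)%:C *: y.
    by rewrite /y scalerA -rmorphM /= mulfV ?scale1r // gt_eqF // nrm_gt0.
  have y1 : nsq y = 1 by exact: unit_normalize.
  exists y; split => //.
  have vE2 : v m = oproj m f (v m) + w by rewrite /w addrC subrK.
  rewrite [LHS]vE2; congr (_ + _); rewrite vE2 dotpDl.
  rewrite dotp_suml big1 ?add0r.
    by rewrite {2}wE dotpZl dotpxx y1 mulr1 -wE.
  by move=> i _; rewrite dotpZl (dotpC (f _)) yf // rmorph0 mulr0.
exists (snoc m f y); split; first exact: orthof_snoc.
move=> i; rewrite ltnS leq_eqVlt => /orP[/eqP ->|im]; rewrite oproj_snoc //.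
rewrite -fv //; suff -> : dotp (v i) y = 0 by rewrite scale0r addr0.
rewrite (fv i im) dotp_suml big1 // => k _.
by rewrite dotpZl (dotpC (f _)) yf // rmorph0 mulr0.
Qed.

End orthonormal_families.

(** * Norm convergence, completeness and Riesz representation *)

Section convergence.
Context {R : realType} {H : hilbertType R}.
Implicit Types (x y z l : H) (u v f : nat -> H).

Definition hcv u l := forall e : R, 0 < e ->
  exists N, forall n, (N <= n)%N -> nrm (u n - l) <= e.

Lemma hilbert_complete u :
  (forall e : R, 0 < e -> exists N, forall n m, (N <= n)%N -> (N <= m)%N ->
    nrm (u n - u m) <= e) -> exists l, hcv u l.
Proof.
move=> cu.
have cv : cvg (u @ \oo).
  apply/cauchy_cvgP/cauchyP => e e0.
  have eE : e = (complex.Re e)%:C.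
    by apply/eqP; rewrite eq_complex /= eqxx; move: e0; rewrite ltcE /= => /andP[].
  have e'0 : 0 < complex.Re e / 2 by move: e0; rewrite ltcE /= => /andP[_ ?]; lra.
  have [N hN] := cu _ e'0.
  exists (u N); exists N => // n /= Nn.
  rewrite -ball_normE /ball_ /= nrmE eE ltcR.
  by apply: le_lt_trans (hN _ _ (leqnn _) Nn) _; lra.
exists (lim (u @ \oo)) => e e0.
have /cvgrPdist_lt/(_ e%:C) := cv; rewrite ltcR => /(_ e0)[N _ hN].
exists N => n Nn; have := hN n Nn; rewrite /= nrmE ltcR nrmB; exact: ltW.
Qed.

Lemma hcvD u v l k : hcv u l -> hcv v k -> hcv (fun n => u n + v n) (l + k).
Proof.
move=> ul vk e e0; have e2 : 0 < e / 2 by lra.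
have [N hN] := ul _ e2; have [M hM] := vk _ e2.
exists (maxn N M) => n; rewrite geq_max => /andP[Nn Mn].
rewrite opprD addrACA; apply: le_trans (nrmD _ _) _.
by have := hN n Nn; have := hM n Mn; lra.
Qed.

Lemma hcvZ u l (c : R[i]) : hcv u l -> hcv (fun n => c *: u n) (c *: l).
Proof.
move=> ul e e0; set r := Num.sqrt (sqc c).
have r0 : 0 <= r by exact: sqrtr_ge0.
have e2 : 0 < e / (r + 1) by rewrite divr_gt0 //; lra.
have [N hN] := ul _ e2; exists N => n Nn.
rewrite -scalerBr nrmZ -/r; have := hN n Nn.
have := nrm_ge0 (u n - l); rewrite ler_pdivlMr; last lra.
by nra.
Qed.

Lemma hcv_uniq u l k : hcv u l -> hcv u k -> l = k.
Proof.
move=> ul uk; apply: nrm_eps => e e0; have e2 : 0 < e / 2 by lra.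
have [N hN] := ul _ e2; have [M hM] := uk _ e2.
have := hN (maxn N M) (leq_maxl _ _); have := hM (maxn N M) (leq_maxr _ _).
rewrite (nrmB _ l); have := nrm_tri l (u (maxn N M)) k; lra.
Qed.

Lemma hcv_dotp u l y : hcv u l -> (fun n => complex.Re (dotp (u n) y)) @ \oo --> complex.Re (dotp l y).
Proof.
move=> ul; apply/cvgrPdist_le => e e0.
have r0 := nrm_ge0 y.
have e2 : 0 < e / (nrm y + 1) by rewrite divr_gt0 //; lra.
have [N hN] := ul _ e2; exists N => // n /= Nn.
rewrite -ReB -dotpBl; apply: le_trans (Re_dotp_le _ _) _.
have := hN n Nn; rewrite nrmB ler_pdivlMr; last lra.
have := nrm_ge0 (l - u n); nra.
Qed.

Lemma hcv_nrm_le u l (M : R) : hcv u l -> (forall n, nrm (u n) <= M) -> nrm l <= M.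
Proof.
move=> ul uM; apply/ler_addgt0Pr => e e0.
have [N hN] := ul _ e0.
have := hN N (leqnn _); have := uM N; have := nrm_tri l (u N) 0.
by rewrite !subr0 (nrmB l); lra.
Qed.

Lemma dotp_cvg_eq u l y c : hcv u l ->
  (exists N, forall n, (N <= n)%N -> dotp (u n) y = c) -> dotp l y = c.
Proof.
move=> ul [N hN].
have key z d : (forall n, (N <= n)%N -> dotp (u n) z = d) ->
    complex.Re (dotp l z) = complex.Re d.
  move=> h; have h1 := hcv_dotp (y := z) ul.
  have h2 : (fun n => complex.Re (dotp (u n) z)) @ \oo --> complex.Re d.
    apply: cvg_near_cst; exists N => // n /= Nn; by rewrite h.
  exact: (cvg_unique _ h1 h2).
apply: complex_ReiP; first exact: key.
have iE z : 'i%C * dotp z y = dotp z ((- 'i%C) *: y).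
  by rewrite dotpZr; congr (_ * _); apply/eqP; rewrite eq_complex /= !oppr0 opprK !eqxx.
rewrite iE; apply: key => n Nn; by rewrite -iE hN.
Qed.

Lemma series_cvg f (c : nat -> R[i]) (M : R) : onseq f ->
  (forall n, \sum_(i < n) sqc (c i) <= M) ->
  exists l, hcv (fun n => \sum_(i < n) c i *: f i) l.
Proof.
move=> fo cM; apply: hilbert_complete => e e0.
have [||N hN] := @monotone_cauchy R (fun n => \sum_(i < n) sqc (c i)) M _ cM (e ^+ 2).
- by move=> n; rewrite big_ord_recr /= lerDl sqc_ge0.
- by rewrite exprn_gt0.
have key n k : nsq (\sum_(i < n) c i *: f i - \sum_(i < n + k) c i *: f i) =
    `| \sum_(i < n) sqc (c i) - \sum_(i < n + k) sqc (c i)|.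
  rewrite !big_split_ord /= !opprD !addrA !subrr !sub0r nsqN normrN ger0_norm; last first.
    by rewrite sumr_ge0 // => i _; exact: sqc_ge0.
  apply: (@orthof_nsq _ _ k (fun i => f (n + i)%N) (fun i => c (n + i)%N)).
  by move=> i j _ _; rewrite fo eqn_add2l.
exists N => n m Nn Nm; apply: nrm_le; first exact: ltW.
wlog nm : n m Nn Nm / (n <= m)%N.
  move=> h; case: (leqP n m) => nm; first exact: h.
  by rewrite -nsqN opprB; apply: h => //; exact: ltnW.
by rewrite -(subnKC nm) key; apply: hN => //; rewrite subnKC.
Qed.

(** The representing vector minimizes the functional [J x = nsq x - 2 Re (phi x)]: the parallelogram
    law makes minimizing sequences Cauchy, and the first-order condition at the minimum is the
    claim. *)
Lemma riesz (phi : H -> R[i]) (M : R) :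
  (forall x y, phi (x + y) = phi x + phi y) ->
  (forall c x, phi (c *: x) = c * phi x) ->
  (forall x, complex.Re (phi x) <= M * nrm x) ->
  exists z, forall x, phi x = dotp x z.
Proof.
move=> phiD phiZ phiM.
pose J x := nsq x - 2 * complex.Re (phi x).
have Jlb x : - M ^+ 2 <= J x.
  rewrite /J -nrm_sqr; have := phiM x; have := sqr_ge0 (nrm x - M); nra.
have hi : has_inf (range J).
  by split; [exists (J 0), 0|exists (- M ^+ 2) => _ [x _ <-]].
set m := inf (range J).
have mJ x : m <= J x by apply: ge_inf; [case: hi|exists x].
have /choice[u uP] : forall n : nat, exists x, J x < m + n.+1%:R^-1.
  move=> n; have n0 : 0 < (n.+1%:R^-1 : R) by rewrite invr_gt0 ltr0Sn.
  have [_ [x _ <-] hx] := inf_adherent n0 hi.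
  by exists x.
have JD x h : J (x + h) = J x + nsq h + 2 * (complex.Re (dotp x h) - complex.Re (phi h)).
  by rewrite /J nsqD phiD ReD; ring.
have inv_small (e : R) : 0 < e -> exists N, forall n, (N <= n)%N -> n.+1%:R^-1 <= e.
  move=> e0; have [N hN] := ltr_add_invr (y := 0) e0; exists N => n Nn.
  rewrite add0r in hN; apply: le_trans (ltW hN); rewrite lef_pV2 ?posrE ?ltr0Sn //.
  by rewrite ler_nat ltnS.
have [z uz] : exists z, hcv u z.
  apply: hilbert_complete => e e0.
  have e4 : 0 < e ^+ 2 / 4 by rewrite divr_gt0 // exprn_gt0.
  have [N hN] := inv_small _ e4; exists N => n k Nn Nk.
  apply: nrm_le; first exact: ltW.
  have hm : nsq (u n - u k) = 2 * J (u n) + 2 * J (u k) - 4 * J ((2^-1 : R)%:C *: (u n + u k)).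
    rewrite /J nsqZ sqc_real phiZ Re_realM phiD ReD.
    by have := parallelogram (u n) (u k); move: (complex.Re _) (complex.Re _) => a b; lra.
  rewrite hm; have := mJ ((2^-1 : R)%:C *: (u n + u k)).
  have un i : (N <= i)%N -> J (u i) <= m + e ^+ 2 / 4.
    by move=> Ni; apply: le_trans (ltW (uP i)) _; rewrite lerD2l hN.
  have := un n Nn; have := un k Nk; lra.
exists z.
have Re_eq h : complex.Re (phi h) = complex.Re (dotp z h).
  (* [J (u k + t h)] is at least the infimum [m] while [J (u k)] tends to [m]; the limit of the
     expansion [JD] is this quadratic inequality in [t]. *)
  have key t : 0 <= t ^+ 2 * nsq h + 2 * t * (complex.Re (dotp z h) - complex.Re (phi h)).
    apply/ler_addgt0Pr => e e0.
    have cvu := hcv_dotp (y := h) uz.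
    pose d := e / (2 * `|2 * t| + 2).
    have t0 := normr_ge0 (2 * t).
    have d0 : 0 < d by rewrite divr_gt0 //; lra.
    have /cvgrPdist_le/(_ _ d0)[N _ hN] := cvu.
    have e2 : 0 < e / 2 by lra.
    have [N' hN'] := inv_small _ e2.
    have Nk := leq_maxl N N'; have N'k := leq_maxr N N'; move: (maxn N N') Nk N'k => k Nk N'k.
    have h1 := hN k Nk; have h2 := hN' k N'k; have h3 := uP k.
    have := mJ (u k + t%:C *: h).
    rewrite JD nsqZ sqc_real dotpZr conj_real phiZ !Re_realM => h4.
    rewrite /= in h1.
    have h5 : `|2 * t * (complex.Re (dotp z h) - complex.Re (dotp (u k) h))| <= e / 2.
      rewrite normrM; apply: le_trans (ler_wpM2l t0 h1) _.
      have dE : d * (2 * `|2 * t| + 2) = e by rewrite /d divfK // gt_eqF //; lra.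
      by move: dE; move: (`|2 * t|) t0 => v v0 dE; nra.
    have {h2}h3 : J (u k) <= m + e / 2 by apply: le_trans (ltW h3) _; rewrite lerD2l.
    move: h5; rewrite ler_norml => /andP[h5 h6]; lra.
  set a := nsq h in key; set b := complex.Re _ - complex.Re _ in key.
  suff : b = 0 by rewrite /b; lra.
  have a0 : 0 <= a by exact: nsq_ge0.
  have a1 : 0 < a + 1 by lra.
  (* The optimal value would be [- b / a]; adding 1 covers [a = 0] and still leaves a negative
     multiple of the square of [b]. *)
  have := key (- b / (a + 1)).
  have -> : (- b / (a + 1)) ^+ 2 * a + 2 * (- b / (a + 1)) * b = - (b ^+ 2 * ((a + 2) / (a + 1) ^+ 2)).
    by field; rewrite gt_eqF.
  rewrite oppr_ge0 pmulr_lle0; last by rewrite divr_gt0 ?exprn_gt0 //; lra.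
  by move=> h0; nra.
move=> x; apply: complex_ReiP; first by rewrite Re_eq (dotpC x) Re_conjC.
by rewrite -phiZ Re_eq -dotpZl (dotpC (_ *: x)) Re_conjC.
Qed.

End convergence.

(** * Bounded and compact operators *)

Section bounded_operators.
Context {R : realType} {H : hilbertType R}.
Implicit Types (x y z : H) (T a b : H -> H) (c : R[i]).

Lemma linD T : linear T -> forall x y, T (x + y) = T x + T y.
Proof. by move=> h x y; have := h 1 x y; rewrite !scale1r. Qed.

Lemma lin0 T : linear T -> T 0 = 0.
Proof. by move=> h; have /eqP := linD h 0 0; rewrite addr0 -subr_eq0 opprD addrA subrr sub0r oppr_eq0 => /eqP. Qed.

Lemma linZ T : linear T -> forall c x, T (c *: x) = c *: T x.
Proof. by move=> h c x; have := h c x 0; rewrite !addr0 (lin0 h) addr0. Qed.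

Lemma linN T : linear T -> forall x, T (- x) = - T x.
Proof. by move=> h x; rewrite -scaleN1r (linZ h) scaleN1r. Qed.

Lemma linB T : linear T -> forall x y, T (x - y) = T x - T y.
Proof. by move=> h x y; rewrite (linD h) (linN h). Qed.

Lemma lin_sum T (lT : linear T) I r (P : pred I) (F : I -> H) :
  T (\sum_(i <- r | P i) F i) = \sum_(i <- r | P i) T (F i).
Proof. exact: (big_morph T (linD lT) (lin0 lT)). Qed.

Lemma bop_lin T : bounded_op T -> linear T.
Proof. by case. Qed.

Lemma bop_bound T : bounded_op T ->
  exists M : R, 0 <= M /\ forall x, nrm (T x) <= M * nrm x.
Proof.
move=> [_ [M hM]]; exists `|M|; split; first exact: normr_ge0.
move=> x; have := hM x; rewrite !nrmE -rmorphM lecR => h.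
by apply: le_trans h _; rewrite ler_wpM2r ?nrm_ge0 // ler_norm.
Qed.

Lemma bounded_opI T (M : R) : linear T -> (forall x, nrm (T x) <= M * nrm x) ->
  bounded_op T.
Proof. by move=> h hM; split => //; exists M => x; rewrite !nrmE -rmorphM lecR. Qed.

Lemma bounded_id : bounded_op (id : H -> H).
Proof. by apply: (bounded_opI (M := 1)) => // x; rewrite mul1r. Qed.

Lemma bounded_comp a b : bounded_op a -> bounded_op b -> bounded_op (a \o b).
Proof.
move=> ha hb; have [M [M0 hM]] := bop_bound ha; have [N [N0 hN]] := bop_bound hb.
apply: (bounded_opI (M := M * N)).
  by move=> c x y /=; rewrite (bop_lin hb) (bop_lin ha).
move=> x /=; apply: le_trans (hM _) _; rewrite -mulrA ler_wpM2l //.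
Qed.

Lemma bounded_lincomb c a b : bounded_op a -> bounded_op b ->
  bounded_op (fun x => c *: a x + b x).
Proof.
move=> ha hb; have [M [M0 hM]] := bop_bound ha; have [N [N0 hN]] := bop_bound hb.
apply: (bounded_opI (M := Num.sqrt (sqc c) * M + N)).
  move=> d x y; rewrite (bop_lin hb) (bop_lin ha) !scalerDr !scalerA.
  by rewrite (mulrC c d) addrACA.
move=> x; apply: le_trans (nrmD _ _) _; rewrite mulrDl nrmZ lerD //.
by rewrite -mulrA ler_wpM2l ?sqrtr_ge0.
Qed.

Lemma bounded_zero : bounded_op (fun=> 0 : H).
Proof.
apply: (bounded_opI (M := 0)); first by move=> c x y; rewrite scaler0 addr0.
by move=> x; rewrite nrm0 mul0r.
Qed.

Lemma bounded_add a b : bounded_op a -> bounded_op b ->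
  bounded_op (fun x => a x + b x).
Proof.
move=> ha hb; have := bounded_lincomb 1 ha hb.
by under eq_fun do rewrite scale1r.
Qed.

Lemma bounded_scale c a : bounded_op a -> bounded_op (fun x => c *: a x).
Proof.
move=> ha; have := bounded_lincomb c ha bounded_zero.
by under eq_fun do rewrite addr0.
Qed.

Lemma hcv_bop T u l : bounded_op T -> hcv u l -> hcv (fun n => T (u n)) (T l).
Proof.
move=> hT ul e e0; have [M [M0 hM]] := bop_bound hT.
have e2 : 0 < e / (M + 1) by rewrite divr_gt0 //; lra.
have [N hN] := ul _ e2; exists N => n Nn.
rewrite -(linB (bop_lin hT)); apply: le_trans (hM _) _.
have := hN n Nn; rewrite ler_pdivlMr; last lra.
have := nrm_ge0 (u n - l); nra.
Qed.

Lemma adjoint_exists T : bounded_op T -> exists b, is_adjoint T b.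
Proof.
move=> hT; have [M [M0 hM]] := bop_bound hT.
suff /choice[b hb] : forall y, exists z, forall x, dotp (T x) y = dotp x z.
  by exists b => x y.
move=> y; apply: (@riesz _ _ (fun x => dotp (T x) y) (M * nrm y)).
- by move=> x z; rewrite (linD (bop_lin hT)) dotpDl.
- by move=> c x; rewrite (linZ (bop_lin hT)) dotpZl.
- move=> x; apply: le_trans (ler_norm _) _; apply: le_trans (Re_dotp_le _ _) _.
  by rewrite mulrAC ler_wpM2r ?nrm_ge0.
Qed.

Lemma adjoint_is T : bounded_op T -> is_adjoint T (adjoint T).
Proof. by move=> hT; have [b hb] := adjoint_exists hT; exact: (getPex (P := is_adjoint T) (ex_intro _ b hb)). Qed.

Lemma dotp_injr x y : (forall z, dotp z x = dotp z y) -> x = y.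
Proof. by move=> h; apply: dotp_inj => z; rewrite dotpC h -dotpC. Qed.

Lemma adjoint_unique T b : is_adjoint T b -> adjoint T = b.
Proof.
move=> hb; have h : is_adjoint T (adjoint T).
  exact: (getPex (P := is_adjoint T) (ex_intro _ b hb)).
by apply/funext => y; apply: dotp_injr => x; rewrite -h -hb.
Qed.

Lemma is_adjoint_sym T b : is_adjoint T b -> is_adjoint b T.
Proof. by move=> h x y; rewrite dotpC -h -dotpC. Qed.

Lemma is_adjoint_bounded T b : bounded_op T -> is_adjoint T b -> bounded_op b.
Proof.
move=> hT hb; have [M [M0 hM]] := bop_bound hT.
apply: (bounded_opI (M := M)).
  move=> c x y; apply: dotp_injr => z.
  by rewrite -hb !dotpDr !dotpZr -!hb.
move=> x; have [->|/eqP/nrm_gt0 bx] := eqVneq (b x) 0.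
  by rewrite nrm0 mulr_ge0 ?nrm_ge0.
have h : nsq (b x) <= M * nrm (b x) * nrm x.
  rewrite /nsq -hb; apply: le_trans (ler_norm _) _.
  apply: le_trans (Re_dotp_le _ _) _.
  by rewrite ler_wpM2r ?nrm_ge0.
by rewrite -(ler_pM2r bx) -expr2 nrm_sqr mulrAC.
Qed.

Lemma adjoint_bounded T : bounded_op T -> bounded_op (adjoint T).
Proof. by move=> hT; exact: is_adjoint_bounded (adjoint_is hT). Qed.

Lemma dotp_adjoint T x y : bounded_op T -> dotp (adjoint T x) y = dotp x (T y).
Proof. by move=> hT; rewrite (is_adjoint_sym (adjoint_is hT)). Qed.

(** A complex phenomenon: the form takes real values, and polarization at [x + y] and at ['i x + y]
    recovers both parts of [dotp (T x) y]. *)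
Lemma positive_symmetric T : positive_op T -> is_adjoint T T.
Proof.
move=> [hT pT].
have im0 x : complex.Im (dotp (T x) x) = 0.
  by have := pT x; rewrite lecE /= => /andP[/eqP].
have re x y : complex.Im (dotp (T x) y) + complex.Im (dotp (T y) x) = 0.
  have := im0 (x + y); rewrite (linD (bop_lin hT)) dotpDl !dotpDr.
  have := im0 x; have := im0 y.
  move: (dotp (T x) x) (dotp (T x) y) (dotp (T y) x) (dotp (T y) y).
  by move=> [? ?] [? ?] [? ?] [? ?] /=; lra.
move=> x y.
have := re x y; have := re ('i%C *: x) y.
rewrite (linZ (bop_lin hT)) dotpZl dotpZr (dotpC x).
move: (dotp (T x) y) (dotp (T y) x) => [p q] [p' q'] /=; rewrite ?mul0r ?mul1r => h1 h2.
by congr (_ +i* _); lra.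
Qed.

Lemma positive_ge0 T x : positive_op T -> 0 <= complex.Re (dotp (T x) x).
Proof. by move=> [_ h]; have := h x; rewrite lecE => /andP[]. Qed.

End bounded_operators.

Section compact_operators.
Context {R : realType} {H : hilbertType R}.
Implicit Types (x y z : H) (T a b : H -> H) (c : R[i]).

Lemma nbhs_nrm x (A : set H) : nbhs x A <-> exists2 e : R, 0 < e & forall y, nrm (x - y) < e -> A y.
Proof.
split.
  move=> /nbhs_ballP[e /= e0 eA].
  have eE : e = (complex.Re e)%:C.
    by apply/eqP; rewrite eq_complex /= eqxx; move: e0; rewrite ltcE /= => /andP[].
  exists (complex.Re e); first by move: e0; rewrite ltcE /= => /andP[_].
  move=> y xy; apply: eA; rewrite -ball_normE /ball_ /= nrmE eE ltcR //.
move=> [e e0 eA]; apply/nbhs_ballP; exists e%:C; rewrite /= ?ltcR //.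
by move=> y; rewrite -ball_normE /ball_ /= nrmE ltcR => /eA.
Qed.

Lemma bounded_continuous T : bounded_op T -> continuous T.
Proof.
move=> hT x A /nbhs_nrm[e e0 eA]; have [M [M0 hM]] := bop_bound hT.
apply/nbhs_nrm; exists (e / (M + 1)); first by rewrite divr_gt0 //; lra.
move=> y xy; apply: eA; rewrite -(linB (bop_lin hT)).
apply: le_lt_trans (hM _) _; move: xy; rewrite ltr_pdivlMr; last lra.
have := nrm_ge0 (x - y); nra.
Qed.

Lemma hilbert_hausdorff : hausdorff_space H.
Proof. exact: norm_hausdorff. Qed.

Lemma precompact_image (f : H -> H) (A : set H) : continuous f -> precompact A ->
  precompact (f @` A).
Proof.
move=> fc [B AB [cB _]]; exists (f @` B); first by apply: image_subset.
have : compact (f @` B) by apply: continuous_compact => //; exact: continuous_subspaceT.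
by move=> h; split => //; apply: compact_closed h; exact: hilbert_hausdorff.
Qed.

Lemma compact_comp_left a T : bounded_op a -> compact_op T -> compact_op (a \o T).
Proof.
move=> ha [lT cT]; split; first by move=> c x y /=; rewrite lT (bop_lin ha).
by rewrite -image_comp; apply: precompact_image => //; exact: bounded_continuous.
Qed.

Lemma compact_lincomb c a b : compact_op a -> compact_op b ->
  compact_op (fun x => c *: a x + b x).
Proof.
move=> [la [A aA [cA _]]] [lb [B bB [cB _]]]; split.
  by move=> d x y; rewrite la lb !scalerDr !scalerA (mulrC c d) addrACA.
exists ((fun p : H * H => c *: p.1 + p.2) @` (A `*` B)).
  by move=> _ [x x1 <-]; exists (a x, b x) => //; split; [apply: aA|apply: bB]; exists x.
have h : compact ((fun p : H * H => c *: p.1 + p.2) @` (A `*` B)).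
  apply: continuous_compact; last exact: compact_setX.
  apply: continuous_subspaceT => p; apply: cvgD; last exact: cvg_snd.
  by apply: cvgZr; exact: cvg_fst.
by split => //; apply: compact_closed h; exact: hilbert_hausdorff.
Qed.

Lemma compact_comp_right a T : bounded_op a -> compact_op T -> compact_op (T \o a).
Proof.
move=> ha [lT cT]; split; first by move=> c x y /=; rewrite (bop_lin ha) lT.
have [M [M0 hM]] := bop_bound ha.
have M1 : 0 < M + 1 by lra.
apply: (precompact_subset (B := (fun x => (M + 1)%:C *: x) @` (T @` [set x | `|x| <= 1]))).
  move=> _ [x x1 <-] /=; exists (T ((M + 1)^-1%:C *: a x)).
    exists ((M + 1)^-1%:C *: a x) => //=.
    move: x1; rewrite /= !nrmE -!(rmorph1 (real_complex R)) !lecR => x1.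
    rewrite nrmZr ger0_norm ?invr_ge0; last lra.
    rewrite mulrC ler_pdivrMr // mul1r; apply: le_trans (hM _) _.
    by have := nrm_ge0 x; nra.
  by rewrite (linZ lT) scalerA -rmorphM /= mulfV ?scale1r // gt_eqF.
apply: precompact_image => //; apply: bounded_continuous.
exact: bounded_scale bounded_id.
Qed.

Lemma compact_cluster T (u : nat -> H) : compact_op T -> (forall n, nrm (u n) <= 1) ->
  exists y, forall e : R, 0 < e -> forall N, exists2 n, (N <= n)%N & nrm (T (u n) - y) <= e.
Proof.
move=> [_ [A TA [cA _]]] u1.
have FA : ((fun n => T (u n)) @ \oo) A.
  by exists 0%N => // n _ /=; apply: TA; exists (u n) => //; rewrite /= nrmE -(rmorph1 (real_complex R)) lecR.
have [y [_ hy]] := cA _ (fmap_proper_filter _ _) FA.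
exists y => e e0 N.
have h1 : ((fun n => T (u n)) @ \oo) [set T (u n) | n in [set n | (N <= n)%N]].
  by exists N => // n /= Nn; exists n.
have h2 : nbhs y [set z | nrm (y - z) < e] by apply/nbhs_nrm; exists e.
have [_ [[n Nn <-] /ltW hn]] := hy _ _ h1 h2.
by exists n => //; rewrite nrmB.
Qed.

Lemma oproj_lin n (f : nat -> H) : linear (oproj n f).
Proof.
move=> c x y; rewrite /oproj scaler_sumr -big_split /=; apply: eq_bigr => i _.
by rewrite dotpDl dotpZl scalerDl scalerA.
Qed.

Lemma oproj_contract n (f : nat -> H) x : orthof n f -> nrm (x - oproj n f x) <= nrm x.
Proof.
move=> fo; apply: nrm_le; first exact: nrm_ge0.
rewrite nrm_sqr oproj_nsq // lerBlDr lerDl sumr_ge0 // => i _; exact: sqc_ge0.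
Qed.

Lemma ultra_bounded_cvg (T : Type) (F : set_system T) (g : T -> R) (M : R) :
  UltraFilter F -> F [set t | `|g t| <= M] -> exists l : R, g @ F --> l.
Proof.
move=> FU FM; have cM : compact `[- M, M]%classic := segment_compact (a := - M) (b := M).
have PF : ProperFilter (g @ F) by exact: fmap_proper_filter.
have FgM : (g @ F) `[- M, M]%classic.
  apply: (filterS _ FM) => t tM; rewrite /= in_itv /= -ler_norml; exact: tM.
have [l [_ gl]] := cM _ PF FgM.
exists l => B lB; have [//|FB] := in_ultra_setVsetC (g @^-1` B) FU.
by have [y [yB /yB]] := gl (~` B) B FB lB.
Qed.

(** Up to the error [tau N], a point of this set is known from its first [N] coordinates, which are
    bounded. Along an ultrafilter these coordinates converge, so the ultrafilter is Cauchy. *)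
Lemma compact_tail_set (f : nat -> H) (tau : nat -> R) (M : R) :
  onseq f -> tau @ \oo --> 0 ->
  precompact [set z : H | nrm z <= M /\ forall n, nrm (z - oproj n f z) <= tau n].
Proof.
move=> fo tau0; set C := [set z | _].
have clC : closed C.
  move=> z zC.
  have near_z e : 0 < e -> exists2 w, C w & nrm (z - w) < e.
    move=> e0; have hz : nbhs z [set w | nrm (z - w) < e] by apply/nbhs_nrm; exists e.
    by have [w [Cw hw]] := zC _ hz; exists w.
  split; last move=> n; apply/ler_addgt0Pr => e e0.
    have [w [wM _] zw] := near_z _ e0.
    by have := nrm_tri z w 0; rewrite !subr0; lra.
  have [w [_ wt] zw] := near_z _ e0.
  have -> : z - oproj n f z = (w - oproj n f w) + ((z - w) - oproj n f (z - w)).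
    rewrite (linB (@oproj_lin n f)) opprB addrACA (addrC w) subrK.
    by congr (_ + _); rewrite addKr.
  apply: le_trans (nrmD _ _) _; apply: lerD => //.
  by apply: le_trans (ltW zw); apply: oproj_contract; exact: onseq_orthof.
rewrite precompact_closed // compact_ultra => F FU FC.
have cvc (g : H -> R) : (forall z, C z -> `|g z| <= M) -> exists l : R, g @ F --> l.
  by move=> gM; apply: (@ultra_bounded_cvg _ _ _ M); exact: filterS FC.
have coef_bd i z : C z -> nrm z * nrm (f i) <= M.
  by move=> [zM _]; rewrite /nrm -/(nrm z) /nsq fo eqxx /= sqrtr1 mulr1.
have /choice[p hp] : forall i, exists l : R, (fun z => complex.Re (dotp z (f i))) @ F --> l.
  move=> i; apply: cvc => z Cz; apply: le_trans (Re_dotp_le _ _) _; exact: coef_bd.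
have /choice[q hq] : forall i, exists l : R, (fun z => complex.Im (dotp z (f i))) @ F --> l.
  move=> i; apply: cvc => z Cz; apply: le_trans (_ : nrm z * nrm (f i) <= M); last exact: coef_bd.
  rewrite -sqrtr_sqr /nrm -sqrtrM ?nsq_ge0 // ler_wsqrtr //.
  by apply: le_trans (cauchy_schwarz _ _); rewrite /sqc lerDr sqr_ge0.
have Fcv : cvg F.
  apply/cauchy_cvgP/cauchy_exP => e e0.
  have eE : e = (complex.Re e)%:C.
    by apply/eqP; rewrite eq_complex /= eqxx; move: e0; rewrite ltcE /= => /andP[].
  have e0' : 0 < complex.Re e by move: e0; rewrite ltcE /= => /andP[_].
  rewrite eE; move: (complex.Re e) e0' => {eE e0}e e0.
  have e3 : 0 < e / 3 by lra.
  have /cvgrPdist_le/(_ _ e3)[N _ /(_ N (leqnn N)) hN] := tau0.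
  rewrite /= sub0r normrN in hN; have {}hN := le_trans (ler_norm _) hN.
  pose y := \sum_(i < N) (p i +i* q i) *: f i.
  exists y.
  (* Real and imaginary parts are each off by at most [d], so the [N] coefficients contribute at
     most [2 * d * N <= e / 3]; the tail adds another third, which leaves the strict inequality. *)
  pose d := e / (6 * N.+1%:R).
  have N0 : 0 < (N.+1%:R : R) by rewrite ltr0Sn.
  have d0 : 0 < d by rewrite divr_gt0 //; lra.
  have good : F [set z | forall i, (i < N)%N ->
     `|p i - complex.Re (dotp z (f i))| <= d /\ `|q i - complex.Im (dotp z (f i))| <= d].
    move: (N) => K; elim: K => [|K IH]; first by apply: filterS FC => z _ i; rewrite ltn0.
    have /cvgrPdist_le/(_ _ d0) h1 := hp K; have /cvgrPdist_le/(_ _ d0) h2 := hq K.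
    apply: filterS (filterI IH (filterI h1 h2)) => z [h [h1' h2']] i.
    by rewrite ltnS leq_eqVlt => /orP[/eqP ->|/h].
  apply: filterS (filterI FC good) => z [[zM zt] hz].
  rewrite -ball_normE /ball_ /= nrmE ltcR.
  have -> : y - z = \sum_(i < N) ((p i +i* q i) - dotp z (f i)) *: f i - (z - oproj N f z).
    rewrite opprB addrA; congr (_ - _).
    by rewrite /y /oproj -big_split /=; apply: eq_bigr => i _; rewrite -scalerDl subrK.
  apply: le_lt_trans (nrmD _ _) _; rewrite nrmN.
  have : nrm (\sum_(i < N) ((p i +i* q i) - dotp z (f i)) *: f i) <= e / 3.
    apply: le_trans (nrm_sum _ (fun i => ((p i +i* q i) - dotp z (f i)) *: f i)) _.
    apply: (@le_trans _ _ (\sum_(i < N) (2 * d))).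
      apply: ler_sum => i _; rewrite nrmZ [nrm (f i)]/nrm /nsq fo eqxx /= sqrtr1 mulr1.
      have [h1 h2] := hz i (ltn_ord i).
      rewrite -[leRHS]ger0_norm; last lra.
      rewrite -sqrtr_sqr ler_wsqrtr // /sqc ReB raddfB /=.
      move: (complex.Re _) (complex.Im _) h1 h2 => s t; rewrite !ler_norml => /andP[? ?] /andP[? ?]; nra.
    rewrite sumr_const card_ord -(mulr_natr (2 * d)) /d.
    have NK : (N%:R : R) <= N.+1%:R by rewrite ler_nat.
    have -> : 2 * (e / (6 * N.+1%:R)) * N%:R = e / 3 * (N%:R / N.+1%:R).
      by field; rewrite gt_eqF.
    rewrite -[leRHS]mulr1 ler_wpM2l ?(ltW e3) // ler_pdivrMr ?mul1r //.
  by have := zt N; lra.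
exists (lim F); split => //.
by apply: clC => B lB; have [z [Cz Bz]] := filter_ex (filterI FC (Fcv _ lB)); exists z.
Qed.

End compact_operators.

(** * Diagonal operators and the spectral theorem *)

Section limits.
Context {R : realType}.

Lemma cvg_congr (u v : nat -> R) (l : R) : u =1 v -> u @ \oo --> l -> v @ \oo --> l.
Proof. by move=> /funext ->. Qed.

Lemma cvg_ge0 (u : nat -> R) (l : R) : u @ \oo --> l -> (forall n, 0 <= u n) -> 0 <= l.
Proof.
move=> ul u0; rewrite -(cvg_lim (@Rhausdorff R) ul); apply: limr_ge; first exact: cvgP ul.
by apply: nearW => n; exact: u0.
Qed.

Lemma cvg_le_cst (u : nat -> R) (l M : R) : u @ \oo --> l -> (forall n, u n <= M) -> l <= M.
Proof.
move=> ul uM; rewrite -subr_ge0; apply: (@cvg_ge0 (fun n => M - u n)).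
  by apply: cvgB => //; exact: cvg_cst.
by move=> n; rewrite subr_ge0.
Qed.

(** Dependent choice in which the n-th choice may look at all earlier ones. The first premise says
    that [P n] reads only those, so a finite history [G n] determines the next value. *)
Lemma greedy_sequence (T : Type) (x0 : T) (P : nat -> (nat -> T) -> T -> Prop) :
  (forall n g g' (x : T), (forall i, (i < n)%N -> g i = g' i) -> P n g x -> P n g' x) ->
  (forall n g, (forall i, (i < n)%N -> P i g (g i)) -> exists x : T, P n g x) ->
  exists f : nat -> T, forall n, P n f (f n).
Proof.
move=> ext ex.
have /choice[nxt nxtP] : forall ng : nat * (nat -> T), exists x,
    (forall i, (i < ng.1)%N -> P i ng.2 (ng.2 i)) -> P ng.1 ng.2 x.
  move=> [n g] /=; have [h|h] := pselect (forall i, (i < n)%N -> P i g (g i)).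
    by have [x hx] := ex n g h; exists x.
  by exists x0 => /h.
pose G := fix G n := if n is n'.+1 then
   (fun i => if (i < n')%N then G n' i else nxt (n', G n')) else (fun=> x0).
pose f n := G n.+1 n.
have Gf n i : (i < n)%N -> G n i = f i.
  elim: n i => // n IH i; rewrite ltnS leq_eqVlt => /orP[/eqP ->|i_n] //=.
  by rewrite i_n IH.
exists f => n; elim/ltn_ind: n => n IH.
have -> : f n = nxt (n, G n) by rewrite /f /= ltnn.
apply: (ext _ (G n)); first by move=> i i_n; rewrite Gf.
apply: (nxtP (n, G n)) => i i_n /=; rewrite Gf //; apply: (ext _ f); last exact: IH.
by move=> j ji; rewrite Gf // (ltn_trans ji).
Qed.

End limits.

Section diagonal_operators.
Context {R : realType} {H : hilbertType R}.
Variables (m : nat -> R) (f : nat -> H).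
Implicit Types (x y : H).

Definition diag_sum x (n : nat) : H := \sum_(i < n) ((m i)%:C * dotp x (f i)) *: f i.

(** The family [f] may be incomplete; the series then gives 0 on its orthogonal complement, so
    operators with a kernel are also of this form. *)
Definition diagop x : H := get [set l | hcv (diag_sum x) l].

Hypothesis fo : onseq f.

Lemma diag_sum_tail_nsq x n k (M : R) :
  (forall i, (n <= i)%N -> `|m i| <= M) ->
  nsq (diag_sum x (n + k) - diag_sum x n) <= M ^+ 2 * nsq x.
Proof.
move=> mM; rewrite /diag_sum big_split_ord /= addrAC subrr add0r.
have fo' : orthof k (fun i => f (n + i)%N) by move=> i j _ _; rewrite fo eqn_add2l.
rewrite (orthof_nsq (fun i => (m (n + i)%N)%:C * dotp x (f (n + i)%N)) fo').
apply: (@le_trans _ _ (\sum_(i < k) M ^+ 2 * sqc (dotp x (f (n + i)%N)))).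
  apply: ler_sum => i _; rewrite sqcM sqc_real ler_wpM2r ?sqc_ge0 //.
  rewrite -real_normK ?num_real // lerXn2r ?nnegrE //.
    by apply: le_trans (mM n (leqnn n)).
  by apply: mM; rewrite leq_addr.
by rewrite -mulr_sumr ler_wpM2l ?sqr_ge0 //; exact: (bessel fo').
Qed.

Variable M : R.
Hypothesis mM : forall i, `|m i| <= M.

Lemma diag_bound_ge0 : 0 <= M.
Proof. exact: le_trans (mM 0). Qed.

Lemma diag_sum_nsq x n : nsq (diag_sum x n) <= M ^+ 2 * nsq x.
Proof.
have := @diag_sum_tail_nsq x 0 n M; rewrite add0n {2}/diag_sum big_ord0 subr0; apply.
by move=> i _; exact: mM.
Qed.

Lemma diagop_cvg x : hcv (diag_sum x) (diagop x).
Proof.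
apply: (getPex (P := [set l | hcv (diag_sum x) l])).
apply: (@series_cvg _ _ f (fun i => (m i)%:C * dotp x (f i)) (M ^+ 2 * nsq x) fo) => n.
rewrite -(orthof_nsq (fun i => (m i)%:C * dotp x (f i)) (onseq_orthof fo)).
exact: diag_sum_nsq.
Qed.

Lemma diagop_unique x l : hcv (diag_sum x) l -> diagop x = l.
Proof. exact: hcv_uniq (diagop_cvg x). Qed.

Lemma diagop_nrm x : nrm (diagop x) <= M * nrm x.
Proof.
apply: hcv_nrm_le (diagop_cvg x) _ => n; apply: nrm_le.
  by rewrite mulr_ge0 ?nrm_ge0 // diag_bound_ge0.
by rewrite exprMn nrm_sqr; exact: diag_sum_nsq.
Qed.

Lemma diagop_bounded : bounded_op diagop.
Proof.
apply: (bounded_opI _ diagop_nrm) => c x y; apply: diagop_unique.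
have := hcvD (hcvZ c (diagop_cvg x)) (diagop_cvg y).
congr (hcv _ _); apply/funext => n; rewrite /diag_sum scaler_sumr -big_split /=.
apply: eq_bigr => i _; rewrite scalerA -scalerDl dotpDl dotpZl.
by congr (_ *: _); ring.
Qed.

Lemma diagop_dotp x j : dotp (diagop x) (f j) = (m j)%:C * dotp x (f j).
Proof.
apply: (dotp_cvg_eq (diagop_cvg x)); exists j.+1 => n jn.
by rewrite /diag_sum (orthof_dotp (fun i => (m i)%:C * dotp x (f i)) (onseq_orthof fo) jn).
Qed.

Lemma diagop_eigen j : diagop (f j) = (m j)%:C *: f j.
Proof.
apply: diagop_unique => e e0; exists j.+1 => n jn.
rewrite /diag_sum (bigD1 (Ordinal jn)) //= fo eqxx mulr1 big1 => [|i /eqP ij].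
  by rewrite addr0 subrr nrm0 ltW.
rewrite fo; case: eqP => [e'|_]; last by rewrite mulr0 scale0r.
by case: ij; apply/val_inj.
Qed.

Lemma diagop_Re_cvg x y :
  (fun n => \sum_(i < n) m i * complex.Re (dotp x (f i) * Num.conj (dotp y (f i)))) @ \oo -->
  complex.Re (dotp (diagop x) y).
Proof.
apply: cvg_congr (hcv_dotp (y := y) (diagop_cvg x)) => n.
rewrite /diag_sum dotp_suml.
rewrite Re_sum.
by apply: eq_bigr => i _; rewrite dotpZl -mulrA Re_realM -dotpC.
Qed.

Lemma diagop_symmetric : is_adjoint diagop diagop.
Proof.
have key x y : complex.Re (dotp (diagop x) y) = complex.Re (dotp x (diagop y)).
  have h := diagop_Re_cvg (x := x) (y := y); have h2 := diagop_Re_cvg (x := y) (y := x).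
  rewrite [in RHS]dotpC Re_conjC; apply: (cvg_unique (@Rhausdorff R) h).
  apply: cvg_congr h2 => n; apply: eq_bigr => i _; congr (_ * _).
  by case: (dotp x _) (dotp y _) => [? ?] [? ?] /=; ring.
move=> x y; apply: complex_ReiP => //.
by rewrite -!dotpZl -(linZ (bop_lin diagop_bounded)) key.
Qed.

Lemma diagop_positive : (forall i, 0 <= m i) -> positive_op diagop.
Proof.
move=> m0; split; first exact: diagop_bounded.
move=> x; rewrite lecE /=; apply/andP; split.
  have := diagop_symmetric x x; rewrite [in X in _ = X]dotpC.
  by case: (dotp _ _) => a b [] /= h; apply/eqP; lra.
apply: cvg_ge0 (diagop_Re_cvg (x := x) (y := x)) _ => n; apply: sumr_ge0 => i _.
by rewrite mulcJ /= mulr_ge0 ?sqc_ge0.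
Qed.

Lemma oproj_diagop x n : oproj n f (diagop x) = diag_sum x n.
Proof. by apply: eq_bigr => i _; rewrite diagop_dotp. Qed.

Lemma diagop_tail x n (N : R) : (forall i, (n <= i)%N -> `|m i| <= N) ->
  nrm (diagop x - diag_sum x n) <= N * nrm x.
Proof.
move=> mN; have N0 : 0 <= N by apply: le_trans (mN n (leqnn n)).
apply: (@hcv_nrm_le _ _ (fun k => diag_sum x (n + k) - diag_sum x n)).
  move=> e e0; have [K hK] := diagop_cvg x e0; exists K => k Kk.
  by rewrite opprB addrA subrK; apply: hK; rewrite (leq_trans Kk) ?leq_addl.
move=> k; apply: nrm_le; first by rewrite mulr_ge0 ?nrm_ge0.
by rewrite exprMn nrm_sqr; exact: diag_sum_tail_nsq.
Qed.

Lemma diagop_compact : (forall i j, (i <= j)%N -> m j <= m i) ->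
  (forall i, 0 <= m i) -> m @ \oo --> 0 -> compact_op diagop.
Proof.
move=> mono m0 mcv; split; first exact: bop_lin diagop_bounded.
apply: precompact_subset (compact_tail_set M fo mcv) => _ [x x1 <-].
move: x1; rewrite /= nrmE -(rmorph1 (real_complex R)) lecR => x1; split.
  apply: le_trans (diagop_nrm x) _; rewrite -[leRHS]mulr1 ler_wpM2l //.
  exact: diag_bound_ge0.
move=> n; rewrite oproj_diagop; apply: le_trans (@diagop_tail x n (m n) _) _.
  by move=> i ni; rewrite ger0_norm ?mono.
by rewrite -[leRHS]mulr1 ler_wpM2l.
Qed.

End diagonal_operators.

(** * Maximal eigenvectors of compact positive operators *)

Section top_eigenvector.
Context {R : realType} {H : hilbertType R}.
Implicit Types (x y : H) (K : H -> H) (E : set H).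

Definition perp E : set H := [set x | forall e, E e -> dotp x e = 0].

Lemma perp_lincomb E c x y : perp E x -> perp E y -> perp E (c *: x + y).
Proof. by move=> hx hy e Ee; rewrite dotpDl dotpZl hx // hy // mulr0 addr0. Qed.

Lemma perp_scale E c x : perp E x -> perp E (c *: x).
Proof. by move=> hx e Ee; rewrite dotpZl hx // mulr0. Qed.

Lemma perp_closed E x : (forall e : R, 0 < e -> exists2 w, perp E w & nrm (w - x) <= e) ->
  perp E x.
Proof.
move=> h z Ez; apply: sqc_eq0; apply/eqP; rewrite eq_le sqc_ge0 andbT.
have z0 := nsq_ge0 z.
have z1 : 0 < nsq z + 1 by lra.
apply/ler_addgt0Pr => e e0; rewrite add0r.
have d0 : 0 < e / (nsq z + 1) by rewrite divr_gt0.
have s0 : 0 < Num.sqrt (e / (nsq z + 1)) by rewrite sqrtr_gt0.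
have [w Ww wx] := h _ s0.
have -> : dotp x z = - dotp (w - x) z by rewrite dotpBl Ww // sub0r opprK.
rewrite sqcN; apply: le_trans (cauchy_schwarz _ _) _.
have : nsq (w - x) <= e / (nsq z + 1).
  by rewrite -nrm_sqr -[leRHS](sqr_sqrtr (ltW d0)) lerXn2r ?nnegrE ?nrm_ge0 // ltW.
rewrite ler_pdivlMr // => h2; have := nsq_ge0 (w - x); nra.
Qed.

Lemma quadratic_discr (a b c : R) : 0 <= a -> 0 <= c ->
  (forall t, 0 <= a + 2 * t * b + t ^+ 2 * c) -> b ^+ 2 <= a * c.
Proof.
move=> a0 c0 h; have [c00|cn0] := eqVneq c 0.
  rewrite c00 mulr0; have [->|b0] := eqVneq b 0; first by rewrite expr0n.
  have := h (- (a + 1) / (2 * b)); rewrite c00 mulr0 addr0.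
  have -> : 2 * (- (a + 1) / (2 * b)) * b = - (a + 1) by field.
  lra.
have c1 : 0 < c by rewrite lt0r cn0.
have := h (- b / c).
have -> : a + 2 * (- b / c) * b + (- b / c) ^+ 2 * c = (a * c - b ^+ 2) / c by field.
by rewrite pmulr_lge0 ?invr_gt0 // subr_ge0.
Qed.

Lemma positive_cauchy_schwarz K x y : positive_op K ->
  complex.Re (dotp (K x) y) ^+ 2 <= complex.Re (dotp (K x) x) * complex.Re (dotp (K y) y).
Proof.
move=> hK; have lK := bop_lin hK.1.
apply: quadratic_discr; [exact: positive_ge0|exact: positive_ge0|] => t.
have := positive_ge0 (x + t%:C *: y) hK.
rewrite (linD lK) (linZ lK) !dotpDl !dotpDr !dotpZl !dotpZr conj_real !ReD !Re_realM.
have -> : complex.Re (dotp (K y) x) = complex.Re (dotp (K x) y).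
  by rewrite (positive_symmetric hK) dotpC Re_conjC.
by congr (0 <= _); ring.
Qed.

(** Cauchy-Schwarz for the form of [K] at [x] and [K x] bounds the square of [nsq (K x)] by the form
    at [x] times [k * nsq (K x)]; one factor [nsq (K x)] cancels. *)
Lemma form_bound_nsq K E (k : R) : positive_op K ->
  (forall x, perp E x -> perp E (K x)) -> 0 <= k ->
  (forall x, perp E x -> complex.Re (dotp (K x) x) <= k * nsq x) ->
  forall x, perp E x -> nsq (K x) <= k * complex.Re (dotp (K x) x).
Proof.
move=> pK KE k0 Wk x Wx; have := positive_cauchy_schwarz x (K x) pK.
rewrite -/(nsq (K x)).
have := Wk _ (KE _ Wx); have := nsq_ge0 (K x).
have := positive_ge0 x pK; have := positive_ge0 (K x) pK.
have [->|Kn0] := eqVneq (nsq (K x)) 0; first by move=> *; rewrite mulr_ge0.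
move=> h1 h2 h3 h4 h5; have n0 : 0 < nsq (K x) by rewrite lt0r Kn0.
rewrite -(ler_pM2r n0); nra.
Qed.

(** With [k] the supremum of the form on unit vectors, a maximizing sequence consists of almost
    eigenvectors, and compactness gives their images a cluster point. For [k = 0] the operator
    vanishes on [perp E] and any unit vector there will do. *)
Lemma top_eigenvector K E : positive_op K -> compact_op K ->
  (forall x, perp E x -> perp E (K x)) -> (exists2 x, perp E x & x <> 0) ->
  exists f (k : R), [/\ perp E f, nsq f = 1, 0 <= k, K f = k%:C *: f &
    forall x, perp E x -> complex.Re (dotp (K x) x) <= k * nsq x].
Proof.
move=> pK cK KE [x0 Wx0 x0n0].
have lK := bop_lin pK.1; have [M [M0 hM]] := bop_bound pK.1.
pose q x := complex.Re (dotp (K x) x).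
have q0 x : 0 <= q x by exact: positive_ge0.
have qZ (r : R) x : q (r%:C *: x) = r ^+ 2 * q x.
  by rewrite /q (linZ lK) dotpZl dotpZr conj_real !Re_realM mulrA.
pose S := [set q x | x in [set x | perp E x /\ nsq x = 1]].
have nrm1 x : nsq x = 1 -> nrm x = 1 by rewrite /nrm => ->; exact: sqrtr1.
pose u0 := (nrm x0)^-1%:C *: x0.
have u0W : perp E u0 by exact: perp_scale.
have u01 : nsq u0 = 1 by exact: unit_normalize.
have hS : has_sup S.
  split; first by exists (q u0), u0.
  exists M => _ [x [_ x1] <-]; apply: le_trans (ler_norm _) _.
  by apply: le_trans (Re_dotp_le _ _) _; have := hM x; rewrite (nrm1 _ x1) !mulr1.
pose k := sup S.
have Sk x : perp E x -> nsq x = 1 -> q x <= k.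
  by move=> Wx x1; apply: ub_le_sup; [case: hS|exists x].
have k0 : 0 <= k by apply: le_trans (q0 u0) (Sk _ _ _).
have Wk x : perp E x -> q x <= k * nsq x.
  move=> Wx; have [->|/eqP xn0] := eqVneq x 0.
    by rewrite /q (lin0 lK) dotp0l nsq0 mulr0.
  have := Sk _ (perp_scale (nrm x)^-1%:C Wx) (unit_normalize xn0).
  rewrite qZ exprVn nrm_sqr mulrC ler_pdivrMr //; exact: nsq_gt0.
have Kk := form_bound_nsq pK KE k0 Wk.
have fin x : perp E x -> nsq x = 1 -> K x = k%:C *: x ->
    exists f (k : R), [/\ perp E f, nsq f = 1, 0 <= k, K f = k%:C *: f &
    forall x, perp E x -> complex.Re (dotp (K x) x) <= k * nsq x].
  by move=> *; exists x, k; split.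
have [k00|kn0] := eqVneq k 0.
  apply: (fin _ u0W u01); rewrite k00 scale0r; apply: nsq_eq0.
  by apply/eqP; rewrite eq_le nsq_ge0 andbT -[leRHS](mul0r (q u0)) -k00 Kk.
have k1 : 0 < k by rewrite lt0r kn0.
have /choice[u uP] : forall n : nat, exists x, [/\ perp E x, nsq x = 1 & k - n.+1%:R^-1 < q x].
  move=> n; have n0 : 0 < (n.+1%:R^-1 : R) by rewrite invr_gt0 ltr0Sn.
  have [_ [x [Wx x1] <-] hx] := sup_adherent n0 hS.
  by exists x.
have [y hy] : exists y, forall e : R, 0 < e -> forall N, exists2 n, (N <= n)%N & nrm (K (u n) - y) <= e.
  by apply: compact_cluster => // n; have [_ h _] := uP n; rewrite nrm1.
have almost (e : R) : 0 < e -> exists n, nrm (K (u n) - y) <= e /\ nrm (K (u n) - k%:C *: u n) <= e.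
  (* By [form_bound_nsq] the squared norm of [K (u n) - k u n] is at most [k * (k - q (u n))], hence
     at most the square of [e] once [q (u n)] is within this constant of [k]. *)
  move=> e0; have d0 : 0 < e ^+ 2 / k by rewrite divr_gt0 // exprn_gt0.
  have [N hN] := ltr_add_invr (y := 0) d0; rewrite add0r in hN.
  have [n Nn hn] := hy _ e0 N; exists n; split => //.
  have [Wu u1 uq] := uP n.
  apply: nrm_le; first exact: ltW.
  rewrite nsqB nsqZ sqc_real dotpZr conj_real Re_realM u1 -/(q (u n)).
  have h1 := Kk _ Wu; have h2 : k - e ^+ 2 / k <= q (u n).
    apply: le_trans (ltW uq); rewrite lerD2l lerN2; apply: le_trans (ltW hN).
    by rewrite lef_pV2 ?posrE ?ltr0Sn // ler_nat ltnS.
  have h3 : k * (k - e ^+ 2 / k) <= k * q (u n) by rewrite ler_wpM2l.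
  rewrite mulrBr (mulrC k (_ / _)) divfK // in h3.
  lra.
have almost2 (e : R) : 0 < e -> exists n, nrm (K (u n) - y) <= e /\ nrm (k%:C *: u n - y) <= e.
  move=> e0; have e2 : 0 < e / 2 by lra.
  have [n [h1 h2]] := almost _ e2; exists n; split; first by lra.
  by have := nrm_tri (k%:C *: u n) (K (u n)) y; rewrite (nrmB _ (K (u n))); lra.
have yW : perp E y.
  apply: perp_closed => e e0; have [n [_ hn]] := almost2 _ e0.
  by exists (k%:C *: u n) => //; apply: perp_scale; have [] := uP n.
have Ky : K y = k%:C *: y.
  apply: nrm_eps => e e0.
  have d0 : 0 < e / (M + k) by rewrite divr_gt0 //; lra.
  have [n [h1 h2]] := almost2 _ d0.
  have := nrm_tri (K y) (k%:C *: K (u n)) (k%:C *: y).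
  have a1 : nrm (K y - k%:C *: K (u n)) <= M * nrm (k%:C *: u n - y).
    by rewrite -(linZ lK) -(linB lK) (nrmB (k%:C *: u n)); exact: hM.
  have a2 : nrm (k%:C *: K (u n) - k%:C *: y) = k * nrm (K (u n) - y).
    by rewrite -scalerBr nrmZr ger0_norm.
  move=> /le_trans; apply; rewrite a2.
  have dE : e / (M + k) * (M + k) = e by rewrite divfK // gt_eqF //; lra.
  have := ler_wpM2l M0 h2; have := ler_wpM2l k0 h1; lra.
have y0 : y <> 0.
  move=> y0; have k2 : 0 < k / 2 by lra.
  have [n [_]] := almost2 _ k2; rewrite y0 subr0 nrmZr nrm1; last by have [] := uP n.
  by rewrite ger0_norm // mulr1; lra.
apply: (fin ((nrm y)^-1%:C *: y)); [exact: perp_scale|exact: unit_normalize|].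
by rewrite (linZ lK) Ky !scalerA mulrC.
Qed.

End top_eigenvector.

Section compact_positive.
Context {R : realType} {H : hilbertType R}.
Implicit Types (x y : H) (K : H -> H).

(** Otherwise the images [K (f n)] would be orthogonal with norms at least [c], hence at mutual
    distance greater than [c], and could not cluster. *)
Lemma compact_eigenvalues_unbounded_below K (f : nat -> H) (k : nat -> R) (c : R) :
  compact_op K -> onseq f -> (forall n, K (f n) = (k n)%:C *: f n) -> 0 < c ->
  exists n, `|k n| < c.
Proof.
move=> cK fo Kf c0; apply: contrapT => h.
have {}h n : c <= `|k n| by rewrite leNgt; apply/negP => hn; apply: h; exists n.
have f1 n : nrm (f n) <= 1 by rewrite /nrm /nsq fo eqxx /= sqrtr1.
have [y hy] := compact_cluster cK f1.
have c2 : 0 < c / 2 by lra.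
have [n _ hn] := hy _ c2 0%N; have [m nm hm] := hy _ c2 n.+1.
have := nrm_tri (K (f n)) y (K (f m)); rewrite (nrmB y) => h1.
have {h1} : nrm (K (f n) - K (f m)) <= c by lra.
rewrite -(ler_pXn2r (n:=2)) ?nnegrE ?nrm_ge0 ?(ltW c0) // nrm_sqr.
have z0 : dotp (f n) (f m) = 0 by rewrite fo; case: eqP => // e; move: nm; rewrite e ltnn.
have hR : complex.Re ((k n)%:C * (Num.conj (k m)%:C * dotp (f n) (f m))) = 0.
  by rewrite z0 !mulr0.
have f2 i : nsq (f i) = 1 by rewrite /nsq fo eqxx.
rewrite !Kf nsqB !nsqZ !sqc_real dotpZl dotpZr hR !f2 mulr0 subr0 !mulr1.
have := h n; have := h m; rewrite -(real_normK (num_real (k n))) -(real_normK (num_real (k m))).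
nra.
Qed.

Lemma perp_image n (g : nat -> H) y :
  perp [set g i | i in [set i | (i < n)%N]] y <-> forall i, (i < n)%N -> dotp y (g i) = 0.
Proof.
split=> [h i i_n|h _ [i i_n <-]]; last exact: h.
by apply: h; exists i.
Qed.

Lemma onseqI (f : nat -> H) : (forall n, nsq (f n) = 1) ->
  (forall n i, (i < n)%N -> dotp (f n) (f i) = 0) -> onseq f.
Proof.
move=> f1 fo i j; case: eqP => [->|ij]; first by rewrite dotpxx f1.
have [h|h] : (i < j)%N \/ (j < i)%N by lia.
  by rewrite dotpC fo // rmorph0.
by rewrite fo.
Qed.

Theorem compact_positive_spectral K : infinite_dimensional H -> positive_op K ->
  compact_op K -> exists f (m : nat -> R), [/\ onseq f,
    (forall i j, (i <= j)%N -> m j <= m i), (forall i, 0 <= m i),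
    m @ \oo --> 0 & forall x, K x = diagop m f x].
Proof.
move=> infH pK cK; have lK := bop_lin pK.1.
pose q x := complex.Re (dotp (K x) x).
pose P n (g : nat -> H) x := [/\ nsq x = 1, (forall i, (i < n)%N -> dotp x (g i) = 0) &
  exists k : R, [/\ 0 <= k, K x = k%:C *: x &
    forall y, (forall i, (i < n)%N -> dotp y (g i) = 0) -> q y <= k * nsq y]].
have inv n (g : nat -> H) (k : nat -> R) : (forall i, (i < n)%N -> K (g i) = (k i)%:C *: g i) ->
    forall x, perp [set g i | i in [set i | (i < n)%N]] x ->
      perp [set g i | i in [set i | (i < n)%N]] (K x).
  move=> Kg x /perp_image xg; apply/perp_image => i i_n.
  by rewrite (positive_symmetric pK) Kg // dotpZr xg // mulr0.
have [||f fP] := @greedy_sequence H 0 P.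
- move=> n g g' x gg' [x1 xg [k [k0 Kx hk]]]; split => //.
    by move=> i i_n; rewrite -gg' // xg.
  exists k; split => // y yg; apply: hk => i i_n; by rewrite gg' // yg.
- move=> n g gP.
  have go : orthof n g.
    move=> i j i_n j_n; have [gi1 gio _] := gP i i_n; have [gj1 gjo _] := gP j j_n.
    case: eqP => [<-|ij]; first by rewrite dotpxx gi1.
    have [h|h] : (i < j)%N \/ (j < i)%N by lia.
      by rewrite dotpC gjo // rmorph0.
    by rewrite gio.
  have /choice[k hk] : forall i, exists k : R, (i < n)%N -> K (g i) = k%:C *: g i.
    move=> i; have [i_n|i_n] := ltnP i n; last by exists 0.
    by have [_ _ [k [_ Kg _]]] := gP i i_n; exists k.
  have [y [y1 yg]] := exists_orthogonal infH go.
  have [||x [k' [Wx x1 k0 Kx hx]]] := @top_eigenvector _ _ K [set g i | i in [set i | (i < n)%N]] pK cK.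
  + exact: (inv _ _ k).
  + exists y; first exact/perp_image.
    by move=> y0; move: y1; rewrite y0 nsq0; lra.
  + exists x; split => //; first exact/perp_image.
    exists k'; split => // z /perp_image; exact: hx.
have /choice[m mP] : forall n, exists k : R, [/\ 0 <= k, K (f n) = k%:C *: f n &
    forall y, (forall i, (i < n)%N -> dotp y (f i) = 0) -> q y <= k * nsq y].
  by move=> n; have [_ _ h] := fP n.
have fo : onseq f by apply: onseqI => n; have [] := fP n.
have qf n : q (f n) = m n.
  by have [_ Kf _] := mP n; rewrite /q Kf dotpZl fo eqxx mulr1.
have m0 n : 0 <= m n by have [] := mP n.
have mono i j : (i <= j)%N -> m j <= m i.
  move=> ij; have [_ _ h] := mP i; have := h (f j); rewrite qf /nsq fo eqxx /= mulr1; apply.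
  by move=> k ki; rewrite fo; case: eqP => // jk; lia.
have mcv : m @ \oo --> 0.
  apply/cvgrPdist_le => e e0.
  have [n hn] := compact_eigenvalues_unbounded_below cK fo (fun n => let: And3 _ h _ := mP n in h) e0.
  exists n => // k /= nk; rewrite sub0r normrN ger0_norm //.
  by apply: le_trans (mono _ _ nk) _; apply: le_trans (ltW hn); exact: ler_norm.
exists f, m; split => // x.
have mM i : `|m i| <= m 0%N by rewrite ger0_norm // mono.
apply/esym; apply: (diagop_unique fo mM) => e e0.
have d0 : 0 < e / (nrm x + 1) by rewrite divr_gt0 //; have := nrm_ge0 x; lra.
have /cvgrPdist_le/(_ _ d0)[N _ hN] := mcv.
exists N => n Nn; have := hN n Nn; rewrite /= sub0r normrN ger0_norm // => mn.
(* The error of the partial sum is [K] on the complement of the first [n] vectors, where its norm is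
   at most [m n]. This also covers the kernel of [K], which [f] may miss. *)
have -> : diag_sum m f x n = K (oproj n f x).
  rewrite /oproj (lin_sum lK); apply: eq_bigr => i _.
  by have [_ Kf _] := mP i; rewrite (linZ lK) Kf scalerA mulrC.
rewrite nrmB -(linB lK).
have Wx : perp [set f i | i in [set i | (i < n)%N]] (x - oproj n f x).
  by apply/perp_image => i i_n; apply: oproj_dotp => //; exact: onseq_orthof.
have [_ _ hmn] := mP n.
have hm y : perp [set f i | i in [set i | (i < n)%N]] y -> q y <= m n * nsq y.
  by move=> /perp_image; exact: hmn.
have Kb : nrm (K (x - oproj n f x)) <= m n * nrm (x - oproj n f x).
  apply: nrm_le; first by rewrite mulr_ge0 ?nrm_ge0.
  apply: le_trans (form_bound_nsq pK (inv n f m _) (m0 n) hm Wx) _.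
    by move=> i _; have [_ ? _] := mP i.
  by rewrite exprMn nrm_sqr expr2 -mulrA ler_wpM2l // hm.
have pc : nrm (x - oproj n f x) <= nrm x by apply: oproj_contract; exact: onseq_orthof.
apply: le_trans Kb _.
move: mn; rewrite ler_pdivlMr; last by have := nrm_ge0 x; lra.
have := m0 n; have := nrm_ge0 x; have := nrm_ge0 (x - oproj n f x); nra.
Qed.

End compact_positive.

(** * Spectral theorem for self-adjoint operators with compact resolvent *)

Section self_adjoint_spectral.
Context {R : realType} {H : hilbertType R}.
Variable D : partial_op H.
Hypotheses (infH : infinite_dimensional H) (saD : self_adjoint D)
  (cD : compact_resolvent D) (injD : forall x, pdom D x -> papp D x = 0 -> x = 0).
Implicit Types x y w : H.

Definition eigenvector x (l : R) := pdom D x /\ papp D x = l%:C *: x.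

Lemma pdom0 : pdom D 0.
Proof. by have [[]] := saD. Qed.

Lemma pdom_lincomb c x y : pdom D x -> pdom D y -> pdom D (c *: x + y).
Proof. by have [[_ h] _ _] := saD => hx hy; have [] := h c x y hx hy. Qed.

Lemma papp_lincomb c x y : pdom D x -> pdom D y ->
  papp D (c *: x + y) = c *: papp D x + papp D y.
Proof. by have [[_ h] _ _] := saD => hx hy; have [] := h c x y hx hy. Qed.

Lemma pdom_scale c x : pdom D x -> pdom D (c *: x).
Proof. by move=> hx; have := pdom_lincomb c hx pdom0; rewrite addr0. Qed.

Lemma papp0 : papp D 0 = 0.
Proof.
have := papp_lincomb 1 pdom0 pdom0; rewrite !scale1r addr0 => /eqP.
by rewrite -subr_eq0 opprD addrA subrr sub0r oppr_eq0 => /eqP.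
Qed.

Lemma papp_scale c x : pdom D x -> papp D (c *: x) = c *: papp D x.
Proof. by move=> hx; have := papp_lincomb c hx pdom0; rewrite papp0 !addr0. Qed.

Lemma papp_symmetric x y : pdom D x -> pdom D y -> dotp (papp D x) y = dotp x (papp D y).
Proof. by move=> hx hy; have [_ _ h] := saD; have [_] := h y (papp D y); apply. Qed.

Lemma eigenvector_scale c x l : eigenvector x l -> eigenvector (c *: x) l.
Proof.
by move=> [hx Dx]; split; [exact: pdom_scale|rewrite papp_scale // Dx !scalerA mulrC].
Qed.

Lemma eigenvector_dotp x y l : pdom D x -> eigenvector y l -> dotp (papp D x) y = l%:C * dotp x y.
Proof. by move=> hx [hy Dy]; rewrite papp_symmetric // Dy dotpZr conj_real. Qed.

Lemma eigenvector_orthogonal x y l l' : eigenvector x l -> eigenvector y l' -> l <> l' ->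
  dotp x y = 0.
Proof.
move=> ex ey ll'; have := eigenvector_dotp ex.1 ey; rewrite ex.2 dotpZl => /eqP.
rewrite -subr_eq0 -mulrBl mulf_eq0 => /orP[|/eqP //].
by rewrite -rmorphB /= eq_complex /= eqxx andbT subr_eq0 => /eqP.
Qed.

(* K = S^* S for the resolvent S at z. Since z need not be real, an eigenvector f
   of K yields y with (D - Re z) f = y and (D - Re z) y = c f: the span of f and y is
   D-invariant. *)
Lemma resolvent_square : exists (z : R[i]) K, [/\ positive_op K, compact_op K,
  (forall x l, eigenvector x l -> x <> 0 -> 0 < sqc (l%:C - z) /\ K x = (sqc (l%:C - z))^-1%:C *: x) &
  forall f (k : R), f <> 0 -> K f = k%:C *: f -> exists y (c : R),
    [/\ y = papp D f - (complex.Re z)%:C *: f, pdom D f, pdom D y &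
     papp D y - (complex.Re z)%:C *: y = c%:C *: f] ].
Proof.
have [z [S [[bS SD DS] cS]]] := cD.
pose T := adjoint S.
have bT : bounded_op T by exact: adjoint_bounded.
have ST x y : dotp (S x) y = dotp x (T y) by exact: adjoint_is.
(* [T] is the resolvent at the conjugate of [z]. Its range lies in the domain because the identity
   below puts [T w] into the domain of the adjoint of [D], which is that of [D]. *)
have TP w : pdom D (T w) /\ papp D (T w) = w + Num.conj z *: T w.
  have [_ _ h] := saD; have [h1 _] := h (T w) (w + Num.conj z *: T w).
  suff /h1[hT ->] : forall x, pdom D x -> dotp (papp D x) (T w) = dotp x (w + Num.conj z *: T w) by [].
  move=> x hx; have -> : papp D x = (papp D x - z *: x) + z *: x by rewrite subrK.
  by rewrite dotpDl -ST DS // dotpZl dotpDr dotpZr conjCK.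
have TS x : T (S x) = (T \o S) x by [].
have TD x : pdom D x -> T (papp D x - Num.conj z *: x) = x.
  move=> hx; apply: dotp_injr => y; rewrite -ST.
  have [hS DSy] := SD y.
  rewrite dotpBr -papp_symmetric // dotpZr conjCK -dotpZl -dotpBl.
  by rewrite DSy.
exists z, (T \o S); split.
- split; first exact: bounded_comp.
  by move=> x /=; rewrite dotpC -ST dotpxx conj_real ler0c nsq_ge0.
- exact: compact_comp_left.
- move=> x l [hx Dx] x0.
  have lz : l%:C - z <> 0.
    move=> lz; have := DS x hx; rewrite Dx -scalerBl lz scale0r (lin0 (bop_lin bS)).
    by move/esym.
  have sz : 0 < sqc (l%:C - z).
    by rewrite lt0r sqc_ge0 andbT; apply/eqP => /sqc_eq0.
  split => //.
  have Sx : (l%:C - z) *: S x = x.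
    by have := DS x hx; rewrite Dx -scalerBl (linZ (bop_lin bS)).
  have Tx : Num.conj (l%:C - z) *: T x = x.
    have -> : Num.conj (l%:C - z) = l%:C - Num.conj z.
      by case: (z) => a b; apply/eqP; rewrite eq_complex /=; apply/andP; split; apply/eqP; ring.
    by have := TD x hx; rewrite Dx -scalerBl (linZ (bop_lin bT)).
  have -> : (T \o S) x = (l%:C - z)^-1 *: T x.
    by rewrite /= -[in RHS]Sx (linZ (bop_lin bT)) scalerA mulVf ?scale1r //; apply/eqP.
  by rewrite -[in RHS]Tx scalerA invC_conj.
- move=> f k f0 Kf.
  have k0 : k%:C != 0.
    apply/eqP => k0; apply: f0; have [_ <-] := SD f.
    suff -> : S f = 0 by rewrite papp0 scaler0 subrr.
    apply: nsq_eq0; rewrite /nsq ST; have -> : T (S f) = 0 by move: Kf; rewrite /= k0 scale0r.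
    by rewrite dotp0r.
  (* Then [f = T g], so [(D - conj z) f = g] and [(D - z) g = f / k]. Completing the square in
     [(D - z) (D - conj z)] gives [(D - Re z)^2 f = (1/k - (Im z)^2) f]. *)
  pose g := k%:C^-1 *: S f.
  have [pg Dg] : pdom D g /\ papp D g = k%:C^-1 *: f + z *: g.
    have [h1 h2] := SD f; split; first exact: pdom_scale.
    by rewrite papp_scale // scalerA mulrC -scalerA -scalerDr; congr (_ *: _); rewrite -[in X in X + _]h2 subrK.
  have fE : f = T g.
    by rewrite /g (linZ (bop_lin bT)); have -> : T (S f) = k%:C *: f by []; rewrite scalerA mulVf // scale1r.
  have [pf Df] : pdom D f /\ papp D f = g + Num.conj z *: f by rewrite fE; exact: TP.
  exists (papp D f - (complex.Re z)%:C *: f), (k^-1 - complex.Im z ^+ 2).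
  have yE : papp D f - (complex.Re z)%:C *: f = (Num.conj z - (complex.Re z)%:C) *: f + g.
    by rewrite Df; apply: dotp_inj => v; rewrite !(dotpDl, dotpNl, dotpZl) /=; ring.
  split => //; first by rewrite yE; exact: pdom_lincomb.
  rewrite yE papp_lincomb // Dg Df.
  have hz : z = (complex.Re z)%:C - (Num.conj z - (complex.Re z)%:C).
    by case: (z) => a b; apply/eqP; rewrite eq_complex /=; apply/andP; split; apply/eqP; ring.
  have ha : (k^-1 - complex.Im z ^+ 2)%:C =
      k%:C^-1 + (Num.conj z - (complex.Re z)%:C) * (Num.conj z - (complex.Re z)%:C).
    rewrite rmorphB /= fmorphV; congr (_ + _).
    by case: (z) => a b; apply/eqP; rewrite eq_complex /=; apply/andP; split; apply/eqP; ring.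
  rewrite ha; move: (Num.conj z) (complex.Re z)%:C (k%:C^-1) hz => w a k' ->.
  apply: dotp_inj => v; rewrite !(dotpDl, dotpNl, dotpZl) /=.
  by ring.
Qed.

(** As [E] consists of eigenvectors, [perp E] is stable under [K], and a top eigenvector [f] of [K]
    there satisfies [(D - a)^2 f = s^2 f]. Factoring, [s f + y] with [y = (D - a) f] is an
    eigenvector for [a + s], unless it is 0, in which case [f] is one for [a - s]. *)
Lemma perp_eigenvector (E : set H) x : (forall e, E e -> exists l, eigenvector e l) ->
  perp E x -> x <> 0 -> exists y l, [/\ perp E y, y <> 0 & eigenvector y l].
Proof.
move=> eigE Ex x0.
have [z [K [pK cK KE Kf]]] := resolvent_square.
have [||f [k [Ef f1 k0 Kff _]]] := @top_eigenvector _ _ K E pK cK.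
- move=> w Ew e Ee; have [->|/eqP e0] := eqVneq e 0; first by rewrite dotp0r.
  have [l el] := eigE e Ee; have [_ Ke] := KE e l el e0.
  by rewrite (positive_symmetric pK) Ke dotpZr Ew // mulr0.
- by exists x.
have f0 : f <> 0 by move=> f0; move: f1; rewrite f0 nsq0; lra.
have [y [c [yE pf py Dy]]] := Kf f k f0 Kff.
set a := complex.Re z in yE Dy.
have Ey : perp E y.
  move=> e Ee; have [l el] := eigE e Ee.
  by rewrite yE dotpBl dotpZl (eigenvector_dotp pf el) Ef // !mulr0 subrr.
have cE : c = nsq y.
  have : dotp (papp D y - a%:C *: y) f = dotp y y.
    have h : dotp y y = dotp y (papp D f - a%:C *: f) by congr (dotp y _); exact: yE.
    by rewrite h dotpBl papp_symmetric // dotpZl dotpBr dotpZr conj_real.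
  by rewrite Dy dotpZl !dotpxx f1 mulr1 => /complexI.
have Df : papp D f = a%:C *: f + y by rewrite yE addrC subrK.
have [y0|/eqP y0] := eqVneq y 0.
  by exists f, a; split => //; split => //; rewrite Df y0 addr0.
pose s := Num.sqrt c.
have s2 : c = s ^+ 2 by rewrite sqr_sqrtr // cE nsq_ge0.
have Dy' : papp D y = a%:C *: y + c%:C *: f by rewrite -Dy addrC subrK.
have pw : pdom D (s%:C *: f + y) by exact: pdom_lincomb.
have [w0|/eqP w0] := eqVneq (s%:C *: f + y) 0.
  exists f, (a - s); split => //; split => //.
  rewrite Df rmorphB /= scalerBl; congr (_ + _).
  by apply/eqP; rewrite -subr_eq0 opprK addrC; apply/eqP.
exists (s%:C *: f + y), (a + s); split => //; first exact: perp_lincomb.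
split => //; rewrite papp_lincomb // Df Dy' s2 rmorphXn rmorphD /=.
by apply: dotp_inj => v; rewrite !(dotpDl, dotpZl); ring.
Qed.

Lemma eigenvalues_unbounded (f : nat -> H) (l : nat -> R) (M : R) : onseq f ->
  (forall n, eigenvector (f n) (l n)) -> exists n, M < `|l n|.
Proof.
move=> fo fl; have [z [K [pK cK KE _]]] := resolvent_square.
apply: contrapT => h.
have {}h n : `|l n| <= M by rewrite leNgt; apply/negP => hn; apply: h; exists n.
have f0 n : f n <> 0.
  by move=> fn; have := fo n n; rewrite fn dotp0l eqxx => /eqP; rewrite eq_sym oner_eq0.
(* Bounds the squared modulus of [l n - z], so the eigenvalues of [K] would stay above [B^-1]; the
   summand 1 makes [B] positive. *)
pose B := 2 * M ^+ 2 + 2 * sqc z + 1.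
have M0 : 0 <= M by exact: le_trans (h 0%N).
have B0 : 0 < B by rewrite /B; have := sqc_ge0 z; have := sqr_ge0 M; lra.
have lB n : sqc ((l n)%:C - z) <= B.
  have := h n; rewrite /B /sqc; case: (z) => a b /=.
  rewrite ler_norml => /andP[h1 h2].
  have : l n ^+ 2 <= M ^+ 2 by nra.
  by have := sqr_ge0 (l n + a); nra.
have B'0 : 0 < B^-1 by rewrite invr_gt0.
have [n] := compact_eigenvalues_unbounded_below cK fo (fun n => (KE _ _ (fl n) (f0 n)).2) B'0.
have [s0 _] := KE _ _ (fl n) (f0 n).
rewrite ger0_norm ?invr_ge0 ?ltW // ltf_pV2 ?posrE //.
by rewrite ltNge lB.
Qed.

Definition min_eigenvector n (g : nat -> H) x :=
  [/\ nsq x = 1, (forall i, (i < n)%N -> dotp x (g i) = 0) &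
   exists l, eigenvector x l /\ forall y l', y <> 0 -> eigenvector y l' ->
     (forall i, (i < n)%N -> dotp y (g i) = 0) -> `|l| <= `|l'|].

(** Without a minimum, one could descend forever through strictly decreasing moduli. Distinct
    eigenvalues make the eigenvectors orthogonal, so this would be an orthonormal sequence with
    bounded eigenvalues. *)
Lemma exists_min_eigenvector n g : (forall i, (i < n)%N -> min_eigenvector i g (g i)) ->
  exists x, min_eigenvector n g x.
Proof.
move=> gP; apply: contrapT => nomin.
pose W y l := [/\ nsq y = 1, (forall i, (i < n)%N -> dotp y (g i) = 0) & eigenvector y l].
have go : orthof n g.
  move=> i j i_n j_n; have [gi1 gio _] := gP i i_n; have [gj1 gjo _] := gP j j_n.
  case: eqP => [<-|ij]; first by rewrite dotpxx gi1.
  have [h|h] : (i < j)%N \/ (j < i)%N by lia.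
    by rewrite dotpC gjo // rmorph0.
  by rewrite gio.
have norm_W y l : y <> 0 -> eigenvector y l -> (forall i, (i < n)%N -> dotp y (g i) = 0) ->
    W ((nrm y)^-1%:C *: y) l.
  move=> y0 yl yg; split; first exact: unit_normalize.
    by move=> i i_n; rewrite dotpZl yg // mulr0.
  exact: eigenvector_scale.
have [y0 [l0 W0]] : exists y l, W y l.
  have [x [x1 xg]] := exists_orthogonal infH go.
  have [||| y [l [/perp_image Ey yn0 yl]]] := @perp_eigenvector [set g i | i in [set i | (i < n)%N]] x.
  - by move=> _ [i i_n <-]; have [_ _ [l [gl _]]] := gP i i_n; exists l.
  - exact/perp_image.
  - by move=> x0; move: x1; rewrite x0 nsq0; lra.
  - by exists ((nrm y)^-1%:C *: y), l; exact: norm_W.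
have /choice[nxt nxtP] : forall p : H * R, exists p' : H * R,
    W p.1 p.2 -> W p'.1 p'.2 /\ `|p'.2| < `|p.2|.
  move=> [y l]; have [Wy|nWy] := pselect (W y l); last by exists (y, l) => /= /nWy.
  apply: contrapT => h; apply: nomin; exists y; case: (Wy) => y1 yg yl; split => //.
  exists l; split => // y' l' y'0 y'l' y'g; rewrite leNgt; apply/negP => ll'.
  apply: h; exists ((nrm y')^-1%:C *: y', l') => _ /=; split => //.
  exact: norm_W.
pose p k := iter k nxt (y0, l0).
have Wp k : W (p k).1 (p k).2.
  by elim: k => // k IH; rewrite /p iterS; have [] := nxtP _ IH.
have dec k : `|(p k.+1).2| < `|(p k).2| by rewrite /p iterS; have [] := nxtP _ (Wp k).
have dec2 i j : (i < j)%N -> `|(p j).2| < `|(p i).2|.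
  elim: j => // j IH; rewrite ltnS leq_eqVlt => /orP[/eqP ->|/IH]; first exact: dec.
  exact: lt_trans (dec j).
have fo : onseq (fun k => (p k).1).
  apply: onseqI => k; first by have [] := Wp k.
  move=> i ik; have [_ _ h1] := Wp k; have [_ _ h2] := Wp i.
  apply: eigenvector_orthogonal h1 h2 _ => h; have := dec2 _ _ ik; rewrite h ltxx //.
have [k hk] := @eigenvalues_unbounded (fun k => (p k).1) (fun k => (p k).2) `|l0| fo (fun k => let: And3 _ _ h := Wp k in h).
case: k hk => [|k] hk; first by move: hk; rewrite ltxx.
by have := lt_trans hk (dec2 0%N k.+1 isT); rewrite ltxx.
Qed.

(** Minimal choice gives completeness: a nonzero vector orthogonal to every [e n] would yield an
    eigenvector that competed at every stage, so its eigenvalue would bound all the [l n]. *)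
Theorem self_adjoint_spectral : exists (e : nat -> H) (l : nat -> R), [/\ onseq e,
  (forall x, (forall n, dotp x (e n) = 0) -> x = 0),
  (forall n, eigenvector (e n) (l n)),
  (forall i j, (i <= j)%N -> `|l i| <= `|l j|) &
  (forall n, l n != 0) /\ forall M : R, exists n, M < `|l n|].
Proof.
have [||e eP] := @greedy_sequence H 0 min_eigenvector; last first.
- have /choice[l lP] : forall n, exists l, eigenvector (e n) l /\ forall y l', y <> 0 -> eigenvector y l' ->
     (forall i, (i < n)%N -> dotp y (e i) = 0) -> `|l| <= `|l'|.
    by move=> n; have [_ _ h] := eP n.
  have eo : onseq e by apply: onseqI => n; have [] := eP n.
  have e0 n : e n <> 0.
    by move=> fn; have := eo n n; rewrite fn dotp0l eqxx => /eqP; rewrite eq_sym oner_eq0.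
  have unb (M : R) : exists n, M < `|l n|.
    by apply: eigenvalues_unbounded eo _ => n; have [] := lP n.
  exists e, l; split => //.
  + move=> x xe; apply: contrapT => x0.
    have [|||y [l' [Ey y0 yl]]] := @perp_eigenvector (range e) x.
    * by move=> _ [n _ <-]; exists (l n); have [] := lP n.
    * by move=> _ [n _ <-].
    * exact: x0.
    have [n] := unb `|l'|; have [_ h] := lP n.
    by rewrite ltNge (h y l') // => i _; apply: Ey; exists i.
  + by move=> n; have [] := lP n.
  + move=> i j ij; have [_ h] := lP i; apply: (h (e j)) => //; first by have [] := lP j.
    by move=> k ki; rewrite eo; case: eqP => // jk; lia.
  + split => // n; apply/eqP => ln0; apply: (e0 n); have [[pe De] _] := lP n.
    by apply: injD => //; rewrite De ln0 scale0r.
- exact: exists_min_eigenvector.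
- move=> n g g' x gg' [x1 xg [l [xl hl]]]; split => //.
    by move=> i i_n; rewrite -gg' // xg.
  exists l; split => // y l' y0 yl' yg; apply: hl yl' _ => // i i_n; by rewrite gg' // yg.
Qed.

End self_adjoint_spectral.

(** * Singular values and partial sums *)

Section dimension.
Context {R : realType} {H : hilbertType R}.
Implicit Types (x y : H).

Lemma lin_indep_le n p (e : 'I_n -> H) (f : 'I_p -> H) : lin_indep e ->
  (forall i, in_span f (e i)) -> (n <= p)%N.
Proof.
move=> le /choice[c cP].
pose M : 'M[R[i]]_(n, p) := \matrix_(i, j) c i j.
suff /eqP <- : row_free M by exact: rank_leq_col.
rewrite -kermx_eq0; apply/eqP/matrixP => i j; rewrite [RHS]mxE.
apply: (le (fun k => kermx M i k)).
transitivity (\sum_j (kermx M *m M) i j *: f j); last first.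
  by rewrite mulmx_ker big1 // => k _; rewrite mxE scale0r.
under eq_bigr => k _ do rewrite cP scaler_sumr.
rewrite exchange_big /=; apply: eq_bigr => k _.
rewrite mxE scaler_suml; apply: eq_bigr => h _.
have ME : M h k = c h k by rewrite mxE.
by rewrite ME scalerA.
Qed.

Lemma has_dim_unique (V : set H) n p : has_dim V n -> has_dim V p -> n = p.
Proof.
move=> [e le Ve] [f lf Vf].
have self_span k (g : 'I_k -> H) i : in_span g (g i).
  exists (fun j => (j == i)%:R); rewrite (bigD1 i) //= eqxx scale1r big1 ?addr0 //.
  by move=> j /negPf ->; rewrite scale0r.
apply/eqP; rewrite eqn_leq; apply/andP; split.
  apply: (@lin_indep_le _ _ e f le) => i.
  suff : [set x | in_span f x] (e i) by [].
  by rewrite -Vf Ve; exact: self_span.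
apply: (@lin_indep_le _ _ f e lf) => i.
suff : [set x | in_span e x] (f i) by [].
by rewrite -Ve Vf; exact: self_span.
Qed.

Lemma orthof_lin_indep n (f : nat -> H) : orthof n f -> lin_indep (fun i : 'I_n => f i).
Proof.
move=> fo c c0 i.
pose c' k := if insub k is Some j then c j else 0 : R[i].
have cE j : c j = c' (val j) by rewrite /c' valK.
have := orthof_dotp c' fo (ltn_ord i).
rewrite cE; under eq_bigr => k _ do rewrite -cE.
by rewrite c0 dotp0l => <-.
Qed.

End dimension.

Section eigenvalue_sequences.
Context {R : realType} {H : hilbertType R}.
Implicit Types (P : H -> H) (m : nat -> R).

Lemma finite_card_proper (A B : set nat) k : A `<=` B -> (A #= `I_k)%card ->
  (B #= `I_k)%card -> B `<=` A.
Proof.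
move=> AB Ak Bk.
have fA : finite_set A by exists k.
have fB : finite_set B by exists k.
have fAB : (fset_set A `<=` fset_set B)%fset by rewrite -fset_set_sub.
have : fset_set A = fset_set B.
  by apply/eqP; rewrite eqEfcard fAB (card_fset_set Ak) (card_fset_set Bk) /=.
by move=> /fset_set_inj -> //.
Qed.

(** Suppose [m n < m' n = l]. Every index with [m i = l] is then below [n], so it also satisfies
    [m' i = l]. Both level sets have as many elements as the eigenspace has dimensions, yet [n]
    belongs only to the second. *)
Lemma eigenvalue_seq_le P m m' : eigenvalue_seq P m -> eigenvalue_seq P m' ->
  forall n, (forall i, (i < n)%N -> m i = m' i) -> m' n <= m n.
Proof.
move=> [dm m0 hm] [dm' m0' hm'] n mm'; rewrite leNgt; apply/negP => lt.
have l0 : 0 < m' n by apply: le_lt_trans lt.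
have [k [Ak Vk]] := hm _ l0; have [k' [Ak' Vk']] := hm' _ l0.
rewrite (has_dim_unique Vk' Vk) in Ak'.
suff /finite_card_proper/(_ Ak Ak') : [set i | m i = m' n] `<=` [set i | m' i = m' n].
  by move=> /(_ n erefl) /= e; move: lt; rewrite e ltxx.
move=> i /= mi; rewrite -mm' //; rewrite ltnNge; apply/negP => /dm; rewrite mi.
by rewrite leNgt lt.
Qed.

Lemma eigenvalue_seq_unique P m m' : eigenvalue_seq P m -> eigenvalue_seq P m' -> m = m'.
Proof.
move=> hm hm'; apply/funext; elim/ltn_ind => n IH.
apply/le_anti/andP; split.
  by apply: (eigenvalue_seq_le hm' hm) => i i_n; rewrite IH.
exact: (eigenvalue_seq_le hm hm').
Qed.

Lemma diagop_eigenvalue_seq m (f : nat -> H) : onseq f ->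
  (forall i j, (i <= j)%N -> m j <= m i) -> (forall n, 0 <= m n) -> m @ \oo --> 0 ->
  eigenvalue_seq (diagop m f) m.
Proof.
move=> fo dm m0 mcv; split => // l l0.
have small (c : R) : 0 < c -> exists n, m n < c.
  move=> c0; have /cvgrPdist_lt/(_ _ c0)[N _ hN] := mcv.
  by exists N; have := hN N (leqnn N); rewrite /= sub0r normrN ger0_norm.
have mM i : `|m i| <= m 0%N by rewrite ger0_norm // dm.
have exq : exists n, m n < l by exact: small.
have exp : exists n, m n <= l by have [n hn] := exq; exists n; exact: ltW.
(* By monotonicity the indices [i] with [m i = l] form the interval from [p] to [q], with [q]
   excluded. *)
pose p := ex_minn exp; pose q := ex_minn exq.
have pP i : (p <= i)%N = (m i <= l).
  rewrite /p; case: ex_minnP => a ha hm; apply/idP/idP => [ai|]; last exact: hm.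
  by apply: le_trans (dm _ _ ai) ha.
have qP i : (q <= i)%N = (m i < l).
  rewrite /q; case: ex_minnP => a ha hm; apply/idP/idP => [ai|]; last exact: hm.
  by apply: le_lt_trans (dm _ _ ai) ha.
have pq : (p <= q)%N by rewrite pP ltW // -qP.
have mE i : (m i = l) <-> (p <= i < q)%N.
  rewrite pP ltnNge qP -leNgt; split => [->|/andP[h1 h2]]; first by rewrite lexx.
  by apply/le_anti; rewrite h1.
exists (q - p)%N; split.
  have -> : [set n | m n = l] = (addn p) @` `I_(q - p).
    apply/seteqP; split => [i /= /mE h|_ [i /= ilt <-]].
      by exists (i - p)%N => /=; lia.
    by apply/mE; lia.
  by apply: inj_card_eq => i j _ _; exact: addnI.
exists (fun i : 'I_(q - p) => f (p + i)%N).
  apply: (@orthof_lin_indep _ _ (q - p) (fun i => f (p + i)%N)).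
  by move=> i j _ _; rewrite fo eqn_add2l.
apply/seteqP; split => [x /= Px|x [c ->] /=]; last first.
  have lQ := bop_lin (diagop_bounded fo mM).
  rewrite (big_morph _ (linD lQ) (lin0 lQ)) scaler_sumr; apply: eq_bigr => i _.
  rewrite (linZ lQ) (diagop_eigen fo mM) !scalerA mulrC; congr (_%:C * _ *: _).
  by apply/mE; have := ltn_ord i; lia.
have xf i : ~~ (p <= i < q)%N -> dotp x (f i) = 0.
  move=> /negP npq; have := diagop_dotp fo mM x i.
  rewrite Px dotpZl => /eqP; rewrite -subr_eq0 -mulrBl mulf_eq0 => /orP[|/eqP //].
  rewrite -rmorphB /= eq_complex /= eqxx andbT subr_eq0 => /eqP lm.
  by case: npq; apply/mE.
exists (fun i => dotp x (f (p + i)%N)).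
suff : diagop m f x = l%:C *: \sum_(i < q - p) dotp x (f (p + i)%N) *: f (p + i)%N.
  rewrite Px => /(congr1 (fun v => l%:C^-1 *: v)).
  have lC : l%:C != 0 :> R[i] by rewrite eq_complex /= eqxx andbT gt_eqF.
  by rewrite !scalerA mulVf // !scale1r.
apply: (diagop_unique fo mM) => e e0; exists q => n qn.
rewrite /diag_sum -(big_mkord xpredT (fun i => ((m i)%:C * dotp x (f i)) *: f i)).
rewrite (@big_cat_nat _ _ _ p) ?(leq_trans pq) //= (@big_cat_nat _ _ _ q p) //=.
rewrite big_nat_cond big1 => [|i /andP[/andP[_ ip] _]]; last first.
  by rewrite xf ?mulr0 ?scale0r // negb_and -ltnNge ip.
rewrite [X in _ + (_ + X)]big_nat_cond [X in _ + (_ + X)]big1 => [|i /andP[/andP[qi _] _]]; last first.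
  by rewrite xf ?mulr0 ?scale0r // negb_and -leqNgt qi orbT.
rewrite add0r addr0 -{1}(add0n p) big_addn big_mkord scaler_sumr -sumrB.
rewrite big1 ?nrm0 ?ltW // => i _; rewrite addnC scalerA.
have -> : m (p + i)%N = l by apply/mE; have := ltn_ord i; lia.
by rewrite subrr.
Qed.

End eigenvalue_sequences.

Section step_functions.
Context {R : realType}.
Local Notation mu := (@lebesgue_measure R).
Variable m : nat -> R.
Hypotheses (dm : forall i j, (i <= j)%N -> m j <= m i) (m0 : forall n, 0 <= m n).
Local Notation g := (fun x : R => m (Num.truncn x)).

Lemma step_measurable (A : set R) : measurable A -> measurable_fun A g.
Proof.
by move=> mA; apply: nonincreasing_measurable => // x y xy; apply: dm; exact: le_truncn.
Qed.

Lemma step_integral n :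
  (\int[mu]_(x in `[0%R, (n%:R)%R]) (g x)%:E = (\sum_(i < n) m i)%:E)%E.
Proof.
have mg A : measurable A -> measurable_fun A (EFin \o g).
  by move=> mA; apply/measurable_EFinP; exact: step_measurable.
rewrite -(@integral_itv_bndo_bndc _ _ _ (EFin \o g)); last exact: mg.
elim: n => [|n IH]; first by rewrite set_itv_ge ?integral_set0 ?big_ord0 // bnd_simp ltxx.
have -> : `[0, n.+1%:R[%classic = (`[0, n%:R[ `|` `[n%:R, n.+1%:R[)%classic :> set R.
  by rewrite -itv_bndbnd_setU // bnd_simp ?ler0n // ler_nat.
rewrite ge0_integral_setU //=; last 3 first.
- by apply: mg; exact: measurableU.
- by move=> x _; rewrite lee_fin.
- rewrite disj_set2E; apply/eqP/seteqP; split => // x [] /=; rewrite !in_itv /= => /andP[_ h1] /andP[h2 _].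
  by move: (lt_le_trans h1 h2); rewrite ltxx.
rewrite IH big_ord_recr /= EFinD; congr (_ + _)%E.
rewrite (eq_integral (fun=> (m n)%:E)); last first.
  by move=> x /set_mem /=; rewrite in_itv /= => /truncn_def ->.
rewrite integral_cst //= lebesgue_measure_itv /= lte_fin ltr_nat ltnSn.
by rewrite -EFinB -natrB // subSnn mule1.
Qed.

Lemma step_Rintegral n : Rintegral mu `[0, n%:R] g = \sum_(i < n) m i.
Proof. by rewrite /Rintegral step_integral. Qed.

Lemma step_integral_le (s t : R) : s <= t ->
  (\int[mu]_(x in `[0%R, s]) (g x)%:E <= \int[mu]_(x in `[0%R, t]) (g x)%:E)%E.
Proof.
move=> st; apply: ge0_subset_integral => //.
- by apply/measurable_EFinP; exact: step_measurable.
- by move=> x _; rewrite lee_fin.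
- by move=> x /=; rewrite !in_itv /= => /andP[-> /le_trans]; apply.
Qed.

Lemma step_Rintegral_le (s t : R) : s <= t ->
  Rintegral mu `[0, s] g <= Rintegral mu `[0, t] g.
Proof.
move=> st; have fin_int u : (\int[mu]_(x in `[0%R, u]) (g x)%:E)%E \is a fin_num.
  rewrite ge0_fin_numE; last by apply: integral_ge0 => x _; rewrite lee_fin.
  apply: le_lt_trans (@step_integral_le u (Num.truncn u).+1%:R _) _; first exact/ltW/truncnS_gt.
  by rewrite step_integral ltry.
by rewrite /Rintegral fine_le //; exact: step_integral_le.
Qed.

End step_functions.

(** * Positive square roots and singular values *)

Section absolute_value.
Context {R : realType} {H : hilbertType R}.
Implicit Types (a P : H -> H) (m : nat -> R) (f : nat -> H) (x : H).

Lemma diagop_sqr m f (M : R) x : onseq f -> (forall i, `|m i| <= M) ->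
  diagop m f (diagop m f x) = diagop (fun i => m i ^+ 2) f x.
Proof.
move=> fo mM; have lQ := bop_lin (diagop_bounded fo mM).
have mM2 i : `|m i ^+ 2| <= M ^+ 2.
  by rewrite normrX lerXn2r ?nnegrE // (le_trans _ (mM 0%N)).
apply/esym/(diagop_unique fo mM2).
have := hcv_bop (diagop_bounded fo mM) (diagop_cvg fo mM x).
congr (hcv _ _); apply/funext => n.
rewrite /diag_sum (lin_sum lQ).
apply: eq_bigr => i _; rewrite (linZ lQ) (diagop_eigen fo mM) scalerA.
by rewrite rmorphXn /= mulrAC.
Qed.

(** The vector [y = P x - l x] satisfies [P y = - l y], which positivity of [P] forbids for [l > 0]
    unless [y = 0]. *)
Lemma positive_sqrt_eigen P (l : R) x : positive_op P -> 0 <= l ->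
  P (P x) = (l ^+ 2)%:C *: x -> P x = l%:C *: x.
Proof.
move=> pP l0 PP; have lP := bop_lin pP.1.
have [l00|ln0] := eqVneq l 0.
  rewrite l00 scale0r; apply: nsq_eq0.
  by rewrite /nsq -(positive_symmetric pP) PP l00 expr0n scale0r dotp0l.
apply/eqP; rewrite -subr_eq0; apply/eqP; set y := _ - _.
have Py : P y = - (l%:C *: y).
  rewrite /y (linB lP) (linZ lP) PP scalerBr scalerA -rmorphM /= opprB.
  by rewrite expr2.
have := positive_ge0 y pP; rewrite Py dotpNl dotpZl ReN Re_realM -/(nsq y) => h.
apply: nsq_eq0; have := nsq_ge0 y; have : 0 < l by rewrite lt0r ln0.
by move=> l1 y0; nra.
Qed.

(** On the [f n] this is [positive_sqrt_eigen]; on their orthogonal complement the square of [P]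
    vanishes, and the case [l = 0] of the same lemma shows that [P] does. *)
Lemma positive_sqrt_unique P m f (M : R) : onseq f -> (forall i, 0 <= m i) ->
  (forall i, `|m i| <= M) -> positive_op P ->
  (forall x, P (P x) = diagop (fun i => m i ^+ 2) f x) -> forall x, P x = diagop m f x.
Proof.
move=> fo m0 mM pP PP x; have lP := bop_lin pP.1.
have mM2 i : `|m i ^+ 2| <= M ^+ 2.
  by rewrite normrX lerXn2r ?nnegrE // (le_trans _ (mM 0%N)).
have Pf n : P (f n) = (m n)%:C *: f n.
  by apply: positive_sqrt_eigen => //; rewrite PP (diagop_eigen fo mM2).
have h1 (i : nat) : `|(1 : R)| <= 1 by rewrite normr1.
pose p := diagop (fun=> 1) f x.
have Pp : P p = diagop m f x.
  apply/esym/(diagop_unique fo mM); have := hcv_bop pP.1 (diagop_cvg fo h1 x).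
  congr (hcv _ _); apply/funext => n.
  rewrite /diag_sum (lin_sum lP).
  by apply: eq_bigr => i _; rewrite (linZ lP) Pf scalerA rmorph1 mul1r mulrC.
have wf j : dotp (x - p) (f j) = 0.
  by rewrite dotpBl (diagop_dotp fo h1) rmorph1 mul1r subrr.
have PPw : P (P (x - p)) = 0.
  rewrite PP; apply: (diagop_unique fo mM2) => e e0; exists 0%N => n _.
  by rewrite subr0 /diag_sum big1 ?nrm0 ?ltW // => i _; rewrite wf mulr0 scale0r.
have : P (x - p) = (0 : R)%:C *: (x - p).
  by apply: positive_sqrt_eigen; rewrite // PPw expr0n scale0r.
rewrite scale0r (linB lP) Pp => /eqP; rewrite subr_eq0 => /eqP //.
Qed.

Lemma abs_op_diagop a m f (M : R) : onseq f -> (forall i, 0 <= m i) ->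
  (forall i, `|m i| <= M) ->
  (forall x, adjoint a (a x) = diagop (fun i => m i ^+ 2) f x) -> abs_op a = diagop m f.
Proof.
move=> fo m0 mM aa; pose Pr := [set P | positive_op P /\ P \o P = adjoint a \o a].
have PrQ : Pr (diagop m f).
  split; first exact: diagop_positive mM m0.
  by apply/funext => x /=; rewrite aa (diagop_sqr x fo mM).
have [pP PP] : Pr (get Pr) by apply: getPex; exists (diagop m f).
apply/funext => x; apply: (positive_sqrt_unique fo m0 mM pP) => y.
by rewrite -aa -/((adjoint a \o a) y) -PP.
Qed.

Lemma mu_seq_diagop a m f : onseq f -> (forall i j, (i <= j)%N -> m j <= m i) ->
  (forall n, 0 <= m n) -> m @ \oo --> 0 -> abs_op a = diagop m f -> mu_seq a = m.
Proof.
move=> fo dm m0 mcv ae.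
have em : eigenvalue_seq (abs_op a) m by rewrite ae; exact: diagop_eigenvalue_seq.
apply: (eigenvalue_seq_unique _ em); apply: (getPex (P := [set m | eigenvalue_seq (abs_op a) m])).
by exists m.
Qed.

Lemma noninc_norm_le m : (forall i j, (i <= j)%N -> m j <= m i) -> (forall n, 0 <= m n) ->
  forall i, `|m i| <= m 0%N.
Proof. by move=> dm m0 i; rewrite ger0_norm // dm. Qed.

Lemma abs_op_diagop_self m f (M : R) : onseq f -> (forall i, 0 <= m i) ->
  (forall i, `|m i| <= M) -> abs_op (diagop m f) = diagop m f.
Proof.
move=> fo m0 mM; apply: (abs_op_diagop fo m0 mM) => x.
by rewrite (adjoint_unique (diagop_symmetric fo mM)) (diagop_sqr x fo mM).
Qed.

(** The last clause, orthogonality of the images [a (f i)], replaces a polar decomposition of [a] in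
    what follows. *)
Lemma compact_singular_values a : infinite_dimensional H -> bounded_op a -> compact_op a ->
  exists f m, [/\ onseq f, (forall i j, (i <= j)%N -> m j <= m i), (forall n, 0 <= m n),
    mu_seq a = m &
    forall i j, dotp (a (f i)) (a (f j)) = (m i ^+ 2)%:C * (i == j)%:R].
Proof.
move=> infH ba ca.
have pK : positive_op (adjoint a \o a).
  split; first exact: bounded_comp (adjoint_bounded ba) ba.
  by move=> x /=; rewrite dotp_adjoint // dotpxx ler0c nsq_ge0.
have cK : compact_op (adjoint a \o a) by apply: compact_comp_left => //; exact: adjoint_bounded.
have [f [s [fo ds s0 scv sK]]] := compact_positive_spectral infH pK cK.
pose m i := Num.sqrt (s i).
have m2 i : m i ^+ 2 = s i by rewrite sqr_sqrtr.
have m0 i : 0 <= m i by exact: sqrtr_ge0.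
have dm i j : (i <= j)%N -> m j <= m i by move=> ij; rewrite ler_wsqrtr // ds.
have mcv : m @ \oo --> 0.
  by rewrite -(@sqrtr0 R); apply: continuous_cvg scv; exact: sqrt_continuous.
have sE : (fun i => m i ^+ 2) = s by apply/funext.
have ae : abs_op a = diagop m f.
  apply: (abs_op_diagop fo m0 (noninc_norm_le dm m0)) => x.
  by rewrite sE -sK.
exists f, m; split => //; first exact: mu_seq_diagop ae.
move=> i j; rewrite -dotp_adjoint // -/((adjoint a \o a) (f i)) sK.
by rewrite (diagop_eigen fo (noninc_norm_le ds s0)) dotpZl fo m2.
Qed.

End absolute_value.

Section partial_sums.
Context {R : realType} {H : hilbertType R}.
Variables (a : H -> H) (m : nat -> R).
Hypotheses (dm : forall i j, (i <= j)%N -> m j <= m i) (m0 : forall n, 0 <= m n)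
  (am : mu_seq a = m).

Lemma S_up_nat n : S_up a n%:R = \sum_(i < n) m i.
Proof. by rewrite /S_up /mu_fun am step_Rintegral. Qed.

Lemma S_up_le (s t : R) : s <= t -> S_up a s <= S_up a t.
Proof. by rewrite /S_up /mu_fun am; exact: step_Rintegral_le. Qed.

Lemma S_up_ge0 t : 0 <= S_up a t.
Proof. by rewrite /S_up /mu_fun am; apply: Rintegral_ge0 => x _; exact: m0. Qed.

Lemma summable_S_up (M t : R) : (forall n, \sum_(i < n) m i <= M) -> S_up a t <= M.
Proof.
move=> mM; apply: le_trans (@S_up_le t (Num.truncn t).+1%:R _) _; first exact/ltW/truncnS_gt.
by rewrite S_up_nat.
Qed.

Lemma summable_S_up_cvg (M : R) : (forall n, \sum_(i < n) m i <= M) ->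
  S_up a t / ln t @[t --> +oo] --> (0 : R).
Proof.
move=> mM; apply/cvgrPdist_le => e e0.
have M0 : 0 <= M by have := mM 0%N; rewrite big_ord0.
exists (expR (M / e + 1)); split; first exact: num_real.
move=> t ht; have t0 : 0 < t by apply: lt_trans ht; exact: expR_gt0.
have Me : 0 <= M / e by rewrite divr_ge0 // ltW.
have lt : M / e + 1 < ln t by rewrite -ltr_expR lnK.
have l0 : 0 < ln t by apply: le_lt_trans lt; lra.
rewrite sub0r normrN ger0_norm; last by rewrite divr_ge0 ?S_up_ge0 // ltW.
rewrite ler_pdivrMr //; apply: le_trans (summable_S_up t mM) _.
rewrite -ler_pdivrMl // mulrC; lra.
Qed.

Lemma summable_L1oo0 (M : R) : compact_op a -> (forall n, \sum_(i < n) m i <= M) -> L1oo0 a.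
Proof. by move=> ca mM; split => //; exact: summable_S_up_cvg mM. Qed.

Lemma summable_L1oo (M : R) : compact_op a -> (forall n, \sum_(i < n) m i <= M) -> L1oo a.
Proof.
move=> ca mM; split => //; exists 1.
have /cvgrPdist_le/(_ _ ltr01) := summable_S_up_cvg mM.
apply: filterS => t; rewrite sub0r normrN; exact: le_trans (ler_norm _).
Qed.

Lemma L1oo_log_bound : L1oo a -> exists M (N : nat), forall n, (N <= n)%N ->
  \sum_(i < n) m i <= M * ln n%:R.
Proof.
(* The maximum with 1 makes [ln n] positive, so that the quotient can be cleared. *)
move=> [_ [M [K [_ hK]]]]; exists M, (Num.truncn (Num.max K 1)).+1 => n Nn.
have hn : Num.max K 1 < n%:R.
  by apply: lt_le_trans (truncnS_gt _) _; rewrite ler_nat.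
have [Kn n1] : K < n%:R /\ 1 < n%:R :> R by move: hn; rewrite gt_max => /andP.
by have := hK _ Kn; rewrite S_up_nat ler_pdivrMr // ln_gt0.
Qed.

Lemma L1oo0_L1oo : L1oo0 a -> L1oo a.
Proof.
move=> [ca h]; split => //; exists 1; have /cvgrPdist_le/(_ _ ltr01) := h.
apply: filterS => t; rewrite sub0r normrN; exact: le_trans (ler_norm _).
Qed.

Lemma summable_dixmier_weight Lim (M : R) : generalized_limit Lim -> compact_op a ->
  (forall n, \sum_(i < n) m i <= M) -> dixmier_weight Lim a = 0%E.
Proof.
move=> gL ca mM; rewrite /dixmier_weight asboolT; last exact: summable_L1oo mM.
rewrite (glim_cvg gL (l := 0)) //.
exact: (cvg_comp _ _ (@cvgr_idn R) (summable_S_up_cvg mM)).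
Qed.

End partial_sums.

(** * Functional calculus and vanishing of the Dixmier trace on trace class operators *)

Section functional_calculus.
Context {R : realType} {H : hilbertType R}.
Implicit Types (x y : H).

Definition complete_seq (e : nat -> H) := forall x, (forall n, dotp x (e n) = 0) -> x = 0.

Lemma complete_inj e x y : complete_seq e -> (forall n, dotp x (e n) = dotp y (e n)) -> x = y.
Proof.
move=> ce h; apply/eqP; rewrite -subr_eq0; apply/eqP; apply: ce => n.
by rewrite dotpBl h subrr.
Qed.

Lemma diagop1 e x : onseq e -> complete_seq e -> diagop (fun=> 1) e x = x.
Proof.
move=> eo ce; have h1 (i : nat) : `|(1 : R)| <= 1 by rewrite normr1.
by apply: (complete_inj ce) => n; rewrite (diagop_dotp eo h1) rmorph1 mul1r.
Qed.

Lemma bounded_eq_on_basis (B C : H -> H) e : onseq e -> complete_seq e ->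
  bounded_op B -> bounded_op C -> (forall n, B (e n) = C (e n)) -> B = C.
Proof.
move=> eo ce bB bC BC; apply/funext => x.
have h1 (i : nat) : `|(1 : R)| <= 1 by rewrite normr1.
have := diagop_cvg eo h1 x; rewrite diagop1 // => cx.
apply: hcv_uniq (hcv_bop bB cx) _.
have := hcv_bop bC cx; congr (hcv _ _); apply/funext => n.
rewrite /diag_sum (lin_sum (bop_lin bB)).
rewrite (lin_sum (bop_lin bC)).
by apply: eq_bigr => i _; rewrite (linZ (bop_lin bB)) (linZ (bop_lin bC)) BC.
Qed.

(** By [Dx], an eigenvector for [l] has no component along an [e n] of another eigenvalue, so the
    diagonal operator meets the specification of [fun_calc]; completeness of [e] makes it the only
    one that does. *)
Lemma fun_calc_diagop (g : R -> R) (D : partial_op H) e (l : nat -> R) (M : R) :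
  onseq e -> complete_seq e -> (forall n, pdom D (e n) /\ papp D (e n) = (l n)%:C *: e n) ->
  (forall x n, pdom D x -> dotp (papp D x) (e n) = (l n)%:C * dotp x (e n)) ->
  (forall n, `|g (l n)| <= M) -> fun_calc g D = diagop (fun n => g (l n)) e.
Proof.
move=> eo ce De Dx gM.
pose Pr := [set B : H -> H | bounded_op B /\ forall (l : R) x, pdom D x -> papp D x = l%:C *: x ->
      B x = (g l)%:C *: x].
have bB := diagop_bounded eo gM.
have PrB : Pr (diagop (fun n => g (l n)) e).
  split => // r x dx xE; apply: (complete_inj ce) => n.
  rewrite (diagop_dotp eo gM) dotpZl.
  have := Dx x n dx; rewrite xE dotpZl => /eqP; rewrite -subr_eq0 -mulrBl mulf_eq0 => /orP[|/eqP ->].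
    by rewrite -rmorphB /= eq_complex /= eqxx andbT subr_eq0 => /eqP ->.
  by rewrite !mulr0.
have [b1 b2] : Pr (get Pr) by apply: getPex; exists (diagop (fun n => g (l n)) e).
apply: (bounded_eq_on_basis eo ce b1 bB) => n; have [dn en] := De n.
by rewrite (b2 _ _ dn en) (diagop_eigen eo gM).
Qed.

End functional_calculus.

Section trace_class.
Context {R : realType} {H : hilbertType R}.
Implicit Types (x y : H) (a b T : H -> H).

Lemma Re_mul_conj_le (u v : R[i]) : complex.Re (u * Num.conj v) <= (sqc u + sqc v) / 2.
Proof.
case: u v => [p q] [r s]; rewrite /sqc /= ler_pdivlMr //.
by have := sqr_ge0 (p - r); have := sqr_ge0 (q - s); nra.
Qed.

(* Bessel families, unlike orthonormal ones, are preserved by contractions, and they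
   admit the vectors a(f_i)/m_i with 0 in place of those with m_i = 0. *)
Definition trace_bounded T (V : R) := forall n f g, bessel_family n f -> bessel_family n g ->
  \sum_(i < n) complex.Re (dotp (T (f i)) (g i)) <= V.

Lemma bessel_family_scale n (g : nat -> H) (c : R[i]) : sqc c <= 1 -> bessel_family n g ->
  bessel_family n (fun i => c *: g i).
Proof.
move=> c1 hg x; apply: le_trans (hg x); apply: ler_sum => i _.
by rewrite dotpZr sqcM sqcJ -[leRHS]mul1r ler_wpM2r ?sqc_ge0.
Qed.

(** The scalar moves onto the second family, which remains Bessel because [sqc c <= 1]. *)
Lemma trace_bounded_lincomb (c : R[i]) a b V W : sqc c <= 1 -> trace_bounded a V ->
  trace_bounded b W -> trace_bounded (fun x => c *: a x + b x) (V + W).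
Proof.
move=> c1 ha hb n f g hf hg.
have hg' : bessel_family n (fun i => Num.conj c *: g i).
  by apply: bessel_family_scale => //; rewrite sqcJ.
apply: le_trans (lerD (ha n f _ hf hg') (hb n f g hf hg)).
rewrite -big_split /=; apply: ler_sum => i _.
by rewrite dotpDl dotpZl ReD dotpZr conjCK.
Qed.

Lemma trace_bounded_zero : trace_bounded (fun=> 0) 0.
Proof. by move=> n f g _ _; rewrite big1 // => i _; rewrite dotp0l. Qed.

(** With [w] the sum of the [dotp x (g i) *: g i], one has [Re (dotp x w) = s] and [nsq w <= s];
    expanding [nsq (x - w) >= 0] gives [s <= nsq x]. *)
Lemma suborthonormal_bessel n (g : nat -> H) (d : nat -> R) :
  (forall i j, dotp (g i) (g j) = (d i)%:C * (i == j)%:R) -> (forall i, d i <= 1) ->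
  bessel_family n g.
Proof.
move=> gd d1 x; pose w := \sum_(i < n) dotp x (g i) *: g i.
pose s := \sum_(i < n) sqc (dotp x (g i)).
have gw (i : 'I_n) : dotp (g i) w = (d i)%:C * Num.conj (dotp x (g i)).
  rewrite /w dotp_sumr (bigD1 i) //= dotpZr gd eqxx mulr1 mulrC.
  rewrite big1 ?addr0 // => j ji; rewrite dotpZr gd.
  by case: eqP => [e|_]; [move: ji; rewrite -(inj_eq val_inj) /= e eqxx|rewrite !mulr0].
have xw : complex.Re (dotp x w) = s.
  rewrite /w dotp_sumr Re_sum.
  by apply: eq_bigr => i _; rewrite dotpZr mulrC mulcJ.
have ww : nsq w <= s.
  rewrite /nsq {1}/w dotp_suml.
  rewrite Re_sum; apply: ler_sum => i _.
  rewrite dotpZl gw mulrCA mulcJ Re_realM /= -[leRHS]mul1r ler_wpM2r ?sqc_ge0 //.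
have := nsq_ge0 (x - w); rewrite nsqB xw -/s; lra.
Qed.

(** Testing the bound on the singular vectors [f i] and the normalized images [a (f i) / m i]
    returns exactly the sum of the [m i]. *)
Lemma trace_bounded_singular_values a (V : R) : infinite_dimensional H -> bounded_op a ->
  compact_op a -> trace_bounded a V ->
  exists m, [/\ (forall i j, (i <= j)%N -> m j <= m i), (forall n, 0 <= m n),
    mu_seq a = m & forall n, \sum_(i < n) m i <= V].
Proof.
move=> infH ba ca ta; have [f [m [fo dm m0 am aa]]] := compact_singular_values infH ba ca.
exists m; split => // n.
(* As [0^-1 = 0], this is the zero vector when [m i = 0]. *)
pose g i := (m i)^-1%:C *: a (f i).
have gg i j : dotp (g i) (g j) = ((m i != 0)%:R : R)%:C * (i == j)%:R.
  rewrite /g dotpZl dotpZr conj_real aa; case: eqP => [<-|_]; last by rewrite !mulr0.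
  rewrite !mulr1 -!rmorphM /=; congr (_%:C).
  by case: eqP => [->|/eqP mi]; [rewrite expr0n !mulr0|rewrite /=; field].
have := ta n f g (bessel (onseq_orthof fo)) (suborthonormal_bessel n gg _).
have -> : \sum_(i < n) complex.Re (dotp (a (f i)) (g i)) = \sum_(i < n) m i.
  apply: eq_bigr => i _; rewrite /g dotpZr conj_real aa eqxx mulr1 -rmorphM /=.
  by have [->|mi] := eqVneq (m i) 0; [rewrite expr0n mulr0|rewrite expr2 mulrA mulVf // mul1r].
by apply => i; case: (m i != 0).
Qed.

Lemma cvg_finite_sum n (u : nat -> nat -> R) (l : nat -> R) :
  (forall i, (fun k => u i k) @ \oo --> l i) ->
  (fun k => \sum_(i < n) u i k) @ \oo --> \sum_(i < n) l i.
Proof.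
move=> ul; elim: n => [|n IH].
  by rewrite big_ord0; apply: (@cvg_congr R (fun=> 0)); [move=> k; rewrite big_ord0|exact: cvg_cst].
rewrite big_ord_recr /=.
by apply: (@cvg_congr R (fun k => \sum_(i < n) u i k + u n k)) (cvgD IH (ul n)) => k; rewrite big_ord_recr.
Qed.

(** Expanding along [e] gives [nu j] times a sum over [i] of coefficients of [b (f i)] and of the
    adjoint of [c] at [g i]. Passing to adjoints turns these into coefficients of fixed vectors
    along the families, which Bessel bounds uniformly in [j]. *)
Lemma diagop_trace_bounded (nu : nat -> R) e (V : R) b c : onseq e -> (forall i, 0 <= nu i) ->
  (forall n, \sum_(i < n) nu i <= V) -> bounded_op b -> bounded_op c ->
  exists W, trace_bounded (c \o diagop nu e \o b) W.
Proof.
move=> eo nu0 nuV bb bc.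
have nuM i : `|nu i| <= V.
  rewrite ger0_norm //; apply: le_trans (nuV i.+1); rewrite big_ord_recr /= lerDr.
  by apply: sumr_ge0.
have [M [M0 hM]] := bop_bound (adjoint_bounded bb).
have [N [N0 hN]] := bop_bound bc.
have e1 j : nrm (e j) = 1 by rewrite /nrm /nsq eo eqxx /= sqrtr1.
have bd T (K : R) (h : nat -> H) n j : (forall x, nrm (T x) <= K * nrm x) -> 0 <= K ->
    bessel_family n h -> \sum_(i < n) sqc (dotp (T (e j)) (h i)) <= K ^+ 2.
  move=> hT K0 hh; apply: le_trans (hh _) _.
  have := hT (e j); rewrite e1 mulr1 -nrm_sqr => h1.
  by rewrite lerXn2r ?nnegrE ?nrm_ge0.
exists (V * ((M ^+ 2 + N ^+ 2) / 2)) => n f g hf hg.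
have lim i := diagop_Re_cvg eo nuM (x := b (f i)) (y := adjoint c (g i)).
have lim2 := cvg_finite_sum (n := n) lim.
have -> : \sum_(i < n) complex.Re (dotp ((c \o diagop nu e \o b) (f i)) (g i)) =
    \sum_(i < n) complex.Re (dotp (diagop nu e (b (f i))) (adjoint c (g i))).
  by apply: eq_bigr => i _; rewrite /= adjoint_is.
apply: (cvg_le_cst lim2) => k; rewrite exchange_big /=.
apply: (@le_trans _ _ (\sum_(j < k) nu j * ((M ^+ 2 + N ^+ 2) / 2))); last first.
  by rewrite -mulr_suml ler_wpM2r // divr_ge0 // addr_ge0 ?sqr_ge0.
apply: ler_sum => j _; rewrite -mulr_sumr ler_wpM2l //.
apply: (@le_trans _ _ (\sum_(i < n) (sqc (dotp (adjoint b (e j)) (f i)) + sqc (dotp (c (e j)) (g i))) / 2)).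
  apply: ler_sum => i _; apply: le_trans (Re_mul_conj_le _ _) _.
  rewrite (adjoint_is bb) dotp_adjoint // (dotpC (f i)) (dotpC (g i)) !sqcJ //.
rewrite -mulr_suml ler_wpM2r ?invr_ge0 // big_split /=.
by apply: lerD; [exact: bd hf|exact: bd hg].
Qed.

Definition trace_class T := [/\ bounded_op T, compact_op T & exists V, trace_bounded T V].

Lemma compact_zero : compact_op (fun=> 0 : H).
Proof.
split; first by move=> c x y; rewrite scaler0 addr0.
apply: (precompact_subset (B := [set 0])); first by move=> _ [x _ <-].
exact/compact_precompact/compact_set1/hilbert_hausdorff.
Qed.

Lemma trace_class_zero : trace_class (fun=> 0).
Proof.
by split; [exact: bounded_zero|exact: compact_zero|exists 0; exact: trace_bounded_zero].
Qed.

Lemma trace_class_lincomb (c : R[i]) a b : sqc c <= 1 -> trace_class a -> trace_class b ->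
  trace_class (fun x => c *: a x + b x).
Proof.
move=> c1 [ba ca [V hV]] [bb cb [W hW]]; split.
- exact: bounded_lincomb.
- exact: compact_lincomb.
- by exists (V + W); exact: trace_bounded_lincomb.
Qed.

Lemma trace_class_L1oo T : infinite_dimensional H -> trace_class T -> L1oo T.
Proof.
move=> infH [bT cT [V hV]].
have [m [dm m0 Tm mV]] := trace_bounded_singular_values infH bT cT hV.
exact: (summable_L1oo dm m0 Tm cT mV).
Qed.

Lemma trace_class_dixmier_weight Lim T : infinite_dimensional H -> generalized_limit Lim ->
  trace_class T -> dixmier_weight Lim T = 0%E.
Proof.
move=> infH gL [bT cT [V hV]].
have [m [dm m0 Tm mV]] := trace_bounded_singular_values infH bT cT hV.
exact: (summable_dixmier_weight dm m0 Tm gL cT mV).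
Qed.

(* Polarization writes 4 (a B) as a combination of four positive operators
   (conj(z) a + 1) B (z a^* + 1), z^4 = 1, on which the weight is 0. *)
Lemma dixmier_trace_summable Lim (nu : nat -> R) e (V : R) a : infinite_dimensional H ->
  generalized_limit Lim -> onseq e -> (forall i j, (i <= j)%N -> nu j <= nu i) ->
  (forall i, 0 <= nu i) -> nu @ \oo --> 0 ->
  (forall n, \sum_(i < n) nu i <= V) -> bounded_op a ->
  dixmier_trace Lim (a \o diagop nu e) = 0.
Proof.
move=> infH gL eo dnu nu0 nucv nuV ba.
(* If there is no linear extension, [xget] returns the zero functional and the claim is
   immediate. *)
rewrite /dixmier_trace; case: xgetP => [f _ [flin fpos]|//].
set B := diagop nu e.
have nuM := noninc_norm_le dnu nu0.
have bB : bounded_op B by exact: diagop_bounded nuM.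
have cB : compact_op B by exact: diagop_compact nuM dnu nu0 nucv.
have pB : positive_op B by exact: diagop_positive nuM nu0.
have ba' := adjoint_bounded ba.
pose b (z : R[i]) x := z *: adjoint a x + x.
have bb z : bounded_op (b z) by apply: bounded_lincomb => //; exact: bounded_id.
pose c (z : R[i]) x := Num.conj z *: a x + x.
have bc z : bounded_op (c z) by apply: bounded_lincomb => //; exact: bounded_id.
have cb z x y : dotp (c z x) y = dotp x (b z y).
  by rewrite dotpDl dotpZl dotpDr dotpZr (adjoint_is ba).
pose P z := c z \o B \o b z.
have tP z : trace_class (P z).
  split; first by apply: bounded_comp => //; exact: bounded_comp.
    by apply: compact_comp_right => //; exact: compact_comp_left.
  exact: diagop_trace_bounded eo nu0 nuV (bb z) (bc z).
have pP z : positive_op (P z).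
  split; first by have [] := tP z.
  by move=> x; rewrite /P /= cb; have [_] := pB; apply.
have fP z : f (P z) = 0.
  rewrite fpos //; last exact: trace_class_L1oo.
  by rewrite trace_class_dixmier_weight.
have f0 : f (fun=> 0) = 0.
  rewrite fpos; [|by split; [exact: bounded_zero|move=> x; rewrite dotp0l]|exact: trace_class_L1oo infH trace_class_zero].
  by rewrite trace_class_dixmier_weight //; exact: trace_class_zero.
(* Adds one polarization term at a time: linearity of [f] has the form [c a + b], and each partial
   sum must be in [L1oo]. The coefficients have modulus 1/4, within the range of
   [trace_class_lincomb]. *)
pose Q (z : R[i]) T := fun x => (4^-1 * z) *: P z x + T x.
have z1 (z : R[i]) : sqc z = 1 -> sqc (4^-1 * z) <= 1.
  move=> hz; rewrite sqcM hz mulr1 (_ : 4^-1 = (4^-1 : R)%:C); last by rewrite fmorphV rmorph_nat.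
  by rewrite sqc_real; lra.
have QP z T : sqc z = 1 -> trace_class T -> f T = 0 -> trace_class (Q z T) /\ f (Q z T) = 0.
  move=> hz tT fT; split; first exact: trace_class_lincomb (z1 _ hz) (tP z) tT.
  by rewrite /Q flin ?fP ?fT ?mulr0 ?addr0 //; exact: trace_class_L1oo.
have i1 : sqc ('i%C : R[i]) = 1 by rewrite /sqc /=; lra.
have one1 : sqc (1 : R[i]) = 1 by rewrite /sqc /=; lra.
have [t1 h1] := QP 1 _ one1 trace_class_zero f0.
have [t2 h2] := QP (-1) _ (etrans (sqcN 1) one1) t1 h1.
have [t3 h3] := QP 'i%C _ i1 t2 h2.
have [t4 h4] := QP (- 'i%C) _ (etrans (sqcN _) i1) t3 h3.
rewrite -h4; congr (f _); apply/funext => x.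
have lB := bop_lin bB; have la := bop_lin ba.
have ii : ('i%C : R[i]) * 'i%C = -1 by exact: sqr_i.
have ci : Num.conj ('i%C : R[i]) = - 'i%C.
  by apply/eqP; rewrite eq_complex /= oppr0 !eqxx.
have cni : Num.conj (- 'i%C : R[i]) = 'i%C by rewrite rmorphN /= ci opprK.
have c1 : Num.conj (1 : R[i]) = 1 by rewrite rmorph1.
have cn1 : Num.conj (-1 : R[i]) = -1 by rewrite rmorphN /= c1.
rewrite /Q /P /= /c /b ci cni c1 cn1 !(linD lB, linZ lB, linD la, linZ la).
apply: dotp_inj => w; rewrite !(dotpDl, dotpZl, dotp0l, dotpNl).
move: (dotp (a (B x)) w) (dotp (a (B (adjoint a x))) w) (dotp (B (adjoint a x)) w) (dotp (B x) w) => p q r s.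
move: ('i%C : R[i]) ii => i ii.
rewrite [RHS](_ : _ = p * (2 - 2 * (i * i)) / 4 + r * (2 + 2 * (i * i)) / 4); last by field.
by rewrite ii; field.
Qed.

End trace_class.

(** * Ky Fan sums *)

Section ky_fan.
Context {R : realType} {H : hilbertType R}.
Implicit Types (x y : H) (a b P : H -> H) (f g h : nat -> H).

Definition family_trace a n f : R := \sum_(i < n) complex.Re (dotp (a (f i)) (f i)).

(* For a compact positive a this is the sum of its n largest eigenvalues (Ky
   Fan), but the supremum makes sense for every bounded positive a. *)
Definition ky_fan a n : R := sup [set family_trace a n f | f in orthof n].

Hypothesis infH : infinite_dimensional H.

Lemma exists_orthof n : exists f : nat -> H, orthof n f.
Proof. by have [f [fo _]] := gram_schmidt n (fun=> 0) infH; exists f. Qed.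

Lemma ky_fan_has_sup a n : bounded_op a -> has_sup [set family_trace a n f | f in orthof n].
Proof.
move=> ba; have [M [M0 hM]] := bop_bound ba; split.
  by have [f fo] := exists_orthof n; exists (family_trace a n f), f.
exists (\sum_(i < n) M) => _ [f fo <-]; apply: ler_sum => i _.
apply: le_trans (ler_norm _) _; apply: le_trans (Re_dotp_le _ _) _.
have f1 : nrm (f i) = 1 by rewrite /nrm /nsq fo // eqxx /= sqrtr1.
by have := hM (f i); rewrite f1 !mulr1.
Qed.

Lemma ky_fan_ub a n f : bounded_op a -> orthof n f -> family_trace a n f <= ky_fan a n.
Proof. by move=> ba fo; apply: ub_le_sup; [case: (ky_fan_has_sup n ba)|exists f]. Qed.

Lemma ky_fan_le a n (M : R) : (forall f, orthof n f -> family_trace a n f <= M) -> ky_fan a n <= M.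
Proof.
move=> h; apply: ge_sup; last by move=> _ [f fo <-]; exact: h.
by have [f fo] := exists_orthof n; exists (family_trace a n f), f.
Qed.

Lemma ky_fan0 a : ky_fan a 0 = 0.
Proof.
rewrite /ky_fan (_ : [set _ | _ in _] = [set 0]) ?sup1 //.
apply/seteqP; split => [_ [f fo <-]|_ ->]; first by rewrite /family_trace big_ord0.
by exists (fun=> 0); [move=> i j; rewrite ltn0|rewrite /family_trace big_ord0].
Qed.

Lemma ky_fan_mono a n : positive_op a -> ky_fan a n <= ky_fan a n.+1.
Proof.
move=> pa; apply: ky_fan_le => f fo.
have [y [y1 yf]] := exists_orthogonal infH fo.
apply: le_trans (ky_fan_ub pa.1 (orthof_snoc fo y1 yf)).
rewrite /family_trace (sum_snoc _ _ _ (fun _ x => complex.Re (dotp (a x) x))).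
by rewrite lerDl positive_ge0.
Qed.

Lemma ky_fanD_le a b n : bounded_op a -> bounded_op b ->
  ky_fan (fun x => a x + b x) n <= ky_fan a n + ky_fan b n.
Proof.
move=> ba bb; apply: ky_fan_le => f fo.
apply: le_trans (lerD (ky_fan_ub ba fo) (ky_fan_ub bb fo)).
rewrite /family_trace -big_split /=; apply: ler_sum => i _.
by rewrite dotpDl ReD.
Qed.

Lemma ky_fanZ a n (c : R) : 0 <= c -> positive_op a ->
  ky_fan (fun x => c%:C *: a x) n = c * ky_fan a n.
Proof.
move=> c0 pa.
have E d f (u : H -> H) : family_trace (fun x => d%:C *: u x) n f = d * family_trace u n f.
  by rewrite /family_trace mulr_sumr; apply: eq_bigr => i _; rewrite dotpZl Re_realM.
have bca : bounded_op (fun x => c%:C *: a x) by apply: bounded_scale; have [] := pa.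
apply/le_anti/andP; split.
  by apply: ky_fan_le => f fo; rewrite E ler_wpM2l // ky_fan_ub //; have [] := pa.
have [->|cn0] := eqVneq c 0.
  rewrite mul0r; have [f fo] := exists_orthof n.
  have b0 : bounded_op (fun x => (0 : R)%:C *: a x) by apply: bounded_scale; have [] := pa.
  by apply: le_trans (ky_fan_ub b0 fo); rewrite E mul0r.
have c1 : 0 < c by rewrite lt0r cn0.
rewrite -ler_pdivlMl //; apply: ky_fan_le => f fo.
by rewrite ler_pdivlMl // -E ky_fan_ub.
Qed.

(** A finite rank trace computed along [h] and along [f]. The choices [L = id] and [L = oproj n f]
    give the cross terms and the square term of [family_trace_le]. *)
Lemma trace_oproj a (L : H -> H) n k f h : linear a -> linear L ->
  (forall i, (i < n)%N -> f i = oproj k h (f i)) ->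
  \sum_(j < k) dotp (a (oproj n f (h j))) (L (h j)) = \sum_(i < n) dotp (a (f i)) (L (f i)).
Proof.
move=> la lL fh.
transitivity (\sum_(j < k) \sum_(i < n) dotp (h j) (f i) * dotp (a (f i)) (L (h j))).
  apply: eq_bigr => j _; rewrite /oproj (lin_sum la).
  rewrite dotp_suml.
  by apply: eq_bigr => i _; rewrite (linZ la) dotpZl.
rewrite exchange_big /=; apply: eq_bigr => i _.
rewrite [in RHS](fh i (ltn_ord i)) /oproj (lin_sum lL).
rewrite -/(oproj k h (f i)) -fh // dotp_sumr.
by apply: eq_bigr => j _; rewrite (linZ lL) dotpZr -dotpC.
Qed.

(** Sum the form of [a] over the vectors [h j - oproj n f (h j)]: each of the two cross terms equals
    minus the trace along [f], the square term restores it once, and the total is nonnegative. *)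
Lemma family_trace_le a n k f h : positive_op a -> orthof n f ->
  (forall i, (i < n)%N -> f i = oproj k h (f i)) ->
  family_trace a n f <= family_trace a k h.
Proof.
move=> pa fo fh; have la := bop_lin pa.1.
have lp := oproj_lin n f.
have idl : linear (id : H -> H) by [].
have e1 := congr1 (@complex.Re R) (trace_oproj la idl fh).
have e2 := congr1 (@complex.Re R) (trace_oproj la lp fh).
rewrite !Re_sum in e1 e2.
have e3 : \sum_(i < n) complex.Re (dotp (a (f i)) (oproj n f (f i))) = family_trace a n f.
  apply: eq_bigr => i _; congr (complex.Re (dotp _ _)).
  rewrite /oproj (bigD1 i) //= fo // eqxx scale1r big1 ?addr0 // => j ji.
  rewrite fo //; case: eqP => [e|_]; last by rewrite scale0r.
  by move: ji; rewrite -(inj_eq val_inj) /= e eqxx.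
have : 0 <= \sum_(j < k) complex.Re (dotp (a (h j - oproj n f (h j))) (h j - oproj n f (h j))).
  by apply: sumr_ge0 => j _; exact: positive_ge0.
have -> : \sum_(j < k) complex.Re (dotp (a (h j - oproj n f (h j))) (h j - oproj n f (h j))) =
    family_trace a k h - family_trace a n f *+ 2 + family_trace a n f.
  have e1' : \sum_(i < k) complex.Re (dotp (a (oproj n f (h i))) (h i)) = family_trace a n f by [].
  rewrite -[X in _ - X *+ 2 + _]e1' -[X in _ + X]e3 -[X in _ + X]e2 mulr2n /family_trace.
  rewrite -!big_split /= -sumrN -!big_split /=.
  apply: eq_bigr => j _; rewrite (linB la) dotpBl !dotpBr !ReB.
  have -> : complex.Re (dotp (a (h j)) (oproj n f (h j))) =
      complex.Re (dotp (a (oproj n f (h j))) (h j)).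
    by rewrite (positive_symmetric pa) dotpC Re_conjC.
  by ring.
by rewrite mulr2n opprD addrA subrK subr_ge0.
Qed.

(** Near-optimal families for [a] and for [b] together have [n + n] vectors, so one orthonormal
    family of that length spans both. *)
Lemma ky_fanD_ge a b n : positive_op a -> positive_op b ->
  ky_fan a n + ky_fan b n <= ky_fan (fun x => a x + b x) (n + n).
Proof.
move=> pa pb.
have bab := bounded_add pa.1 pb.1.
have key f g : orthof n f -> orthof n g ->
    family_trace a n f + family_trace b n g <= ky_fan (fun x => a x + b x) (n + n).
  move=> fo go; pose v i := if (i < n)%N then f i else g (i - n)%N.
  have [h [ho hv]] := gram_schmidt (n + n) v infH.
  apply: le_trans (ky_fan_ub bab ho).
  have -> : family_trace (fun x => a x + b x) (n + n) h =
      family_trace a (n + n) h + family_trace b (n + n) h.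
    by rewrite -big_split /=; apply: eq_bigr => i _; rewrite dotpDl ReD.
  apply: lerD; apply: family_trace_le => // i i_n.
    by have := hv i (ltn_addr n i_n); rewrite /v i_n.
  have i_nn : (n + i < n + n)%N by rewrite ltn_add2l.
  by have := hv _ i_nn; rewrite /v ltnNge leq_addr /= addKn.
rewrite -lerBrDr; apply: ky_fan_le => f fo; rewrite lerBrDr addrC -lerBrDr.
by apply: ky_fan_le => g go; rewrite lerBrDr addrC; exact: key.
Qed.

(** With [g] orthonormal and spanning the [a (f i)], the squared norms of these vectors expand into
    squared coefficients of the [b (g j)] along [f]; exchanging the sums and Bessel finish. *)
Lemma ky_fan_comp_le a b n : bounded_op a -> is_adjoint a b ->
  ky_fan (b \o a) n <= ky_fan (a \o b) n.
Proof.
move=> ba ab; have bb := is_adjoint_bounded ba ab.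
apply: ky_fan_le => f fo.
have [g [go gv]] := gram_schmidt n (fun i => a (f i)) infH.
apply: le_trans (ky_fan_ub (bounded_comp ba bb) go).
have -> : family_trace (b \o a) n f =
    \sum_(i < n) \sum_(j < n) sqc (dotp (b (g j)) (f i)).
  apply: eq_bigr => i _; rewrite /= (is_adjoint_sym ab).
  have := oproj_nsq (a (f i)) go; rewrite -gv // subrr nsq0 => /esym/eqP.
  rewrite subr_eq0 => /eqP; rewrite /nsq => ->.
  by apply: eq_bigr => j _; rewrite ab dotpC sqcJ.
rewrite exchange_big /=; apply: ler_sum => j _; rewrite /= ab.
exact: bessel.
Qed.

Lemma ky_fan_tracial a n : bounded_op a ->
  ky_fan (adjoint a \o a) n = ky_fan (a \o adjoint a) n.
Proof.
move=> ba; have ab := adjoint_is ba; apply/le_anti/andP; split.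
  exact: ky_fan_comp_le.
by apply: ky_fan_comp_le; [exact: adjoint_bounded|exact: is_adjoint_sym].
Qed.

Lemma projection_positive P : finite_rank_projection P -> positive_op P.
Proof.
move=> [bP PP sP _]; split => // x.
have PPx : P (P x) = P x by exact: (congr1 (@^~ x) PP).
by rewrite -PPx sP dotpxx ler0c nsq_ge0.
Qed.

(** The range lies in the span of [r] orthonormal vectors, and Bessel shows that no family beats
    them. This eventual constancy is how vanishing on finite rank projections enters the sequence
    model. *)
Lemma ky_fan_projection P : finite_rank_projection P ->
  exists r, forall n, (r <= n)%N -> ky_fan P n = ky_fan P r.
Proof.
move=> fP; have pP := projection_positive fP; have [bP PP sP [r [e eP]]] := fP.
have PPx x : P (P x) = P x by exact: (congr1 (@^~ x) PP).
pose v i := if insub i is Some j then e j else 0 : H.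
have [h [ho hv]] := gram_schmidt r v infH.
have Ph x : P x = oproj r h (P x).
  have [c ->] := eP x; rewrite -/(oproj r h _) (big_morph _ (linD (@oproj_lin _ _ r h)) (lin0 (@oproj_lin _ _ r h))).
  apply: eq_bigr => i _; rewrite (linZ (@oproj_lin _ _ r h)); congr (_ *: _).
  by have := hv i (ltn_ord i); rewrite /v valK.
have bound n : ky_fan P n <= ky_fan P r.
  apply: ky_fan_le => f fo; apply: le_trans (ky_fan_ub bP ho).
  have PN x : complex.Re (dotp (P x) x) = nsq (P x) by rewrite /nsq -sP PPx.
  have -> : family_trace P n f = \sum_(i < n) \sum_(j < r) sqc (dotp (P (h j)) (f i)).
    apply: eq_bigr => i _; rewrite PN.
    have := oproj_nsq (P (f i)) ho; rewrite -Ph subrr nsq0 => /esym/eqP.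
    rewrite subr_eq0 => /eqP ->; apply: eq_bigr => j _.
    by rewrite sP dotpC sqcJ.
  rewrite exchange_big /=; apply: ler_sum => j _; rewrite PN; exact: bessel.
exists r => n rn; apply/le_anti; rewrite bound /=.
exact: (homo_leq (@lexx _ R) (@le_trans _ _) (fun n => ky_fan_mono n pP)).
Qed.

Lemma sum_head_le (c d : nat -> R) k n : (forall i, 0 <= d i) ->
  (forall i, (i < n)%N -> c i <= d i) -> (forall i, (n <= i)%N -> c i <= 0) ->
  \sum_(i < k) c i <= \sum_(i < n) d i.
Proof.
move=> d0 cd c0; have [kn|nk] := leqP k n.
  rewrite -(subnKC kn) big_split_ord /= -[leLHS]addr0; apply: lerD; last exact: sumr_ge0.
  by apply: ler_sum => i _; apply: cd; apply: leq_trans (ltn_ord i) kn.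
rewrite -(subnKC (ltnW nk)) big_split_ord /= -[leRHS]addr0; apply: lerD.
  by apply: ler_sum => i _; exact: cd.
by rewrite -oppr_ge0 -sumrN; apply: sumr_ge0 => i _; rewrite oppr_ge0 c0 // leq_addr.
Qed.

(** Bathtub principle: a family of [n] vectors puts weights [w j] in [0, 1] of total at most [n] on
    the eigenvalues. Subtracting [nu n] makes the terms beyond [n] nonpositive, so the first [n]
    eigenvalues with full weight are optimal. *)
Lemma ky_fan_diagop (nu : nat -> R) e n : onseq e ->
  (forall i j, (i <= j)%N -> nu j <= nu i) -> (forall i, 0 <= nu i) ->
  ky_fan (diagop nu e) n = \sum_(i < n) nu i.
Proof.
move=> eo dnu nu0; have nuM := noninc_norm_le dnu nu0.
have bB := diagop_bounded eo nuM.
apply/le_anti/andP; split; last first.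
  apply: le_trans (ky_fan_ub bB (onseq_orthof (n := n) eo)).
  apply: ler_sum => i _; rewrite (diagop_eigen eo nuM) dotpZl eo eqxx mulr1 //.
apply: ky_fan_le => f fo.
have lim i := diagop_Re_cvg eo nuM (x := f i) (y := f i).
apply: (cvg_le_cst (cvg_finite_sum (n := n) lim)) => k.
rewrite exchange_big /=.
pose w j := \sum_(i < n) sqc (dotp (f i) (e j)).
have w0 j : 0 <= w j by apply: sumr_ge0 => i _; exact: sqc_ge0.
have w1 j : w j <= 1.
  have <- : nsq (e j) = 1 by rewrite /nsq eo eqxx.
  apply: le_trans (bessel fo _); apply: ler_sum => i _; by rewrite dotpC sqcJ.
have wn : \sum_(j < k) w j <= n%:R.
  rewrite exchange_big /= -[n in leRHS]card_ord -sumr_const; apply: ler_sum => i _.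
  have <- : nsq (f i) = 1 by rewrite /nsq fo // eqxx.
  exact: (bessel (onseq_orthof eo)).
have -> : \sum_(j < k) \sum_(i < n) nu j * complex.Re (dotp (f i) (e j) * Num.conj (dotp (f i) (e j))) =
    \sum_(j < k) nu j * w j.
  by apply: eq_bigr => j _; rewrite mulr_sumr; apply: eq_bigr => i _; rewrite mulcJ.
have h : \sum_(j < k) (nu j - nu n) * w j <= \sum_(j < n) (if (j < n)%N then nu j - nu n else 0).
  apply: (@sum_head_le (fun j => (nu j - nu n) * w j) (fun j => if (j < n)%N then nu j - nu n else 0)).
  - by move=> j; case: ltnP => // /ltnW jn; rewrite subr_ge0 dnu.
  - move=> j jn; rewrite jn -[leRHS]mulr1 ler_wpM2l // subr_ge0 dnu //; exact: ltnW.
  - by move=> j nj; rewrite mulr_le0_ge0 // subr_le0 dnu.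
move: h; under [X in _ <= X -> _]eq_bigr do rewrite ltn_ord.
have -> : \sum_(j < k) (nu j - nu n) * w j = \sum_(j < k) nu j * w j - nu n * \sum_(j < k) w j.
  by rewrite mulr_sumr -sumrB; apply: eq_bigr => j _; rewrite mulrBl.
rewrite sumrB sumr_const card_ord -mulr_natr.
have := ler_wpM2l (nu0 n) wn; lra.
Qed.

End ky_fan.

(** * Singular functionals on sequences of partial sums *)

Section ultralimit_functional.
Context {R : realType}.
Implicit Types (s t u : nat -> R).

(* A gauge stands for the sequence [ky_fan a] of a positive operator a, and
   [additive_at] is what remains for these sequences of the additivity of
   traces. *)
Definition gauge s := s 0%N = 0 /\ forall n, s n <= s n.+1.

Lemma gauge_le s i j : gauge s -> (i <= j)%N -> s i <= s j.
Proof. by move=> [_ h]; exact: (homo_leq (@lexx _ R) (@le_trans _ R)). Qed.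

Lemma gauge_ge0 s n : gauge s -> 0 <= s n.
Proof. by move=> gs; have [s0 _] := gs; rewrite -s0; apply: gauge_le. Qed.

Definition additive_at s t u :=
  (forall n, u n <= s n + t n) /\ (forall n, s n + t n <= u (n + n)%N).

Definition eventually_constant s := exists r, forall n, (r <= n)%N -> s n = s r.

Record singular_functional (T : nat -> R) (Phi : (nat -> R) -> \bar R) : Prop :=
  SingularFunctional {
  sfun_ge0 : forall s, gauge s -> (0 <= Phi s)%E ;
  sfunZ : forall (c : R) s, 0 <= c -> gauge s -> Phi (fun n => c * s n) = (c%:E * Phi s)%E ;
  sfunD : forall s t u, gauge s -> gauge t -> gauge u -> additive_at s t u ->
    Phi u = (Phi s + Phi t)%E ;
  sfun_const : forall s, gauge s -> eventually_constant s -> Phi s = 0%E ;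
  sfun1 : Phi T = 1%E }.

(* J is the domain of finiteness of Phi; on it, Phi s is an ultralimit of v s. *)
Lemma ultralimit_functional (T : nat -> R) (J : (nat -> R) -> Prop) (v : (nat -> R) -> nat -> R) :
  (forall s, gauge s -> J s -> exists (C : R) (N : nat), forall k, (N <= k)%N -> 0 <= v s k <= C) ->
  (forall (c : R) s, 0 < c -> J s -> J (fun n => c * s n)) ->
  (forall (c : R) s, 0 < c -> gauge s -> J s -> v (fun n => c * s n) = (fun k => c * v s k)) ->
  (forall s t u, gauge s -> gauge t -> gauge u -> additive_at s t u -> J u <-> J s /\ J t) ->
  (forall s t u, gauge s -> gauge t -> gauge u -> additive_at s t u -> J u ->
     (fun k => v s k + v t k - v u k) @ \oo --> (0 : R)) ->
  (forall s, gauge s -> eventually_constant s -> J s /\ v s @ \oo --> (0 : R)) ->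
  gauge T -> J T -> v T @ \oo --> (1 : R) ->
  exists Phi, singular_functional T Phi.
Proof.
move=> vbd JZ vZ JD vD const gT JT vT.
have [U [UU ooU]] := ultraFilterLemma (F := \oo) _.
have PU : ProperFilter U by exact: ultra_proper.
have cvU (w : nat -> R) (l : R) : w @ \oo --> l -> w @ U --> l.
  by move=> wl A lA; apply: ooU; exact: wl.
pose L s := get [set l : R | v s @ U --> l].
have Lcv s : gauge s -> J s -> v s @ U --> L s.
  move=> gs Js; apply: (getPex (P := [set l : R | v s @ U --> l])).
  have [C [N hC]] := vbd s gs Js.
  apply: (ultra_bounded_cvg (M := C)); apply: ooU; exists N => // k /= Nk.
  by have /andP[h1 h2] := hC k Nk; rewrite ger0_norm.
have Luniq s l : gauge s -> J s -> v s @ U --> l -> L s = l.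
  by move=> gs Js; exact: (cvg_unique (@Rhausdorff R) (Lcv s gs Js)).
pose Phi s := if `[< J s >] then (L s)%:E else +oo%E.
have PhiJ s : J s -> Phi s = (L s)%:E by move=> Js; rewrite /Phi asboolT.
have PhiN s : ~ J s -> Phi s = +oo%E by move=> Js; rewrite /Phi asboolF.
have L0 s : gauge s -> J s -> 0 <= L s.
  move=> gs Js; have [C [N hC]] := vbd s gs Js.
  apply: (cvgr_to_ge (Lcv s gs Js)).
  by apply: ooU; exists N => // k /= Nk; have /andP[] := hC k Nk.
have Phi0 s : gauge s -> (0 <= Phi s)%E.
  move=> gs; have [Js|nJs] := pselect (J s); last by rewrite PhiN // leey.
  by rewrite PhiJ // lee_fin L0.
have Phic s : gauge s -> eventually_constant s -> Phi s = 0%E.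
  move=> gs cs; have [Js vs] := const s gs cs.
  by rewrite PhiJ // (Luniq s 0 gs Js) //; exact: cvU.
have gZ (c : R) s : 0 <= c -> gauge s -> gauge (fun n => c * s n).
  by move=> c0 [s0 hs]; split; [rewrite s0 mulr0|move=> n; rewrite ler_wpM2l].
exists Phi; split => //.
- move=> c s c0 gs; have [->|cn0] := eqVneq c 0.
    rewrite mul0e; under eq_fun do rewrite mul0r.
    by apply: Phic; [split|exists 0%N].
  have c1 : 0 < c by rewrite lt0r cn0.
  have [Js|nJs] := pselect (J s).
    have Jcs := JZ c s c1 Js; rewrite !PhiJ // (Luniq _ (c * L s)) //; first exact: gZ.
    rewrite vZ //; apply: cvgM; [exact: cvg_cst|exact: Lcv].
  rewrite !PhiN //; first by rewrite gt0_muley.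
  move=> /(JZ c^-1 _ _); rewrite invr_gt0 => /(_ c1).
  under eq_fun do rewrite mulrA mulVf // mul1r.
  by [].
- move=> s t u gs gt gu ad; have [Ju|nJu] := pselect (J u).
    have [Js Jt] := (JD s t u gs gt gu ad).1 Ju.
    rewrite !PhiJ // -EFinD; congr (_%:E); apply: Luniq => //.
    have -> : v u = (fun k => v s k + v t k - (v s k + v t k - v u k)).
      by apply/funext => k; ring.
    rewrite -[X in _ --> X]subr0; apply: cvgB; first by apply: cvgD; exact: Lcv.
    exact/cvU/vD.
  rewrite (PhiN u) //; have [Js|nJs] := pselect (J s); last first.
    by rewrite (PhiN s) // addye //; have := Phi0 t gt; case: (Phi t).
  have [Jt|nJt] := pselect (J t); last by rewrite (PhiN t) // (PhiJ s).
  by case: nJu; apply/(JD s t u gs gt gu ad).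
- by rewrite PhiJ // (Luniq T 1) //; exact: cvU.
Qed.

End ultralimit_functional.

Section divergent_case.
Context {R : realType}.

Definition psum (nu : nat -> R) n := \sum_(i < n) nu i.

Variables (nu : nat -> R).
Hypotheses (dnu : forall i j, (i <= j)%N -> nu j <= nu i) (nu0 : forall i, 0 < nu i).
Local Notation T := (psum nu).

Lemma psum_gauge : gauge T.
Proof.
split; first by rewrite /psum big_ord0.
by move=> n; rewrite /psum big_ord_recr /= lerDl ltW.
Qed.

Lemma psum_gt0 n : (0 < n)%N -> 0 < T n.
Proof.
move=> n0; apply: lt_le_trans (gauge_le psum_gauge n0).
by rewrite /psum big_ord_recr big_ord0 /= add0r.
Qed.

Lemma psum_double n : T (n + n)%N <= 2 * T n.
Proof.
rewrite /psum big_split_ord /= mulr2n mulrDl mul1r lerD2l; apply: ler_sum => i _.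
by rewrite dnu // leq_addl.
Qed.

Hypotheses (unb : forall M : R, exists n, M < T n)
  (slow : forall (k : nat) (e : R), 0 < e -> exists n,
     (k <= n)%N /\ T (2 ^ k * n)%N <= (1 + e) * T n).

(* With v s k the mean of s over k.+1 dyadic scales, divided by T, the defect of
   additivity of v telescopes to O(1/k), while slow growth makes v T tend to 1. *)
Lemma divergent_functional : exists Phi, singular_functional T Phi.
Proof.
have gT := psum_gauge.
(* The base [nk k] starts [k.+1] dyadic scales of almost no growth. That it is at least [k.+1] makes
   [T (nk k)] unbounded, so the means of an eventually constant gauge tend to 0. *)
have /choice[nk nkP] : forall k : nat, exists n, (k.+1 <= n)%N /\
    T (2 ^ k.+1 * n)%N <= (1 + k.+1%:R^-1) * T n.
  by move=> k; apply: slow; rewrite invr_gt0 ltr0Sn.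
pose v s k := k.+1%:R^-1 * (\sum_(j < k.+1) s (2 ^ j * nk k)%N) / T (nk k).
have nk0 k : (0 < nk k)%N by have [h _] := nkP k; exact: leq_trans h.
have Tn0 k : 0 < T (nk k) by exact: psum_gt0.
have K0 (k : nat) : 0 < (k.+1%:R : R) by rewrite ltr0Sn.
have K1 (k : nat) : (k.+1%:R^-1 : R) <= 1 by rewrite invf_le1 // ler1n.
have TB k : T (2 ^ k.+1 * nk k)%N <= 2 * T (nk k).
  have [_ h] := nkP k; apply: le_trans h _; rewrite ler_wpM2r ?(ltW (Tn0 k)) //.
  by rewrite (_ : 2 = 1 + 1) // lerD2l.
have v_le s k C : (forall j, (j < k.+1)%N -> s (2 ^ j * nk k)%N <= C * T (nk k)) -> v s k <= C.
  move=> sC; rewrite /v ler_pdivrMr // ler_pdivrMl // mulr_natl -[k.+1 in leRHS]card_ord -sumr_const.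
  by apply: ler_sum => j _; exact: sC.
have inv_cvg (C : R) : (fun k : nat => C * k.+1%:R^-1) @ \oo --> 0.
  by rewrite -[X in _ --> X](mulr0 C); apply: cvgM; [exact: cvg_cst|exact: cvg_harmonic].
(* Concavity of [T], in the form [psum_double], makes this domain insensitive to the doubling in
   [additive_at]. *)
pose J s := exists C : R, 0 <= C /\ forall n, s n <= C * T n.
have smallT j k : (j <= k.+1)%N -> T (2 ^ j * nk k)%N <= 2 * T (nk k).
  move=> jk; apply: le_trans (TB k); apply: gauge_le => //.
  by rewrite leq_mul2r leq_exp2l // jk orbT.
have v_ge0 s k : gauge s -> 0 <= v s k.
  move=> gs; rewrite /v divr_ge0 ?(ltW (Tn0 k)) // mulr_ge0 ?invr_ge0 //.
  by apply: sumr_ge0 => j _; exact: gauge_ge0.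
apply: (@ultralimit_functional _ T J v) => //.
- move=> s gs [C [C0 hC]]; exists (2 * C), 0%N => k _; rewrite v_ge0 //=.
  apply: v_le => j jk; apply: le_trans (hC _) _.
  by rewrite mulrAC mulrC; apply: ler_wpM2r => //; apply: smallT; exact: ltnW.
- move=> c s c0 [C [C0 hC]]; exists (c * C); split; first by rewrite mulr_ge0 // ltW.
  by move=> n; rewrite -mulrA ler_wpM2l // ltW.
- by move=> c s c0 gs _; apply/funext => k; rewrite /v -mulr_sumr; ring.
- move=> s t u gs gt gu [ust stu]; split.
    move=> [C [C0 hC]]; suff h x y : gauge y -> (forall n, x n + y n <= u (n + n)%N) -> J x.
      by split; [exact: (h s t)|apply: (h t s) => // n; rewrite addrC].
    move=> gy xyu; exists (C * 2); split; first by rewrite mulr_ge0.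
    move=> n; apply: le_trans (_ : u (n + n)%N <= _).
      by apply: le_trans (xyu n); rewrite lerDl gauge_ge0.
    by apply: le_trans (hC _) _; rewrite -mulrA ler_wpM2l // psum_double.
  move=> [[C [C0 hC]] [C' [C'0 hC']]]; exists (C + C'); split; first by rewrite addr_ge0.
  by move=> n; apply: le_trans (ust n) _; rewrite mulrDl lerD.
- move=> s t u gs gt gu [ust stu] [C [C0 hC]].
  (* Since [s x + t x <= u (x + x)], the sum of the defects telescopes to at most [u] at the last
     scale, which is at most [2 * C * T (nk k)]. *)
  have bnd k : 0 <= v s k + v t k - v u k <= (2 * C) * k.+1%:R^-1.
    have -> : v s k + v t k - v u k = k.+1%:R^-1 *
       (\sum_(j < k.+1) (s (2 ^ j * nk k)%N + t (2 ^ j * nk k)%N - u (2 ^ j * nk k)%N)) / T (nk k).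
      by rewrite sumrB big_split /= /v; ring.
    apply/andP; split.
      rewrite divr_ge0 ?(ltW (Tn0 k)) // mulr_ge0 ?invr_ge0 //.
      by apply: sumr_ge0 => j _; rewrite subr_ge0.
    rewrite ler_pdivrMr //.
    have -> : 2 * C * k.+1%:R^-1 * T (nk k) = k.+1%:R^-1 * (C * (2 * T (nk k))) by ring.
    rewrite ler_wpM2l ?invr_ge0 //.
    apply: (@le_trans _ _ (\sum_(j < k.+1) (u (2 ^ j.+1 * nk k)%N - u (2 ^ j * nk k)%N))).
      apply: ler_sum => j _; rewrite lerD2r; apply: le_trans (stu _) _.
      by rewrite addnn -mul2n mulnA -expnS.
    rewrite -(big_mkord xpredT (fun j => u (2 ^ j.+1 * nk k)%N - u (2 ^ j * nk k)%N)).
    rewrite (telescope_sumr (fun j => u (2 ^ j * nk k)%N)) //.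
    apply: (@le_trans _ _ (u (2 ^ k.+1 * nk k)%N)).
      by rewrite gerBl gauge_ge0.
    by apply: le_trans (hC _) _; rewrite ler_wpM2l.
  apply: (squeeze_cvgr (f := fun=> 0) (h := fun k : nat => (2 * C) * k.+1%:R^-1)).
  + by apply: nearW.
  + exact: cvg_cst.
  + exact: inv_cvg.
- move=> s gs [r hr].
  have sr n : s n <= s r.
    have [nr|rn] := leqP n r; first exact: gauge_le.
    by rewrite (hr n) // ltnW.
  have s0 := gauge_ge0 r gs.
  have T1 : 0 < T 1%N by exact: psum_gt0.
  split.
    exists (s r / T 1%N); split; first by rewrite divr_ge0 // ltW.
    move=> [|n]; first by have [-> _] := gs; rewrite /psum big_ord0 mulr0.
    apply: le_trans (sr _) _; rewrite -mulrA ler_peMr // mulrC ler_pdivlMr // mul1r.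
    exact: gauge_le.
  apply/cvgrPdist_le => e e0; have [N hN] := unb (s r / e).
  exists N => // k /= Nk; rewrite sub0r normrN ger0_norm ?v_ge0 //.
  apply: v_le => j _; apply: le_trans (sr _) _.
  rewrite mulrC -ler_pdivrMr //; apply: ltW; apply: lt_le_trans hN _.
  by apply: gauge_le => //; have [h _] := nkP k; apply: leq_trans h; apply: leqW.
- by exists 1; split => // n; rewrite mul1r.
- apply: (squeeze_cvgr (f := fun=> 1) (h := fun k : nat => 1 + 1 * k.+1%:R^-1)).
  + apply: nearW => k; apply/andP; split.
      rewrite /v ler_pdivlMr // mul1r ler_pdivlMl // mulr_natl -[k.+1 in leLHS]card_ord -sumr_const.
      by apply: ler_sum => j _; apply: gauge_le => //; rewrite leq_pmull // expn_gt0.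
    apply: v_le => j jk; rewrite mul1r.
    have [_ h] := nkP k; apply: le_trans h; apply: gauge_le => //.
    by rewrite leq_mul2r leq_exp2l // ltnW ?orbT.
  + exact: cvg_cst.
  + by rewrite -[X in _ --> X]addr0; apply: cvgD; [exact: cvg_cst|exact: inv_cvg].
Qed.

End divergent_case.

Section convergent_case.
Context {R : realType}.
Implicit Types (s t u : nat -> R).

Definition bounded_gauge s := exists M : R, forall n, s n <= M.

(** For bounded [s = psum nu] these are the tail sums of the series. *)
Definition remainder s n : R := sup (range s) - s n.

Lemma bounded_gauge_has_sup s : bounded_gauge s -> has_sup (range s).
Proof. by move=> [M sM]; split; [exists (s 0%N), 0%N|exists M => _ [n _ <-]]. Qed.

Lemma remainder_ge0 s n : bounded_gauge s -> 0 <= remainder s n.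
Proof.
by move=> /bounded_gauge_has_sup[_ bs]; rewrite subr_ge0; apply: ub_le_sup => //; exists n.
Qed.

Lemma remainder_le s i j : gauge s -> (i <= j)%N -> remainder s j <= remainder s i.
Proof. by move=> gs ij; rewrite lerD2l lerN2; exact: gauge_le. Qed.

Lemma sup_unique s (M : R) : (forall n, s n <= M) ->
  (forall e : R, 0 < e -> exists n, M - e <= s n) -> sup (range s) = M.
Proof.
move=> sM Ms; have hs : has_sup (range s) by apply: bounded_gauge_has_sup; exists M.
apply/le_anti/andP; split; first by apply: ge_sup; [case: hs|move=> _ [n _ <-]].
apply/ler_addgt0Pr => e e0; have [n hn] := Ms e e0; rewrite -lerBlDr.
by apply: le_trans hn _; apply: ub_le_sup; [case: hs|exists n].
Qed.

(** The doubling of the index in [additive_at] disappears in the supremum. *)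
Lemma sup_gauge_additive s t u : gauge s -> gauge t -> gauge u -> additive_at s t u ->
  bounded_gauge s -> bounded_gauge t -> sup (range u) = sup (range s) + sup (range t).
Proof.
move=> gs gt gu [ust stu] bs bt.
apply: sup_unique => [n|e e0].
  apply: le_trans (ust n) _; rewrite -subr_ge0 opprD addrACA.
  by rewrite addr_ge0 // remainder_ge0.
have e2 : 0 < e / 2 by rewrite divr_gt0.
have [_ [n _ <-] hn] := sup_adherent e2 (bounded_gauge_has_sup bs).
have [_ [m _ <-] hm] := sup_adherent e2 (bounded_gauge_has_sup bt).
exists (maxn n m + maxn n m)%N; apply: le_trans (stu _).
have := gauge_le gs (leq_maxl n m); have := gauge_le gt (leq_maxr n m); lra.
Qed.

(** Subtracting from the suprema reverses [additive_at]: the sum now dominates [u] at the doubled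
    index. Unlike partial sums, tails admit no doubling inequality here, so the domain below carries
    a power of two. *)
Lemma remainder_additive s t u n : gauge s -> gauge t -> gauge u -> additive_at s t u ->
  bounded_gauge s -> bounded_gauge t ->
  remainder u (n + n)%N <= remainder s n + remainder t n <= remainder u n.
Proof.
move=> gs gt gu ad bs bt; have [ust stu] := ad.
rewrite /remainder (sup_gauge_additive gs gt gu ad bs bt).
have := ust n; have := stu n; lra.
Qed.

Lemma additive_bounded_gauge s t u : gauge t -> additive_at s t u ->
  bounded_gauge u -> bounded_gauge s.
Proof.
move=> gt [_ stu] [M uM]; exists M => n; apply: le_trans (uM (n + n)%N).
by apply: le_trans (stu n); rewrite lerDl gauge_ge0.
Qed.

Lemma additive_at_sym s t u : additive_at s t u -> additive_at t s u.
Proof. by move=> [h1 h2]; split => n; rewrite addrC. Qed.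

Lemma remainderZ (c : R) s n : 0 < c -> bounded_gauge s ->
  remainder (fun n => c * s n) n = c * remainder s n.
Proof.
move=> c0 bs; rewrite /remainder mulrBr; congr (_ - _).
have hs := bounded_gauge_has_sup bs.
apply: sup_unique => [k|e e0].
  by rewrite ler_wpM2l ?(ltW c0) //; apply: ub_le_sup; [case: hs|exists k].
have ec : 0 < e / c by rewrite divr_gt0.
have [_ [k _ <-] hk] := sup_adherent ec hs; exists k.
have := ler_wpM2l (ltW c0) (ltW hk); rewrite mulrBr (mulrC c (e / c)) divfK ?gt_eqF //.
Qed.

Variable (T : nat -> R).
Hypotheses (gT : gauge T) (bT : bounded_gauge T) (r0 : forall n, 0 < remainder T n)
  (slow : forall (k : nat) (e : R), 0 < e -> exists n, (k <= n)%N /\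
     (1 - e) * remainder T n <= remainder T (2 ^ (k + k) * n)%N).
Local Notation r := (remainder T).

(* The same means, of tails instead of partial sums. Starting at the scale k.+1
   absorbs the factor 2 ^ m that the domain J must allow in order to be stable
   under addition. *)
Lemma convergent_functional : exists Phi, singular_functional T Phi.
Proof.
(* The means use the scales [k.+1 + j] with [j <= k], hence the slow range of [k.+1 + k.+1]
   doublings. *)
have /choice[nk nkP] : forall k : nat, exists n, (k.+1 <= n)%N /\
    (1 - k.+1%:R^-1) * r n <= r (2 ^ (k.+1 + k.+1) * n)%N.
  by move=> k; apply: slow; rewrite invr_gt0 ltr0Sn.
pose v s k := k.+1%:R^-1 * (\sum_(j < k.+1) remainder s (2 ^ (k.+1 + j) * nk k)%N) / r (nk k).
have K0 (k : nat) : 0 < (k.+1%:R : R) by rewrite ltr0Sn.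
have nk0 k : (0 < nk k)%N by have [h _] := nkP k; exact: leq_trans h.
have v_le s k C : (forall j, (j < k.+1)%N -> remainder s (2 ^ (k.+1 + j) * nk k)%N <= C * r (nk k)) -> v s k <= C.
  move=> sC; rewrite /v ler_pdivrMr // ler_pdivrMl // mulr_natl -[k.+1 in leRHS]card_ord -sumr_const.
  by apply: ler_sum => j _; exact: sC.
have inv_cvg (C : R) : (fun k : nat => C * k.+1%:R^-1) @ \oo --> 0.
  by rewrite -[X in _ --> X](mulr0 C); apply: cvgM; [exact: cvg_cst|exact: cvg_harmonic].
pose J s := bounded_gauge s /\ exists (m : nat) (C : R), 0 <= C /\
   forall n, remainder s (2 ^ m * n)%N <= C * r n.
have v_ge0 s k : bounded_gauge s -> 0 <= v s k.
  move=> bs; rewrite /v divr_ge0 ?(ltW (r0 _)) // mulr_ge0 ?invr_ge0 //.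
  by apply: sumr_ge0 => j _; exact: remainder_ge0.
have J_bound s m C : gauge s -> 0 <= C -> (forall n, remainder s (2 ^ m * n)%N <= C * r n) ->
    forall k j, (m <= k)%N -> remainder s (2 ^ (k + j) * nk k)%N <= C * r (nk k).
  move=> gs C0 hC k j mk; have -> : (2 ^ (k + j) * nk k = 2 ^ m * (2 ^ (k + j - m) * nk k))%N.
    by rewrite mulnA -expnD subnKC // (leq_trans mk) ?leq_addr.
  apply: le_trans (hC _) _; rewrite ler_wpM2l // remainder_le //.
  by rewrite leq_pmull // expn_gt0.
have J_bound' s m C : gauge s -> 0 <= C -> (forall n, remainder s (2 ^ m * n)%N <= C * r n) ->
    forall k j, (m <= k)%N -> remainder s (2 ^ (k.+1 + j) * nk k)%N <= C * r (nk k).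
  by move=> gs C0 hC k j mk; rewrite addSnnS; exact: (J_bound s m).
apply: (@ultralimit_functional _ T J v) => //.
- move=> s gs [bs [m [C [C0 hC]]]]; exists C, m => k mk; rewrite v_ge0 //=.
  by apply: v_le => j jk; exact: J_bound' hC _ _ _.
- move=> c s c0 [bs [m [C [C0 hC]]]]; split.
    by have [M sM] := bs; exists (c * M) => n; rewrite ler_wpM2l // ltW.
  exists m, (c * C); split; first by rewrite mulr_ge0 // ltW.
  by move=> n; rewrite remainderZ // -mulrA ler_wpM2l // ltW.
- move=> c s c0 gs [bs _]; apply/funext => k; rewrite /v.
  under eq_bigr do rewrite remainderZ //.
  by rewrite -mulr_sumr; ring.
- move=> s t u gs gt gu ad; split.
    move=> [bu [m [C [C0 hC]]]].
    have bs := additive_bounded_gauge gt ad bu.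
    have bt := additive_bounded_gauge gs (additive_at_sym ad) bu.
    split; split => //; exists m, C; split => // n.
      have /andP[_] := remainder_additive (2 ^ m * n)%N gs gt gu ad bs bt.
      by have := hC n; have := remainder_ge0 (2 ^ m * n)%N bt; lra.
    have /andP[_] := remainder_additive (2 ^ m * n)%N gs gt gu ad bs bt.
    by have := hC n; have := remainder_ge0 (2 ^ m * n)%N bs; lra.
  move=> [[bs [m [C [C0 hC]]]] [bt [m' [C' [C'0 hC']]]]]; split.
    have [M sM] := bs; have [M' tM] := bt; exists (M + M') => n.
    by have [h _] := ad; apply: le_trans (h n) _; exact: lerD.
  (* The additional power of two pays for the doubled index in [remainder_additive]. *)
  exists (maxn m m').+1, (C + C'); split; first by rewrite addr_ge0.
  move=> n; have := remainder_additive (2 ^ (maxn m m') * n)%N gs gt gu ad bs bt.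
  rewrite addnn -mul2n mulnA -expnS => /andP[h _]; apply: le_trans h _.
  rewrite mulrDl; apply: lerD.
    apply: le_trans (hC n); apply: remainder_le => //.
    by rewrite leq_mul2r leq_exp2l // leq_maxl orbT.
  apply: le_trans (hC' n); apply: remainder_le => //.
  by rewrite leq_mul2r leq_exp2l // leq_maxr orbT.
- move=> s t u gs gt gu ad [bu [m [C [C0 hC]]]].
  have bs := additive_bounded_gauge gt ad bu.
  have bt := additive_bounded_gauge gs (additive_at_sym ad) bu.
  have bnd k : (m <= k)%N -> - (C * k.+1%:R^-1) <= v s k + v t k - v u k <= 0.
    move=> mk; pose x j := (2 ^ (k.+1 + j) * nk k)%N.
    have -> : v s k + v t k - v u k = - (k.+1%:R^-1 *
       (\sum_(j < k.+1) (remainder u (x j) - (remainder s (x j) + remainder t (x j)))) / r (nk k)).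
      by rewrite sumrB [X in _ * (_ - X)]big_split /= /v /x; ring.
    rewrite lerN2 oppr_le0; apply/andP; split; last first.
      rewrite divr_ge0 ?(ltW (r0 _)) // mulr_ge0 ?invr_ge0 //.
      apply: sumr_ge0 => j _; rewrite subr_ge0.
      by have /andP[] := remainder_additive (x j) gs gt gu ad bs bt.
    rewrite ler_pdivrMr //.
    have -> : C * k.+1%:R^-1 * r (nk k) = k.+1%:R^-1 * (C * r (nk k)) by ring.
    rewrite ler_wpM2l ?invr_ge0 //.
    apply: (@le_trans _ _ (\sum_(j < k.+1) (remainder u (x j) - remainder u (x j.+1)))).
      apply: ler_sum => j _; rewrite lerD2l lerN2.
      have /andP[h _] := remainder_additive (x j) gs gt gu ad bs bt.
      by apply: le_trans h; rewrite /x addnn -mul2n mulnA -expnS addnS.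
    rewrite -(big_mkord xpredT (fun j => remainder u (x j) - remainder u (x j.+1))).
    rewrite (telescope_sumr_eq (fun j => - remainder u (x j))) //; last by move=> j _; rewrite opprK addrC.
    rewrite opprK addrC; apply: (@le_trans _ _ (remainder u (x 0%N))).
      by rewrite gerBl remainder_ge0.
    exact: (J_bound' _ _ _ gu C0 hC).
  apply: (squeeze_cvgr (f := fun k : nat => - (C * k.+1%:R^-1)) (h := fun=> 0)).
  + by exists m => // k /= mk; exact: bnd.
  + by rewrite -oppr0; apply: cvgN; exact: inv_cvg.
  + exact: cvg_cst.
- move=> s gs [p hp].
  have sp n : s n <= s p.
    have [np|pn] := leqP n p; first exact: gauge_le.
    by rewrite (hp n) // ltnW.
  have bs : bounded_gauge s by exists (s p).
  have supE : sup (range s) = s p.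
    by apply: sup_unique => // e e0; exists p; lra.
  have R0 n : (p <= n)%N -> remainder s n = 0.
    by move=> pn; rewrite /remainder supE hp // subrr.
  have pow n m : (0 < n)%N -> (p <= 2 ^ (p + m) * n)%N.
    move=> n0; apply: (@leq_trans (2 ^ p)); first by rewrite ltnW // ltn_expl.
    by rewrite expnD -mulnA leq_pmulr // muln_gt0 expn_gt0.
  split.
    split => //; exists p, (s p / r 0%N); split; first by rewrite divr_ge0 ?(gauge_ge0 p gs) // ltW.
    move=> [|n].
      rewrite divfK ?gt_eqF // muln0 [remainder s 0]/remainder supE.
      by have [-> _] := gs; rewrite subr0.
    rewrite R0; last by have := pow n.+1 0%N isT; rewrite addn0.
    by apply: mulr_ge0; [apply: divr_ge0; [exact: gauge_ge0|exact: ltW]|exact: ltW].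
  apply: cvg_near_cst; exists p => // k /= pk.
  rewrite /v big1 ?mulr0 ?mul0r // => j _; apply: R0.
  have -> : (k.+1 + j = p + (k.+1 + j - p))%N by rewrite subnKC // (leq_trans (leqW pk)) ?leq_addr.
  exact: pow.
- by split => //; exists 0%N, 1; split => // n; rewrite mul1n mul1r.
- apply: (squeeze_cvgr (f := fun k : nat => 1 - 1 * k.+1%:R^-1) (h := fun=> 1)).
  + apply: nearW => k; apply/andP; split; last first.
      by apply: v_le => j jk; rewrite mul1r remainder_le // leq_pmull // expn_gt0.
    have [_ h] := nkP k.
    rewrite /v ler_pdivlMr //; set c := _ * r _.
    rewrite ler_pdivlMl // mulr_natl -[k.+1 in X in X <= _]card_ord -sumr_const.
    apply: ler_sum => j _; rewrite /c mul1r; apply: le_trans h _; apply: remainder_le => //.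
    by rewrite leq_mul2r leq_exp2l // leq_add2l (ltnW (ltn_ord j)) orbT.
  + by rewrite -[X in _ --> X]subr0; apply: cvgB; [exact: cvg_cst|exact: inv_cvg].
  + exact: cvg_cst.
Qed.

End convergent_case.

(** * Growth of power sums *)

Section power_growth.
Context {R : realType}.
Implicit Types (nu : nat -> R) (p s d : R).

Lemma powRDp (x r t : R) : 0 < x -> x `^ (r + t) = x `^ r * x `^ t.
Proof. by move=> x0; rewrite powRD //; apply/implyP => _; rewrite gt_eqF. Qed.

Lemma powR_base_le (r x y : R) : 0 <= r -> 0 <= x -> x <= y -> x `^ r <= y `^ r.
Proof. by move=> r0 x0 xy; rewrite ge0_ler_powR ?nnegrE // (le_trans x0). Qed.

Lemma powR_exponent_small (A g : R) : 1 <= A -> 1 < g ->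
  exists d : R, [/\ 0 < d, d < 1 & A `^ d <= g].
Proof.
move=> A1 g1; have lA := ln_ge0 A1; have lg := ln_gt0 g1.
have A0 : 0 < A by lra.
have D0 : 0 < ln A + ln g + 1 by lra.
(* The claim amounts to [d * ln A <= ln g]; the summands [ln g + 1] in the denominator force [d < 1]
   and keep it positive. *)
exists (ln g / (ln A + ln g + 1)); split; first by rewrite divr_gt0.
  by rewrite ltr_pdivrMr //; lra.
rewrite -ler_ln ?posrE ?powR_gt0 //; last by lra.
rewrite ln_powR mulrAC ler_pdivrMr //; nra.
Qed.

Lemma powR_unbounded (d M : R) : 0 < d -> exists n : nat, M < n.+1%:R `^ d.
Proof.
move=> d0; have M0 : 0 <= `|M| by [].
exists (Num.truncn (`|M| `^ d^-1)); apply: le_lt_trans (ler_norm M) _.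
have {1}-> : `|M| = (`|M| `^ d^-1) `^ d by rewrite -powRrM mulVf ?powRr1 // gt_eqF.
by rewrite gt0_ltr_powR // ?nnegrE ?powR_ge0 // truncnS_gt.
Qed.

Definition summable_at nu p := exists V : R, forall n, \sum_(i < n) nu i `^ p <= V.

(** Condensation: with [q = 2^(1 - s) < 1], the terms of indices [2i + 1] and [2i + 2] sum to at
    most [q * a i]. Hence the sum S satisfies [S <= 1 + q S], which is the bound [1 / (1 - q)]. *)
Lemma p_series s : 1 < s -> exists V : R, forall n, \sum_(i < n) i.+1%:R `^ (- s) <= V.
Proof.
move=> s1; pose a (i : nat) : R := i.+1%:R `^ (- s).
have q1 : 2 `^ (1 - s) < 1 :> R.
  by rewrite -[ltRHS](powRr0 2) -ltr_ln ?posrE ?powR_gt0 // !ln_powR mul0r nmulr_rlt0 ?ln_gt0 //; lra.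
pose q : R := 2 `^ (1 - s); rewrite -/q in q1.
have a0 i : 0 <= a i by exact: powR_ge0.
have amono i j : (i <= j)%N -> a j <= a i.
  move=> ij; rewrite /a !powRN lef_pV2 ?posrE ?powR_gt0 //.
  by rewrite powR_base_le // ?ler_nat //; lra.
have dbl i : a (i + i).+1 + a (i + i).+2 <= q * a i.
  have -> : q * a i = 2 * a (i + i).+1.
    rewrite /q /a (_ : (i + i).+2 = 2 * i.+1)%N; last by lia.
    rewrite natrM powRM // powRDp // powRr1 //; ring.
  by rewrite mulr2n mulrDl mul1r lerD2l amono.
have key n : \sum_(i < (n + n).+1) a i <= 1 + q * \sum_(i < n) a i.
  elim: n => [|n IH]; first by rewrite big_ord_recr !big_ord0 /= /a powR1 mulr0; lra.
  rewrite addSn addnS 2!big_ord_recr /= [in leRHS]big_ord_recr /= mulrDr addrA -addrA.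
  by apply: lerD.
exists (1 / (1 - q)) => n; rewrite ler_pdivlMr; last by lra.
have : \sum_(i < n) a i <= \sum_(i < (n + n).+1) a i.
  by rewrite -addnS big_split_ord /= lerDl sumr_ge0.
have := key n; lra.
Qed.

Lemma eventual_power_summable (u : nat -> R) (C s : R) (N : nat) : 0 <= C -> 1 < s ->
  (forall n, 0 <= u n) -> (forall n, (N <= n)%N -> u n <= C * n.+1%:R `^ (- s)) ->
  exists V : R, forall n, \sum_(i < n) u i <= V.
Proof.
move=> C0 s1 u0 uC; have [V hV] := p_series s1.
exists (\sum_(i < N) u i + C * V) => n.
have V0 : 0 <= V by have := hV 0%N; rewrite big_ord0.
have h1 : \sum_(i < n) (u i - C * i.+1%:R `^ (- s)) <= \sum_(i < N) u i.
  apply: (@sum_head_le R (fun i => u i - C * i.+1%:R `^ (- s)) u n N) => // i; first by move=> _; rewrite gerBl mulr_ge0 ?powR_ge0.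
  by move=> Ni; rewrite subr_le0 uC.
have h2 := ler_wpM2l C0 (hV n); move: h1; rewrite sumrB -mulr_sumr; lra.
Qed.

Lemma power_sum_term nu p V n : (forall i j, (i <= j)%N -> nu j <= nu i) ->
  (forall i, 0 <= nu i) -> 0 <= p -> \sum_(i < n.+1) nu i `^ p <= V -> n.+1%:R * nu n `^ p <= V.
Proof.
move=> dnu nu0 p0; apply: le_trans.
rewrite mulr_natl -[n.+1 in leLHS]card_ord -sumr_const; apply: ler_sum => i _.
by apply: powR_base_le => //; apply: dnu; rewrite -ltnS.
Qed.

Lemma ln_le_powR (x e : R) : 0 < x -> 0 < e -> ln x <= x `^ e / e.
Proof.
move=> x0 e0; rewrite ler_pdivlMr // mulrC -ln_powR.
by apply/ltW/ln_sublinear/powR_gt0.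
Qed.

(** Monotonicity gives [(n + 1) nu_n^al <= M ln (n + 1)], and the logarithm is at most
    [(n + 1)^e / e]. The summand 1 in [C] only makes it positive. *)
Lemma log_bound_decay nu (al M e : R) (N : nat) : (forall i j, (i <= j)%N -> nu j <= nu i) ->
  (forall i, 0 < nu i) -> 0 < al -> 0 < e ->
  (forall n, (N <= n)%N -> \sum_(i < n) nu i `^ al <= M * ln n%:R) ->
  exists2 C : R, 0 < C & forall n, (N <= n)%N -> nu n `^ al <= C * n.+1%:R `^ (e - 1).
Proof.
move=> dnu nu0 al0 e0 h; exists (`|M| / e + 1); first by rewrite ltr_wpDl // divr_ge0 // ltW.
move=> n Nn; have n0 : 0 < n.+1%:R :> R by rewrite ltr0Sn.
have nu0' i : 0 <= nu i by exact: ltW.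
have := power_sum_term dnu nu0' (ltW al0) (h n.+1 (leqW Nn)) => h1.
have l0 : 0 <= ln n.+1%:R :> R by rewrite ln_ge0 // ler1n.
have h2 : n.+1%:R * nu n `^ al <= `|M| / e * n.+1%:R `^ e.
  apply: le_trans h1 _; apply: (@le_trans _ _ (`|M| * ln n.+1%:R)).
    by rewrite ler_wpM2r // ler_norm.
  by rewrite mulrAC -mulrA ler_wpM2l // ln_le_powR.
rewrite powRDp // powRN powRr1 // mulrA ler_pdivlMr // mulrC; apply: le_trans h2 _.
by rewrite ler_wpM2r ?powR_ge0 // lerDl.
Qed.

Lemma log_bound_summable nu (al be M : R) (N : nat) : (forall i j, (i <= j)%N -> nu j <= nu i) ->
  (forall i, 0 < nu i) -> 0 < al -> al < be ->
  (forall n, (N <= n)%N -> \sum_(i < n) nu i `^ al <= M * ln n%:R) -> summable_at nu be.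
Proof.
(* This choice gives [(1 - e) * (be / al) = (be / al + 1) / 2], which exceeds 1. *)
move=> dnu nu0 al0 albe h; pose e := (1 - al / be) / 2.
have be0 : 0 < be by lra.
have ab : al / be < 1 by rewrite ltr_pdivrMr // mul1r.
have ab0 : 0 < al / be by rewrite divr_gt0.
have e0 : 0 < e by rewrite /e; lra.
have [C C0 hC] := log_bound_decay dnu nu0 al0 e0 h.
have s1 : 1 < (1 - e) * (be / al).
  have -> : (1 - e) * (be / al) = (be / al + 1) / 2.
    by rewrite /e; field; rewrite !gt_eqF.
  by have : 1 < be / al by [rewrite ltr_pdivlMr // mul1r]; lra.
apply: (@eventual_power_summable (fun n => nu n `^ be) (C `^ (be / al)) _ N _ s1).
- exact: powR_ge0.
- by move=> n; exact: powR_ge0.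
move=> n Nn; have -> : nu n `^ be = (nu n `^ al) `^ (be / al).
  by rewrite -powRrM mulrC divfK // gt_eqF.
have -> : C `^ (be / al) * n.+1%:R `^ (- ((1 - e) * (be / al))) = (C * n.+1%:R `^ (e - 1)) `^ (be / al).
  by rewrite powRM ?powR_ge0 ?(ltW C0) // -powRrM; congr (_ * _ `^ _); ring.
apply: powR_base_le; [by rewrite divr_ge0 // ltW|exact: powR_ge0|exact: hC].
Qed.

(** A substitute for Hölder's inequality. The exponent [1 - p^-1] tends to 0 as [p] decreases to 1,
    so summability for all [p > 1] excludes growth like any positive power. *)
Lemma power_sum_growth nu p V n : (forall i, 0 <= nu i) -> 1 < p ->
  \sum_(i < n.+1) nu i `^ p <= V -> psum nu n.+1 <= (1 + V) * n.+1%:R `^ (1 - p^-1).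
Proof.
move=> nu0 p1 hV; have n0 : 0 < n.+1%:R :> R by rewrite ltr0Sn.
have p0 : 0 < p by lra.
(* Comparison of nu i with the threshold (n+1)^(-1/p): either nu i is below it, or
   nu i = (nu i)^p (nu i)^(1-p) with 1 - p < 0. *)
pose la : R := n.+1%:R `^ (- p^-1).
have la0 : 0 < la by exact: powR_gt0.
have term x : 0 <= x -> x <= la + x `^ p * la `^ (1 - p).
  move=> x0; have [xla|lax] := leP x la.
    by apply: le_trans xla _; rewrite lerDl mulr_ge0 ?powR_ge0.
  have x1 : 0 < x by exact: lt_trans lax.
  have {1}-> : x = x `^ p * x `^ (1 - p).
    by rewrite -powRDp // (_ : p + (1 - p) = 1) ?powRr1 //; ring.
  apply: (@le_trans _ _ (x `^ p * la `^ (1 - p))); last by rewrite lerDr ltW.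
  rewrite ler_wpM2l ?powR_ge0 // -(opprB p 1) !powRN lef_pV2 ?posrE ?powR_gt0 //.
  by apply: powR_base_le; [lra|exact: ltW|exact: ltW].
apply: (@le_trans _ _ (\sum_(i < n.+1) (la + nu i `^ p * la `^ (1 - p)))).
  by apply: ler_sum => i _; exact: term.
rewrite big_split /= sumr_const card_ord -mulr_suml -[la *+ _]mulr_natr mulrDl mul1r.
have -> : la * n.+1%:R = n.+1%:R `^ (1 - p^-1).
  rewrite /la -{2}(powRr1 (ltW n0)) -powRDp //; congr (_ `^ _); ring.
rewrite lerD2l.
have -> : la `^ (1 - p) = n.+1%:R `^ (1 - p^-1).
  by rewrite /la -powRrM; congr (_ `^ _); field; rewrite gt_eqF.
by rewrite ler_wpM2r ?powR_ge0.
Qed.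

Lemma divn_powR_le (B n : nat) (d g : R) : (0 < B)%N -> (B <= n)%N -> 0 <= d ->
  (2 * B)%:R `^ d <= g -> n%:R `^ d <= g * (n %/ B)%:R `^ d.
Proof.
move=> B0 Bn d0 hg; have q0 : (0 < n %/ B)%N by rewrite divn_gt0.
apply: (@le_trans _ _ ((2 * B)%:R `^ d * (n %/ B)%:R `^ d)).
  rewrite -powRM // -natrM; apply: powR_base_le => //; rewrite ler_nat.
  have := ltn_pmod n B0; have := divn_eq n B; nia.
by rewrite ler_wpM2r ?powR_ge0.
Qed.

(* Growth by a fixed factor over every block would give partial sums of order at
   least n^d with d > 0, which contradicts [power_sum_growth] for p close to 1. *)
Lemma summable_slow_growth nu : (forall i j, (i <= j)%N -> nu j <= nu i) ->
  (forall i, 0 < nu i) -> (forall p, 1 < p -> summable_at nu p) ->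
  forall (k : nat) (e : R), 0 < e -> exists n, (k <= n)%N /\
    psum nu (2 ^ k * n)%N <= (1 + e) * psum nu n.
Proof.
move=> dnu nu0 hp k e e0; apply: contrapT => h.
have nu0' i : 0 <= nu i by exact: ltW.
have gT := psum_gauge nu0.
(* One doubling more than the claim requires, so that [B > 1] also for [k = 0] and the induction on
   [n %/ B] descends. *)
pose B := (2 ^ k.+1)%N; have B0 : (0 < B)%N by rewrite expn_gt0.
have B1 : (1 < B)%N by rewrite /B -[1%N]/(2 ^ 0)%N ltn_exp2l.
have grow n : (k <= n)%N -> (1 + e) * psum nu n <= psum nu (B * n)%N.
  move=> kn; rewrite leNgt; apply/negP => hn; apply: h; exists n; split => //.
  apply: le_trans (ltW hn); apply: gauge_le => //.
  by rewrite leq_mul2r leq_exp2l // leqnSn orbT.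
have A1 : 1 <= (2 * B)%:R :> R by rewrite ler1n muln_gt0.
have e1 : 1 < 1 + e by lra.
have [d [d0 d1 hd]] := powR_exponent_small A1 e1.
pose c := psum nu 1 / (B * k.+1)%:R `^ d.
have D0 : 0 < (B * k.+1)%:R `^ d :> R by rewrite powR_gt0 // ltr0n muln_gt0 B0.
have c0 : 0 < c by rewrite divr_gt0 //; exact: psum_gt0.
have lower n : (0 < n)%N -> c * n%:R `^ d <= psum nu n.
  elim/ltn_ind: n => n IH n0; have [nB|Bn] := leqP n (B * k.+1).
    apply: (@le_trans _ _ (psum nu 1)); last exact: gauge_le.
    rewrite /c mulrAC ler_pdivrMr // ler_wpM2l ?(gauge_ge0 _ gT) //.
    by apply: powR_base_le; rewrite ?(ltW d0) ?ler_nat.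
  have Bn' : (B <= n)%N by apply: leq_trans (ltnW Bn); rewrite leq_pmulr.
  have q0 : (0 < n %/ B)%N by rewrite divn_gt0.
  have kq : (k <= n %/ B)%N by rewrite leq_divRL //; apply: leq_trans (ltnW Bn); rewrite mulnC leq_mul2l leqnSn orbT.
  apply: (@le_trans _ _ (c * ((1 + e) * (n %/ B)%:R `^ d))).
    by rewrite ler_wpM2l ?(ltW c0) // divn_powR_le // ltW.
  apply: (@le_trans _ _ ((1 + e) * psum nu (n %/ B))).
    rewrite mulrCA ler_wpM2l //; first lra.
    by apply: IH => //; rewrite ltn_Pdiv.
  apply: le_trans (grow _ kq) _; apply: gauge_le => //.
  by rewrite mulnC leq_trunc_div.
(* Then [1 - p^-1 = d / 2], so the upper bound of order [n^(d/2)] meets the lower bound of order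
   [n^d]. *)
pose th := d / 2; pose p := (1 - th)^-1.
have p1 : 1 < p by rewrite /p /th -[ltLHS]invr1 ltf_pV2 ?posrE; lra.
have [V hV] := hp p p1.
have V0 : 0 <= V by have := hV 0%N; rewrite big_ord0.
have [n hn] := @powR_unbounded th ((1 + V) / c) (divr_gt0 d0 (ltr0Sn _ 1)).
have := power_sum_growth nu0' p1 (hV n.+1).
have := lower n.+1 isT.
have -> : 1 - p^-1 = th by rewrite /p invrK; ring.
have -> : d = th + th by rewrite /th; lra.
have n0 : 0 < n.+1%:R `^ th :> R by rewrite powR_gt0 // ltr0Sn.
rewrite powRDp ?ltr0Sn // mulrA => h1 h2; have := le_trans h1 h2.
rewrite ler_pM2r // leNgt mulrC -ltr_pdivrMr // hn //.
Qed.

Lemma half_bounds m : (1 < m)%N ->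
  (m %/ 2 + m %/ 2 <= m)%N /\ (m < 4 * (m %/ 2))%N.
Proof. by move=> m1; split; lia. Qed.

(* Decay by a fixed factor over every block would give nu n = O(n^(-1-d)) with
   d > 0, hence convergence of the sum of nu^p for some p < 1. *)
Lemma nonsummable_slow_decay nu : (forall i j, (i <= j)%N -> nu j <= nu i) ->
  (forall i, 0 < nu i) -> bounded_gauge (psum nu) ->
  (forall p, 0 < p -> p < 1 -> ~ summable_at nu p) ->
  forall (k : nat) (e : R), 0 < e -> exists n, (k <= n)%N /\
    (1 - e) * remainder (psum nu) n <= remainder (psum nu) (2 ^ (k + k) * n)%N.
Proof.
move=> dnu nu0 bT hp k e e0; apply: contrapT => h.
have nu0' i : 0 <= nu i by exact: ltW.
have gT := psum_gauge nu0.
have r0 n : 0 <= remainder (psum nu) n by exact: remainder_ge0.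
have e1 : e < 1.
  rewrite ltNge; apply/negP => e1; apply: h; exists k; split => //.
  apply: le_trans (r0 _); rewrite mulr_le0_ge0 //; lra.
pose B := (2 ^ (k + k).+1)%N; have B0 : (0 < B)%N by rewrite expn_gt0.
have B1 : (1 < B)%N by rewrite /B -[1%N]/(2 ^ 0)%N ltn_exp2l.
have decay n : (k <= n)%N -> remainder (psum nu) (B * n)%N <= (1 - e) * remainder (psum nu) n.
  move=> kn; rewrite leNgt; apply/negP => hn; apply: h; exists n; split => //.
  apply: le_trans (ltW hn) _; apply: remainder_le => //.
  by rewrite leq_mul2r leq_exp2l // leqnSn orbT.
have A1 : 1 <= (2 * B)%:R :> R by rewrite ler1n muln_gt0.
have g1 : 1 < (1 - e)^-1 by rewrite -[ltLHS]invr1 ltf_pV2 ?posrE; lra.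
have [d [d0 d1 hd]] := powR_exponent_small A1 g1.
pose C := remainder (psum nu) 0 * (B * k.+1)%:R `^ d.
have C0 : 0 <= C by rewrite mulr_ge0 ?powR_ge0.
have upper n : (0 < n)%N -> remainder (psum nu) n * n%:R `^ d <= C.
  elim/ltn_ind: n => n IH n0; have [nB|Bn] := leqP n (B * k.+1).
    apply: ler_pM; rewrite ?powR_ge0 //; first exact: remainder_le.
    by apply: powR_base_le; rewrite ?(ltW d0) ?ler_nat.
  have Bn' : (B <= n)%N by apply: leq_trans (ltnW Bn); rewrite leq_pmulr.
  have q0 : (0 < n %/ B)%N by rewrite divn_gt0.
  have kq : (k <= n %/ B)%N by rewrite leq_divRL //; apply: leq_trans (ltnW Bn); rewrite mulnC leq_mul2l leqnSn orbT.
  apply: (@le_trans _ _ (((1 - e) * remainder (psum nu) (n %/ B)) * ((1 - e)^-1 * (n %/ B)%:R `^ d))).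
    apply: ler_pM; rewrite ?powR_ge0 //; last by rewrite divn_powR_le // ltW.
    apply: le_trans (decay _ kq); apply: remainder_le => //.
    by rewrite mulnC leq_trunc_div.
  rewrite mulrACA mulfV ?mul1r; last by rewrite gt_eqF //; lra.
  by apply: IH => //; rewrite ltn_Pdiv.
(* The [n] terms after index [n] are each at least [nu (n + n)], and their sum is at most the tail
   at [n]. *)
have dbl n : (0 < n)%N -> nu (n + n)%N * n%:R `^ (1 + d) <= C.
  move=> n0; apply: le_trans (upper n n0); rewrite powRDp ?ltr0n // powRr1 // mulrA.
  rewrite ler_wpM2r ?powR_ge0 //.
  apply: (@le_trans _ _ (psum nu (n + n)%N - psum nu n)).
    rewrite /psum big_split_ord /= addrAC subrr add0r mulr_natr.
    have -> : nu (n + n)%N *+ n = \sum_(i < n) nu (n + n)%N by rewrite sumr_const card_ord.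
    by apply: ler_sum => i _; apply: dnu; rewrite leq_add2l ltnW.
  rewrite lerD2r; apply: ub_le_sup; last by exists (n + n)%N.
  by have [] := bounded_gauge_has_sup bT.
(* The factor 4 comes from [m + 1 <= 4 * (m %/ 2)] for [m > 1]; the summand [nu 0] handles
   [m <= 1]. *)
pose C' := 4 `^ (1 + d) * (C + nu 0%N).
have C'0 : 0 < C' by rewrite mulr_gt0 ?powR_gt0 // ltr_wpDl.
have bound m : nu m <= C' * m.+1%:R `^ (- (1 + d)).
  rewrite powRN ler_pdivlMr ?powR_gt0 ?ltr0Sn //.
  have d1' : 0 <= 1 + d by lra.
  have [m1|m2] := leqP m 1.
    rewrite mulrC; apply: ler_pM; rewrite ?powR_ge0 //.
      by apply: powR_base_le => //; rewrite ler_nat (@leq_ltn_trans 1).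
    by apply: (@le_trans _ _ (nu 0%N)); [exact: dnu|rewrite lerDr].
  pose n := (m %/ 2)%N; have n0 : (0 < n)%N by rewrite divn_gt0.
  apply: (@le_trans _ _ (nu (n + n)%N * (4 * n)%:R `^ (1 + d))).
    apply: ler_pM; rewrite ?powR_ge0 //.
      exact: dnu (half_bounds m2).1.
    by apply: powR_base_le; rewrite ?ler_nat ?ler0n ?(half_bounds m2).2.
  rewrite natrM powRM // mulrCA /C' ler_wpM2l ?powR_ge0 //.
  by apply: le_trans (dbl n n0) _; rewrite lerDl.
(* Chosen so that [p * (1 + d) = 1 + d / 2], which is above 1 although [p < 1]. *)
pose p := (1 + d / 2) / (1 + d).
have p0 : 0 < p by rewrite divr_gt0; lra.
have p1 : p < 1 by rewrite ltr_pdivrMr; lra.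
apply: (hp p p0 p1); apply: (@eventual_power_summable (fun n => nu n `^ p) (C' `^ p) (1 + d / 2) 0%N).
- exact: powR_ge0.
- lra.
- by move=> n; exact: powR_ge0.
move=> n _; have -> : C' `^ p * n.+1%:R `^ (- (1 + d / 2)) = (C' * n.+1%:R `^ (- (1 + d))) `^ p.
  rewrite powRM ?powR_ge0 ?(ltW C'0) // -powRrM; congr (_ * _ `^ _).
  by rewrite /p; field; rewrite gt_eqF //; lra.
by apply: powR_base_le => //; exact: ltW.
Qed.

Theorem exists_singular_functional nu : (forall i j, (i <= j)%N -> nu j <= nu i) ->
  (forall i, 0 < nu i) -> (forall p, 1 < p -> summable_at nu p) ->
  (forall p, 0 < p -> p < 1 -> ~ summable_at nu p) ->
  exists Phi, singular_functional (psum nu) Phi.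
Proof.
move=> dnu nu0 hp hq.
have [bT|nbT] := pselect (bounded_gauge (psum nu)).
  apply: convergent_functional => //; first exact: psum_gauge.
    move=> n; rewrite subr_gt0; apply: (@lt_le_trans _ _ (psum nu n.+1)).
      by rewrite /psum big_ord_recr /= ltrDl.
    apply: ub_le_sup; last by exists n.+1.
    by have [] := bounded_gauge_has_sup bT.
  exact: nonsummable_slow_decay.
apply: divergent_functional => //; last exact: summable_slow_growth.
move=> M; apply: contrapT => h; apply: nbT; exists M => n.
by rewrite leNgt; apply/negP => hn; apply: h; exists n.
Qed.

End power_growth.

(** * Decay rate and exponent of convergence *)

Section decay_rate.
Context {R : realType}.
Implicit Types (nu : nat -> R) (S : set R).

Definition decay_rate nu : \bar R :=
  limf_einf (fun t : R => (- ln (nu (Num.truncn (expR t))) / t)%:E) (pinfty_nbhs R).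

Lemma limf_einf_ge (F : R -> \bar R) (c : \bar R) :
  (\forall t \near +oo, (c <= F t)%E) -> (c <= limf_einf F (pinfty_nbhs R))%E.
Proof.
move=> h; rewrite limf_einfE; apply: (@le_trans _ _ (ereal_inf (F @` [set t | (c <= F t)%E]))).
  by apply: le_ereal_inf_tmp => _ [t ct <-].
by apply: ereal_sup_ubound; exists [set t | (c <= F t)%E].
Qed.

Lemma limf_einf_gt (F : R -> \bar R) (c : \bar R) :
  (c < limf_einf F (pinfty_nbhs R))%E -> \forall t \near +oo, (c <= F t)%E.
Proof.
rewrite limf_einfE => /ereal_sup_gt[_ [V FV <-] cV].
apply: filterS FV => t Vt; apply: (le_trans (ltW cV)).
by apply: ereal_inf_lbound; exists t.
Qed.

Definition summable_above nu d := forall be, d < be -> summable_at nu be.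

(** With [n] the integer part of [exp t], monotonicity gives [(n + 1) nu_n^be <= V], that is
    [t + be ln nu_n <= ln V]. The strict inequality [c * be < 1] absorbs [ln V] for large [t]. *)
Lemma summable_at_decay nu (be c : R) : (forall i j, (i <= j)%N -> nu j <= nu i) ->
  (forall i, 0 < nu i) -> 0 < be -> c * be < 1 -> summable_at nu be ->
  (c%:E <= decay_rate nu)%E.
Proof.
move=> dnu nu0 be0 cbe [V hV]; apply: limf_einf_ge.
have V0 : 0 < V.
  by apply: lt_le_trans (hV 1%N); rewrite big_ord_recl big_ord0 addr0 powR_gt0.
near=> t; have t0 : 0 < t by near: t; exact: nbhs_pinfty_gt.
have t1 : ln V <= (1 - c * be) * t.
  rewrite -ler_pdivrMl; last by lra.
  by near: t; apply: nbhs_pinfty_ge; rewrite num_real.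
have e0 := expR_gt0 t; set n := Num.truncn (expR t).
have nt : expR t < n.+1%:R by exact: truncnS_gt.
have h1 : expR t * nu n `^ be <= V.
  apply: le_trans (power_sum_term dnu (fun i => ltW (nu0 i)) (ltW be0) (hV n.+1)).
  by rewrite ler_wpM2r ?powR_ge0 // ltW.
have h2 : t + be * ln (nu n) <= ln V.
  rewrite -ln_powR -{1}(expRK t) -lnM ?posrE ?powR_gt0 //.
  by rewrite ler_ln ?posrE ?mulr_gt0 ?powR_gt0.
rewrite lee_fin ler_pdivlMr // -(ler_pM2l be0); lra.
Unshelve. all: by end_near.
Qed.

Lemma decay_rate_ge0 nu : (forall n, 0 < nu n) -> nu @ \oo --> (0 : R) -> (0 <= decay_rate nu)%E.
Proof.
move=> nu0 /cvgrPdist_lt /(_ 1 ltr01) [N _ hN]; apply: limf_einf_ge; near=> t.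
have t0 : 0 < t by near: t; exact: nbhs_pinfty_gt.
have tN : N%:R <= t by near: t; exact: nbhs_pinfty_ge.
rewrite lee_fin divr_ge0 ?(ltW t0) // oppr_ge0 ln_le0 //.
have : (N <= Num.truncn (expR t))%N.
  rewrite -ltnS -(ltr_nat R); apply: le_lt_trans tN _.
  apply: lt_trans (truncnS_gt _); have := expR_ge1Dx t; lra.
by move=> /hN; rewrite sub0r normrN gtr0_norm // => /ltW.
Unshelve. all: by end_near.
Qed.

Lemma decay_summable_at nu (c d : R) : (forall i, 0 < nu i) -> 0 < d -> 1 < c * d ->
  (c%:E < decay_rate nu)%E -> summable_at nu d.
Proof.
move=> nu0 d0 cd /limf_einf_gt[T [_ hT]].
have c0 : 0 < c by rewrite -(pmulr_lgt0 _ d0); lra.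
(* Sampling at [t = ln n] gives [nu n <= n^(-c)]. The constant replaces [n] by [n + 1], and the
   threshold ensures [n >= 2] and [ln n > T]. *)
apply: (@eventual_power_summable _ (fun n => nu n `^ d) (2 `^ (c * d)) (c * d)
  (Num.truncn (expR `|T|)).+2 _ cd).
- exact: powR_ge0.
- by move=> n; exact: powR_ge0.
move=> n nN; have n1 : 1 < n%:R :> R by rewrite ltr1n; apply: leq_trans nN.
have n0 : 0 < n%:R :> R by lra.
have Tn : T < ln n%:R.
  apply: le_lt_trans (ler_norm T) _; rewrite -ltr_expR lnK ?posrE //.
  by apply: lt_le_trans (truncnS_gt _) _; rewrite ler_nat; exact: ltnW.
have := hT _ Tn; rewrite lnK ?posrE // natrK lee_fin ler_pdivlMr ?ln_gt0 // => h.
have h1 : nu n <= n%:R `^ (- c).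
  by rewrite -ler_ln ?posrE ?powR_gt0 // ln_powR; lra.
apply: (@le_trans _ _ (n%:R `^ (- (c * d)))).
  by rewrite -mulNr powRrM; apply: powR_base_le => //; exact: ltW.
have cd0 : 0 <= c * d by lra.
rewrite !powRN -[leLHS]mul1r -ler_pdivlMr ?invr_gt0 ?powR_gt0 // invrK.
rewrite mulrAC ler_pdivlMr ?powR_gt0 ?ltr0Sn // mul1r -powRM //.
by apply: powR_base_le => //; rewrite -natrM ler_nat; case: (n) nN => // n' _; lia.
Qed.

(** [S] stands for a membership condition such as [L1oo0]: it holds at every summable exponent and
    forces summability above each of its elements, so its infimum is the exponent of convergence
    whatever happens at the boundary. *)
Lemma critical_exponent_decay nu S : (forall i j, (i <= j)%N -> nu j <= nu i) ->
  (forall i, 0 < nu i) -> nu @ \oo --> (0 : R) -> (forall d, S d -> 0 < d) ->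
  (forall d, 0 < d -> summable_at nu d -> S d) -> (forall d, S d -> summable_above nu d) ->
  ereal_inf [set d%:E | d in S] = ((decay_rate nu)^-1)%E.
Proof.
move=> dnu nu0 nu_cvg S0 sumS Ssum.
have L0 := decay_rate_ge0 nu0 nu_cvg.
have iL0 : (0 <= (decay_rate nu)^-1)%E by rewrite inve_ge0.
apply/eqP; rewrite eq_le; apply/andP; split.
  case E : (decay_rate nu)^-1%E iL0 => [r| |] // r0; last by rewrite leey.
  rewrite lee_fin in r0; apply/lee_addgt0Pr => e e0.
  have re0 : 0 < r + e by lra.
  apply: ereal_inf_lbound; exists (r + e) => //; apply: sumS => //.
  have re2 : 0 < r + e / 2 by lra.
  apply: (@decay_summable_at _ (r + e / 2)^-1) => //.
    by rewrite mulrC ltr_pdivlMr // mul1r; lra.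
  have -> : ((r + e / 2)^-1)%:E = ((r + e / 2)%:E^-1)%E by rewrite inver gt_eqF.
  rewrite inve_plt ?inE ?lee_fin ?(ltW re2) //.
  by rewrite E lte_fin; lra.
apply: le_ereal_inf_tmp => _ [d Sd <-]; have d0 := S0 _ Sd.
rewrite inve_ple ?inE ?lee_fin ?(ltW d0) //.
rewrite inver gt_eqF //; apply/lee_subgt0Pr => e e0.
rewrite -EFinB; have [ed|de] := leP (d^-1 - e) 0; first exact: le_trans L0.
(* An exponent above [d], where [Ssum] applies, with [(d^-1 - e) * be < 1] as [summable_at_decay]
   requires. *)
pose be := (d^-1 - e / 2)^-1.
have dh : 0 < d^-1 - e / 2 by lra.
have dbe : d < be by rewrite /be -[ltLHS]invrK ltf_pV2 ?posrE ?invr_gt0 //; lra.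
have be0 : 0 < be by exact: lt_trans dbe.
apply: (@summable_at_decay _ be) => //; last exact: (Ssum _ Sd _ dbe).
by rewrite /be ltr_pdivrMr // mul1r; lra.
Qed.

End decay_rate.

(** * Powers of the resolvent and the theorem *)

Section spectral_powers.
Context {R : realType} {H : hilbertType R}.
Variables (D : partial_op H) (e : nat -> H) (l : nat -> R).
Hypotheses (infH : infinite_dimensional H) (eo : onseq e) (ce : complete_seq e)
  (De : forall n, pdom D (e n) /\ papp D (e n) = (l n)%:C *: e n)
  (Dx : forall x n, pdom D x -> dotp (papp D x) (e n) = (l n)%:C * dotp x (e n))
  (dl : forall i j, (i <= j)%N -> `|l i| <= `|l j|) (l0 : forall n, l n != 0)
  (l_unbounded : forall M : R, exists n, M < `|l n|).

Let mu n : R := `|l n| `^ (- 1).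

Lemma resolvent_gt0 n : 0 < mu n.
Proof. by rewrite powR_gt0 // normr_gt0. Qed.
Local Hint Resolve resolvent_gt0 : core.

Lemma resolvent_ge0 n : 0 <= mu n.
Proof. exact: ltW. Qed.
Local Hint Resolve resolvent_ge0 : core.

Lemma resolvent_noninc i j : (i <= j)%N -> mu j <= mu i.
Proof.
by move=> ij; rewrite /mu !powR_inv1 // lef_pV2 ?posrE ?normr_gt0 // dl.
Qed.

Lemma resolvent_power_noninc s i j : 0 <= s -> (i <= j)%N -> mu j `^ s <= mu i `^ s.
Proof. by move=> s0 ij; apply: powR_base_le => //; exact: resolvent_noninc. Qed.

Lemma resolvent_power_cvg s : 0 < s -> (fun n => mu n `^ s) @ \oo --> (0 : R).
Proof.
move=> s0; apply/cvgrPdist_lt => eps eps0.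
have e1 : 0 < eps `^ s^-1 by exact: powR_gt0.
have [N hN] := l_unbounded (eps `^ s^-1)^-1; exists N => // n /= Nn.
rewrite sub0r normrN ger0_norm ?powR_ge0 //.
have -> : eps = (eps `^ s^-1) `^ s by rewrite -powRrM mulVf ?powRr1 ?(ltW eps0) ?gt_eqF.
rewrite gt0_ltr_powR ?nnegrE ?powR_ge0 // /mu powR_inv1 //.
rewrite -[ltRHS]invrK ltf_pV2 ?posrE ?invr_gt0 ?normr_gt0 //.
exact: lt_le_trans (dl Nn).
Qed.

Lemma resolvent_power_norm s i : 0 <= s -> `|mu i `^ s| <= mu 0%N `^ s.
Proof.
move=> s0; rewrite ger0_norm; last exact: powR_ge0.
by apply: (resolvent_power_noninc s0).
Qed.

Lemma abs_power_diagop s : 0 < s -> abs_power D (- s) = diagop (fun n => mu n `^ s) e.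
Proof.
move=> s0; have E n : `|l n| `^ (- s) = mu n `^ s by rewrite /mu -powRrM mulN1r.
have gM n : `| `|l n| `^ (- s) | <= mu 0%N `^ s by rewrite E resolvent_power_norm // ltW.
have := @fun_calc_diagop _ _ (fun x => `|x| `^ (- s)) _ _ _ _ eo ce De Dx gM.
by rewrite /abs_power => ->; rewrite (funext E).
Qed.

Let noninc_power s (s0 : 0 < s) : forall i j, (i <= j)%N -> mu j `^ s <= mu i `^ s.
Proof. by move=> i j; apply: resolvent_power_noninc; exact: ltW. Qed.

Let power_ge0 s n : 0 <= mu n `^ s.
Proof. exact: powR_ge0. Qed.

Let power_norm s (s0 : 0 < s) : forall i, `|mu i `^ s| <= mu 0%N `^ s.
Proof. by move=> i; apply: resolvent_power_norm; exact: ltW. Qed.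

Lemma abs_power_compact s : 0 < s -> compact_op (abs_power D (- s)).
Proof.
move=> s0; rewrite abs_power_diagop //.
exact: (diagop_compact eo (power_norm s0) (noninc_power s0) (power_ge0 s)
  (resolvent_power_cvg s0)).
Qed.

Lemma abs_op_abs_power s : 0 < s -> abs_op (abs_power D (- s)) = diagop (fun n => mu n `^ s) e.
Proof.
move=> s0; rewrite abs_power_diagop //.
exact: (abs_op_diagop_self eo (power_ge0 s) (power_norm s0)).
Qed.

Lemma mu_seq_abs_power s : 0 < s -> mu_seq (abs_power D (- s)) = fun n => mu n `^ s.
Proof.
move=> s0; exact: (mu_seq_diagop eo (noninc_power s0) (power_ge0 s)
  (resolvent_power_cvg s0) (abs_op_abs_power s0)).
Qed.

Lemma summable_abs_power_L1oo0 s : 0 < s -> summable_at mu s -> L1oo0 (abs_power D (- s)).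
Proof.
move=> s0 [V hV]; apply: (summable_L1oo0 (noninc_power s0) (power_ge0 s) (mu_seq_abs_power s0) _ hV).
exact: abs_power_compact.
Qed.

Lemma L1oo_abs_power_summable s : 0 < s -> L1oo (abs_power D (- s)) -> summable_above mu s.
Proof.
move=> s0 /(L1oo_log_bound (noninc_power s0) (power_ge0 s) (mu_seq_abs_power s0)) [M [N hN]] be sbe.
exact: (log_bound_summable resolvent_noninc resolvent_gt0 s0 sbe hN).
Qed.

Lemma L1oo0_abs_power_summable s : 0 < s -> L1oo0 (abs_power D (- s)) -> summable_above mu s.
Proof.
move=> s0 h; apply: L1oo_abs_power_summable => //.
exact: L1oo0_L1oo h.
Qed.

Lemma mu_seq_abs_resolvent : mu_seq (abs_power D (- 1)) = mu.
Proof. by rewrite mu_seq_abs_power //; apply/funext => n; rewrite powRr1. Qed.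

Lemma hausdorff_dim_d_bar : hausdorff_dim D = d_bar (abs_power D (- 1)).
Proof.
have -> : d_bar (abs_power D (- 1)) = ((decay_rate mu)^-1)%E.
  by rewrite /d_bar /mu_fun mu_seq_abs_resolvent.
apply: critical_exponent_decay => //.
- exact: resolvent_noninc.
- have := resolvent_power_cvg ltr01; apply: cvg_congr => n; exact: powRr1.
- by move=> d [].
- by move=> d d0 h; split => //; exact: summable_abs_power_L1oo0.
by move=> d [d0 h]; exact: L1oo0_abs_power_summable.
Qed.

Lemma hausdorff_dim_lt d : (hausdorff_dim D < d%:E)%E -> summable_at mu d.
Proof.
move=> /ereal_inf_lt[_ [d' [d0 h] <-]]; rewrite lte_fin.
exact: L1oo0_abs_power_summable.
Qed.

Lemma hausdorff_dim_le d : 0 < d -> summable_at mu d -> (hausdorff_dim D <= d%:E)%E.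
Proof.
move=> d0 h; apply: ereal_inf_lbound; exists d => //; split => //.
exact: summable_abs_power_L1oo0.
Qed.

(** Vanishing of the functional excludes only [al > d]. The case [al < d] is excluded by membership
    in [L1oo], which gives summability at every exponent above [al]. *)
Lemma nontrivial_functional_exponent (A : set (H -> H)) (Lim : (nat -> R) -> R) (al : R) :
  (forall a, A a -> bounded_op a) -> generalized_limit Lim -> 0 < al ->
  nontrivial_hausdorff_functional Lim A D al -> al%:E = hausdorff_dim D.
Proof.
move=> bA gL al0 [hL [a Aa]]; rewrite /hausdorff_functional => nz.
apply/eqP; rewrite eq_le; apply/andP; split; last first.
  apply/lee_addgt0Pr => eps eps0; apply: hausdorff_dim_le; first by lra.
  by apply: (L1oo_abs_power_summable al0 hL); lra.
rewrite leNgt; apply/negP => /hausdorff_dim_lt[V hV]; move/eqP: nz; apply.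
rewrite abs_power_diagop //.
apply: (dixmier_trace_summable infH gL eo (noninc_power al0) _ _ hV) => //.
  exact: resolvent_power_cvg.
exact: bA.
Qed.

(** The Ky Fan inequalities for sums are exactly [additive_at], while traciality needs no limit: the
    Ky Fan sums of the two products coincide. *)
Lemma singular_functional_trace T Phi : singular_functional T Phi ->
  @singular_trace R H (fun a => Phi (ky_fan a)).
Proof.
move=> [P0 PZ PD Pc P1].
have g (a : H -> H) : positive_op a -> gauge (ky_fan a).
  by move=> pa; split; [exact: ky_fan0|move=> n; exact: (ky_fan_mono infH)].
split.
- by move=> a /g; exact: P0.
- move=> a b pa pb; apply: PD; [exact: g|exact: g| |split].
  + apply: g; split; first exact: bounded_add pa.1 pb.1.
    by move=> x; rewrite dotpDl addr_ge0 ?pa.2 ?pb.2.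
  + by move=> n; apply: (ky_fanD_le infH); [exact: pa.1|exact: pb.1].
  + by move=> n; exact: (ky_fanD_ge infH).
- move=> c a c0 pa; rewrite -PZ //; last exact: g.
  by congr Phi; apply/funext => n; exact: (ky_fanZ infH).
- by move=> a ba; congr Phi; apply/funext => n; exact: (ky_fan_tracial infH).
move=> P fP; apply: Pc; first by apply: g; exact: projection_positive.
exact: (ky_fan_projection infH).
Qed.

(** Raising to the power [d] moves the exponent of convergence to 1, where
    [exists_singular_functional] asks for summability above 1 and its failure below 1. *)
Lemma singular_traceability (d : R) : 0 < d -> hausdorff_dim D = d%:E ->
  singular_traceability_exponent (abs_power D (- 1)) d.
Proof.
move=> d0 dE; split => //; pose nu n := mu n `^ d.
have nu_pow p n : nu n `^ p = mu n `^ (d * p) by rewrite /nu -powRrM.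
have dnu := noninc_power d0.
have [Phi hPhi] : exists Phi, singular_functional (psum nu) Phi.
  apply: exists_singular_functional => //.
  - by move=> i; exact: powR_gt0.
  - move=> p p1; have [|V hV] := @hausdorff_dim_lt (d * p).
      by rewrite dE lte_fin ltr_pMr.
    by exists V => n; under eq_bigr do rewrite nu_pow.
  move=> p p0 p1 [V hV].
  have : (hausdorff_dim D <= (d * p)%:E)%E.
    apply: hausdorff_dim_le; first exact: mulr_gt0.
    by exists V => n; under eq_bigr do rewrite -nu_pow.
  by rewrite dE lee_fin leNgt gtr_pMr // p1.
exists (fun a => Phi (ky_fan a)); first exact: singular_functional_trace hPhi.
rewrite abs_op_abs_power // (@fun_calc_diagop _ _ _ _ e mu (mu 0%N `^ d)) //=.
- have -> : ky_fan (diagop nu e) = psum nu by apply/funext => n; exact: (ky_fan_diagop infH n eo dnu (power_ge0 d)).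
  by case: hPhi => _ _ _ _ ->; rewrite onee_neq0.
- have m1 i : `|mu i `^ 1| <= mu 0%N `^ 1 by exact: resolvent_power_norm.
  by move=> n; rewrite (diagop_eigen eo m1) powRr1.
- have m1 i : `|mu i `^ 1| <= mu 0%N `^ 1 by exact: resolvent_power_norm.
  by move=> x n _; rewrite (diagop_dotp eo m1) powRr1.
by move=> n; apply: resolvent_power_norm; exact: ltW.
Qed.

End spectral_powers.

Theorem theorem2p7 (R : realType) (H : hilbertType R) (A : set (H -> H))
    (D : partial_op H) (triple : spectral_triple A D) :
  [/\ hausdorff_dim D = d_bar (abs_power D (-1)),
      (forall (Lim : (nat -> R) -> R) (al : R),
         generalized_limit Lim -> dilation_invariant Lim -> 0 < al ->
         nontrivial_hausdorff_functional Lim A D al ->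
         al%:E = hausdorff_dim D) &
      (forall d : R, 0 < d -> hausdorff_dim D = d%:E ->
         singular_traceability_exponent (abs_power D (-1)) d)].
Proof.
have [infH algA saD cD _ injD] := triple.
have [e [l [eo ce De dl [l0 lu]]]] := self_adjoint_spectral infH saD cD injD.
have Dx x n : pdom D x -> dotp (papp D x) (e n) = (l n)%:C * dotp x (e n).
  by move=> dx; apply: eigenvector_dotp => //; exact: De.
split.
- exact: (hausdorff_dim_d_bar eo ce De Dx dl l0 lu).
- move=> Lim al gL _; apply: (nontrivial_functional_exponent infH eo ce De Dx dl l0 lu) => //.
  exact: star_algebra_bounded algA.
by move=> d; exact: (singular_traceability infH eo ce De Dx dl l0 lu).
Qed.
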